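(* Let $X$ be a proper LQC space and let $\alpha$ be a quasi-geodesic ray in $X$. The following are all equivalent: (1) $\alpha$ is Morse. (2) $\alpha$ is contracting. (3) $\alpha$ has at least quadratic divergence.
   Context: $(X,d)$ is a proper geodesic metric space; quasi-geodesics are continuous. **Morse.** $\alpha$ is Morse if for every $\mathsf q\ge1,\mathsf Q\ge0$ there is $\mathsf m(\mathsf q,\mathsf Q)$ such that every $(\mathsf q,\mathsf Q)$-quasi-geodesic with endpoints on $\alpha$ stays in the $\mathsf m(\mathsf q,\mathsf Q)$-neighborhood of $\alpha$. **Contracting.** $\alpha$ is contracting if there are a map $\pi:X\to\mathcal P(\alpha)$ (subsets of $\alpha$) and constants $D_1,D_2,C_1,C_2$ with $\mathrm{diam}(\{x\}\cup\pi(x))\le(D_1+1)d(x,\alpha)+D_2$ for all $x\in X$, and $d(x,y)<C_1d(x,\alpha)\Rightarrow\mathrm{diam}(\pi(x)\cup\pi(y))\le C_2$ for all $x,y\in X$. **Divergence.** Let $\alpha:[0,\infty)\to X$ be a $(C,C)$-quasi-geodesic ray. For $0<\delta<1/C$, $A\ge C$ and $s\ge r>0$, let $\Lambda(r,s)$ be the infimal length of a path from $\alpha(s-r)$ to $\alpha(s+r)$ avoiding the open ball of radius $\delta r-A$ centered at $\alpha(s)$ ($\infty$ if there is no such path), and $\Delta_\alpha(r)=\inf_{s\ge r}\Lambda(r,s)$. $\alpha$ has at least quadratic divergence if, for some such $\delta,A$, there is $c>0$ with $\Delta_\alpha(r)\ge c\,r^2-1/c$ for all $r>0$. **LQC spaces.**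 $(X,d)$ is a coarse median space if there are $m=m_X:X^3\to X$ and $\mathsf h:\mathbb N\to\mathbb N$ such that (i) $d(m(x,y,z),m(x',y',z'))\le \mathsf h(1)(d(x,x')+d(y,y')+d(z,z'))$; (ii) for each $n$ and each $A\subseteq X$ with $|A|\le n$ there are a finite CAT(0) cube complex $Q$ and maps $f:Q\to X$, $g:A\to Q$ with $d(f(m_Q(a,b,c)),m_X(f(a),f(b),f(c)))\le \mathsf h(n)$ and $d(a,f(g(a)))\le \mathsf h(n)$. It has rank $v$ if these $Q$ can be chosen of dimension at most $v$. In a CAT(0) cube complex the median of three vertices is the unique vertex lying on combinatorial geodesics between each pair. Put $[x,y]=\{m(x,y,z):z\in X\}$, $J(A)=\bigcup_{x,y\in A}[x,y]$, $\mathrm{hull}_X(A)=J^v(A)$ in rank $v$. A map is $K$-median if it preserves medians up to additive error $K$. $X$ is locally quasi-cubical (LQC) if it is a coarse median space and there is a positive integer $v$ such that for each finite $F\subseteq X$ there are $K=K(|F|)$, a CAT(0) cube complex $Q$ of dimension $v$, and a $K$-median $(K,K)$-quasi-isometry $Q\to\mathrm{hull}_X(F)$.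
   Formalization: In the definition of contracting, the sets π(x) are required to be nonempty and the constant C_1 to be positive; without this every quasi-geodesic ray would be contracting (take π(x) empty) and the equivalence would fail. *)

(* Defs.v *)
From HB Require Import structures.
From mathcomp Require Import all_boot all_order all_algebra.
From mathcomp Require Import all_classical all_reals all_analysis.

Set Implicit Arguments.
Unset Strict Implicit.
Unset Printing Implicit Defensive.

Import Order.TTheory GRing.Theory Num.Theory.
Import numFieldNormedType.Exports.

Local Open Scope classical_set_scope.
Local Open Scope card_scope.
Local Open Scope ring_scope.

Section Metric.
Variables (R : realType) (X : metricType R).
Implicit Types (x y : X) (A : set X).

Definition proper_space := forall x (r : R), compact [set y | mdist x y <= r].

Definition geodesic_space := forall x y, exists g : R -> X,
  [/\ g 0 = x, g (mdist x y) = y &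
      forall s t, 0 <= s <= mdist x y -> 0 <= t <= mdist x y ->
        mdist (g s) (g t) = `|s - t|].

(* The infimum is meaningful only for nonempty A. *)
Definition dist_set x A : R := inf [set mdist x y | y in A].

(* -oo on the empty set; only used for nonempty sets. *)
Definition diam A : \bar R :=
  ereal_sup [set (mdist p.1 p.2)%:E | p in A `*` A].

Definition qi_bounds (q Q a b : R) := a / q - Q <= b <= q * a + Q.

Definition quasi_geodesic (q Q : R) (I : set R) (g : R -> X) :=
  [/\ 1 <= q, 0 <= Q, {within I, continuous g} &
      forall s t, I s -> I t -> qi_bounds q Q `|s - t| (mdist (g s) (g t))].

(* Rays and segments are functions on all of R whose values outside the
   domain interval are irrelevant. *)
Definition half_line : set R := [set t | 0 <= t].

Definition quasi_geodesic_ray (q Q : R) (a : R -> X) :=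
  quasi_geodesic q Q half_line a.

Definition trace (a : R -> X) : set X := a @` half_line.

Definition Morse (a : R -> X) := forall q Q : R, 1 <= q -> 0 <= Q ->
  exists m : R, forall (g : R -> X) (t0 t1 : R), t0 <= t1 ->
    quasi_geodesic q Q `[t0, t1]%classic g ->
    trace a (g t0) -> trace a (g t1) ->
    forall t, t0 <= t <= t1 -> dist_set (g t) (trace a) <= m.

(* Without nonemptiness of pi x (take pi = set0) or without 0 < C1 (take a
   closest point projection), every ray would be contracting. *)
Definition contracting (a : R -> X) :=
  exists (pi : X -> set X) (D1 D2 C1 C2 : R),
  [/\ 0 < C1,
      forall x, pi x !=set0 /\ pi x `<=` trace a,
      forall x, (diam ([set x] `|` pi x) <=
        ((D1 + 1) * dist_set x (trace a) + D2)%:E)%E &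
      forall x y, mdist x y < C1 * dist_set x (trace a) ->
        (diam (pi x `|` pi y) <= C2%:E)%E].

(* Supremum over the subdivisions 0 = t_0 < t_1 < ... < t_n = 1. *)
Definition path_length (p : R -> X) : \bar R :=
  ereal_sup [set (\sum_(i < size s)
                   mdist (p (nth 1 (0 :: s) i)) (p (nth 1 s i)))%:E
            | s in [set s : seq R | itv_partition 0 1 s]].

Definition path_avoiding x y (B : set X) : set (R -> X) :=
  [set p : R -> X | [/\ {within `[0, 1]%classic, continuous p}, p 0 = x, p 1 = y &
               forall t, 0 <= t <= 1 -> ~ B (p t)]].

(* The ball is empty when its radius is nonpositive, see ballEmdist. *)
Definition detour (a : R -> X) (delta A r s : R) : \bar R :=
  ereal_inf [set path_length p
            | p in path_avoiding (a (s - r)) (a (s + r))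
                                 (ball (a s) (delta * r - A))].

Definition divergence (a : R -> X) (delta A r : R) : \bar R :=
  ereal_inf [set detour a delta A r s | s in [set s | r <= s]].

(* C is the constant for which a is a (C, C)-quasi-geodesic ray. *)
Definition at_least_quadratic_divergence (C : R) (a : R -> X) :=
  exists delta A : R, [/\ 0 < delta, delta < 1 / C, C <= A &
    exists2 c : R, 0 < c & forall r : R, 0 < r ->
      ((c * r ^+ 2 - 1 / c)%:E <= divergence a delta A r)%E].

End Metric.

(* Faces of the combinatorial n-cube {0,1}^n: the coordinates in S are free,
   the others are those of a. *)
Definition cube_face n (a : {ffun 'I_n -> bool}) (S : {set 'I_n}) :
    set {ffun 'I_n -> bool} :=
  [set x | forall i, i \notin S -> x i = a i].

Definition has_cube_dim (V : Type) (K : set (set V)) (n : nat) (C : set V) :=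
  exists phi : {ffun 'I_n -> bool} -> V,
  [/\ injective phi, range phi = C &
      forall A : set V, A `<=` C ->
        (K A <-> exists a S, A = phi @` cube_face a S)].

(* Abstract cubical complexes: a cell is recorded by its set of vertices, so
   cells are embedded and meet in a common face, as they do in every CAT(0)
   cube complex. *)
Record cube_complex := CubeComplex {
  vertex : Type;
  cube : set (set vertex);
  cube_vertex : forall v, cube [set v];
  cubeI : forall C D, cube C -> cube D -> C `&` D !=set0 -> cube (C `&` D);
  cube_chart : forall C, cube C -> exists n, has_cube_dim cube n C }.

Section CubeComplex.
Variable Q : cube_complex.
Implicit Types (x y z : vertex Q) (p : seq (vertex Q)).

Definition adj : rel (vertex Q) :=
  fun x y => `[< x <> y /\ cube [set x; y] >].

Definition edge_path x p y := path adj x p /\ last x p = y.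

(* Homotopy of edge paths, each given as the list of all its vertices. *)
Inductive edge_homotopic : seq (vertex Q) -> seq (vertex Q) -> Prop :=
| eh_refl p : edge_homotopic p p
| eh_sym p p' : edge_homotopic p p' -> edge_homotopic p' p
| eh_trans p1 p2 p3 :
    edge_homotopic p1 p2 -> edge_homotopic p2 p3 -> edge_homotopic p1 p3
| eh_backtrack p p' x y : adj x y ->
    edge_homotopic (p ++ [:: x; y; x] ++ p') (p ++ [:: x] ++ p')
| eh_square p p' x y z w :
    adj x y -> adj y z -> adj z w -> adj w x -> cube [set x; y; z; w] ->
    edge_homotopic (p ++ [:: x; y; z] ++ p') (p ++ [:: x; w; z] ++ p').

(* Triviality of the edge-path group, which is the fundamental group of the
   realisation. *)
Definition simply_connected :=
  [/\ [set: vertex Q] !=set0,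
      forall x y, exists p, edge_path x p y &
      forall x p, edge_path x p x -> edge_homotopic (x :: p) [:: x]].

(* A simplex of the link of v is given by the neighbours of v in a cube
   containing v; the cube {v} gives the empty simplex. *)
Definition link_simplex (v : vertex Q) (s : set (vertex Q)) :=
  exists C, [/\ cube C, C v & s = [set w | C w /\ adj v w]].

Definition flag_link (v : vertex Q) := forall s : set (vertex Q),
  finite_set s -> (forall w, s w -> adj v w) ->
  (forall w w', s w -> s w' -> link_simplex v [set w; w']) ->
  link_simplex v s.

Definition CAT0_cube_complex :=
  simply_connected /\ forall v, flag_link v.

Definition finite_cube_complex := finite_set [set: vertex Q].

Definition dim_at_most (v : nat) :=
  forall n C, cube C -> has_cube_dim (@cube Q) n C -> (n <= v)%N.

Definition dim_eq (v : nat) :=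
  dim_at_most v /\ exists2 C, cube C & has_cube_dim (@cube Q) v C.

Definition edge_geodesic x p y :=
  edge_path x p y /\ forall p', edge_path x p' y -> (size p <= size p')%N.

Definition on_geodesic x y z := exists p p',
  [/\ edge_path x p z, edge_path z p' y & edge_geodesic x (p ++ p') y].

(* In a CAT(0) cube complex there is exactly one such vertex mu. *)
Definition is_median x y z mu :=
  [/\ on_geodesic x y mu, on_geodesic y z mu & on_geodesic x z mu].

Definition edge_dist (R : realType) x y : R :=
  inf [set (size p)%:R | p in [set p | edge_path x p y]].

End CubeComplex.

Section CoarseMedian.
Variables (R : realType) (X : metricType R).
Variable m : X -> X -> X -> X.
Implicit Types (A F : set X) (Q : cube_complex).

Definition median_up_to Q (K : R) (f : vertex Q -> X) :=
  forall a b c mu, is_median a b c mu ->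
    mdist (f mu) (m (f a) (f b) (f c)) <= K.

(* g is only used on A. *)
Definition cubical_approximation Q (e : R) A :=
  exists (f : vertex Q -> X) (g : X -> vertex Q),
    median_up_to e f /\ forall a, A a -> mdist a (f (g a)) <= e.

Definition coarse_median (h : nat -> nat) :=
  (forall x y z x' y' z', mdist (m x y z) (m x' y' z') <=
     (h 1%N)%:R * (mdist x x' + mdist y y' + mdist z z')) /\
  (forall (n : nat) A, A #<= `I_n ->
     exists Q, [/\ finite_cube_complex Q, CAT0_cube_complex Q &
       cubical_approximation Q (h n)%:R A]).

Definition has_rank (h : nat -> nat) (v : nat) :=
  forall (n : nat) A, A #<= `I_n ->
    exists Q, [/\ finite_cube_complex Q, CAT0_cube_complex Q,
      dim_at_most Q v & cubical_approximation Q (h n)%:R A].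

Definition med_interval (x y : X) : set X := range (m x y).

Definition med_join A : set X :=
  \bigcup_(x in A) \bigcup_(y in A) med_interval x y.

Definition hull (v : nat) A : set X := iter v med_join A.

Definition quasi_isometry Q (K : R) (H : set X) (f : vertex Q -> X) :=
  [/\ 1 <= K, forall a, H (f a),
      forall a b, qi_bounds K K (edge_dist R a b) (mdist (f a) (f b)) &
      forall y, H y -> exists a, mdist y (f a) <= K].

(* F is nonempty, since hull v set0 = set0. *)
Definition locally_cubical (v : nat) :=
  exists K : nat -> R, forall (n : nat) F, F !=set0 -> F #= `I_n ->
    exists Q, [/\ CAT0_cube_complex Q, dim_eq Q v &
      exists2 f : vertex Q -> X,
        median_up_to (K n) f & quasi_isometry (K n) (hull v F) f].

End CoarseMedian.

(* The same v is the rank (hull is only defined relative to a rank) and the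
   dimension of the cube complexes modelling hulls. *)
Definition LQC (R : realType) (X : metricType R) :=
  exists (m : X -> X -> X -> X) (h : nat -> nat) (v : nat),
  [/\ coarse_median m h, (0 < v)%N, has_rank m h v & locally_cubical m v].

(* Main.v *)
Require Import Defs.
From mathcomp Require Import all_boot all_order all_algebra.
From mathcomp Require Import all_classical all_reals all_analysis.
From mathcomp Require Import zify ring lra.
Import Order.TTheory GRing.Theory Num.Theory.

(** The three conditions are proved equivalent along the cycle contracting,
    quadratic divergence, Morse, contracting. The first two implications hold
    in every geodesic space; the cubical structure enters in the last one.

    Contracting implies quadratic divergence ([crossing_length]). A path from
    alpha (s - r) to alpha (s + r) that avoids a ball around alpha s of radius
    proportional to r has to carry its projection across s. It cannot do so
    close to the ray, where the projection moves little and stays away from s;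
    at distance r1 from the ray, of the order of r, the projection moves by a
    bounded amount whenever the path travels kappa r1 / 2. So about r moves
    are needed, each of length about r.

    Quadratic divergence implies Morse ([gap_bound]). If a quasi-geodesic with
    endpoints on the ray misses alpha s by a distance E that is almost maximal,
    then going along the ray, over to the quasi-geodesic, along it and back to
    the ray is a detour around alpha s of length linear in E, which bounds E.
    So the ray stays near the quasi-geodesic, and a connectedness argument
    ([qg_near_ray]) gives the converse.

    Morse implies contracting ([gate_contracting]). The vertices of a CAT(0)
    cube complex form a median graph, and any four points of X are seen, up to
    bounded error, in such a graph Q with a median quasi-isometric embedding f
    into X ([LQC_cubical_model]). Points of a median interval of Q lie on
    geodesics of Q, whose images are quasi-geodesics; so the Morse property
    keeps the interval between two points of the ray close to the ray, and the
    median of x, alpha 0 and alpha t is a coarse gate of x on the ray, stable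
    for large t. It is taken as the projection of x. If p and q are the gates
    of x and y in Q, the walls separating p from q cross those separating x and
    y from p and q, which gives a rectangle with base from p to q and height at
    least the distance of x to p minus that of x to y ([rectangle]). The path
    up, across and down a rectangle which is at least as wide as high is a
    quasi-geodesic with both ends near the ray but with its top as far from the
    ray as the height. Cutting the rectangle to a height at most its width, the
    Morse property shows that the height or the width is bounded: if the width
    is, the gates are close; if the height is, then x is close to the ray
    compared with the distance of x to y, unless both are bounded.

    The median graph structure is obtained from simple connectedness and flag
    links as follows. Reduced edge paths, in which no edge cancels an earlier
    one across a ladder of squares, are normal forms for homotopy classes up to
    swapping the two sides of a square, as in the solution of the word problem
    of a right-angled Coxeter group; flagness gives the confluence
    ([cancels_swap], [homotopic_run]). The quadrangle condition follows
    ([quadrangle]), then the existence of medians ([median_exists]) and the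
    description of distance and betweenness by halfspaces ([between_sep]). *)

Set Implicit Arguments.
Unset Strict Implicit.
Unset Printing Implicit Defensive.

Import numFieldNormedType.Exports.

Local Open Scope classical_set_scope.

(** * Squares and cubes in a complex with flag links *)

Section Squares.
Variable Q : cube_complex.
Notation V := (vertex Q).
Implicit Types (x y z w : V) (p q : seq V).

Lemma adjP x y : adj x y <-> x <> y /\ cube [set x; y].
Proof. by split => [/asboolP|?]; last apply/asboolP. Qed.

Lemma adj_sym x y : adj x y -> adj y x.
Proof. by move=> /adjP[xy c]; apply/adjP; rewrite setUC; split=> // /esym. Qed.

Lemma adj_neq x y : adj x y -> x <> y.
Proof. by move=> /adjP[]. Qed.

Definition square x y z w := [/\ adj x y, adj y z, adj z w & adj w x] /\
  [/\ x <> z, y <> w & cube [set x; y; z; w]].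

Lemma square_rev x y z w : square x y z w -> square x w z y.
Proof.
move=> [[xy yz zw wx] [xz yw c]]; split.
  by split; apply: adj_sym.
split=> //; first by move/esym.
suff -> : [set x; w; z; y] = [set x; y; z; w] by [].
by apply/seteqP; split => u; rewrite /setU /set1 /mkset /=; tauto.
Qed.

Lemma square_rot x y z w : square x y z w -> square y z w x.
Proof.
move=> [[xy yz zw wx] [xz yw c]]; split=> //; split=> //; first by move/esym.
suff -> : [set y; z; w; x] = [set x; y; z; w] by [].
by apply/seteqP; split => u; rewrite /setU /set1 /mkset /=; tauto.
Qed.

Definition flip n (i : 'I_n) (a : {ffun 'I_n -> bool}) : {ffun 'I_n -> bool} :=
  [ffun k => if k == i then ~~ a k else a k].

Lemma flipC n (i j : 'I_n) a : flip i (flip j a) = flip j (flip i a).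
Proof. by apply/ffunP => k; rewrite !ffunE; case: eqP; case: eqP. Qed.

Lemma flip_neq n (i : 'I_n) a : flip i a <> a.
Proof. by move/ffunP/(_ i); rewrite ffunE eqxx; case: (a i). Qed.

Lemma flip_inj n (i j : 'I_n) a : flip i a = flip j a -> i = j.
Proof.
move/ffunP/(_ i); rewrite !ffunE eqxx; case: eqP => // _.
by case: (a i).
Qed.

Lemma face_flip n (i : 'I_n) a b (S : {set 'I_n}) :
  cube_face b S a -> cube_face b S (flip i a) -> i \in S.
Proof.
move=> fa fi; case: (boolP (i \in S)) => // iS.
by have := fi i iS; rewrite ffunE eqxx (fa i iS); case: (b i).
Qed.

Lemma face_flipS n (i : 'I_n) a b (S : {set 'I_n}) :
  cube_face b S a -> i \in S -> cube_face b S (flip i a).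
Proof.
move=> fa iS k kS; rewrite ffunE; case: eqP => [ki|_]; last exact: fa.
by rewrite ki iS in kS.
Qed.

Section Chart.
Variables (n : nat) (C : set V) (phi : {ffun 'I_n -> bool} -> V).
Hypothesis phi_inj : injective phi.
Hypothesis phiC : range phi = C.
Hypothesis phi_face : forall A : set V, A `<=` C ->
        (cube A <-> exists a S, A = phi @` cube_face a S).

Let C_phi a : C (phi a). Proof. by rewrite -phiC; exists a. Qed.

Lemma chart_adj a b : adj (phi a) (phi b) -> exists i, b = flip i a.
Proof.
move=> /adjP[ab c].
have sub : [set phi a; phi b] `<=` C by move=> _ [->|->].
move/(phi_face sub): c => [d [S e]].
have mem g : cube_face d S g <-> g = a \/ g = b.
  split=> [fx|].
    have : (phi @` cube_face d S) (phi g) by exists g.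
    by rewrite -e => -[/phi_inj|/phi_inj]; [left|right].
  have eq g' : [set phi a; phi b] (phi g') -> cube_face d S g'.
    by rewrite e => -[g'' fz /phi_inj <-].
  by case=> ->; apply: eq; [left|right].
have fa : cube_face d S a by apply/mem; left.
have fb : cube_face d S b by apply/mem; right.
have [i iS abi] : exists2 i, i \in S & a i != b i.
  apply: contrapT => h; apply: ab; congr phi; apply/ffunP => i.
  case: (boolP (i \in S)) => iS; last by rewrite fa // fb.
  by apply/eqP; apply/negPn/negP => k; apply: h; exists i.
have /mem[] := face_flipS fa iS.
  by move/flip_neq.
by exists i.
Qed.

Lemma chart_adjF i a : adj (phi a) (phi (flip i a)).
Proof.
apply/adjP; split; first by move/phi_inj/esym/flip_neq.
apply/phi_face; first by move=> _ [->|->].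
exists a, [set i]%SET; rewrite eqEsubset; split => [_ [->|->]|_ [b fb <-]].
- by exists a.
- by exists (flip i a) => //; apply: face_flipS; rewrite ?inE.
have nb k : k != i -> b k = a k by move=> ki; apply: fb; rewrite inE.
case: (eqVneq (b i) (a i)) => e; [left|right]; congr phi; apply/ffunP => k.
  by case: (eqVneq k i) => [->//|/nb].
rewrite ffunE; case: (eqVneq k i) => [->|/nb//].
by move: e; case: (b i); case: (a i).
Qed.

Lemma chart_square i j a : i != j ->
  square (phi a) (phi (flip i a)) (phi (flip j (flip i a))) (phi (flip j a)).
Proof.
move=> ij; split.
  split; try exact: chart_adjF; last by apply/adj_sym/chart_adjF.
  by rewrite flipC; apply/adj_sym/chart_adjF.
split.
- move/phi_inj/ffunP/(_ i); rewrite !ffunE (negbTE ij) eqxx.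
  by case: (a i).
- by move/phi_inj/flip_inj => e; rewrite e eqxx in ij.
apply/phi_face; first by move=> _ [[[->|->]|->]|->].
exists a, [set i; j]%SET; rewrite eqEsubset; split.
  move=> _ [[[->|->]|->]|->].
  - by exists a.
  - by exists (flip i a) => //; apply: face_flipS; rewrite ?inE ?eqxx.
  - exists (flip j (flip i a)) => //.
    by do 2?apply: face_flipS; rewrite ?inE ?eqxx ?orbT.
  - by exists (flip j a) => //; apply: face_flipS; rewrite ?inE ?eqxx ?orbT.
move=> _ [b fb <-].
have nb k : k != i -> k != j -> b k = a k.
  by move=> ki kj; apply: fb; rewrite !inE (negbTE ki) (negbTE kj).
have eqb (c : {ffun 'I_n -> bool}) : b i = c i -> b j = c j ->
    (forall k, k != i -> k != j -> c k = a k) -> b = c.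
  move=> ei ej ec; apply/ffunP => k.
  case: (eqVneq k i) => [->//|ki]; case: (eqVneq k j) => [->//|kj].
  by rewrite nb // ec.
case: (eqVneq (b i) (a i)) => ei; case: (eqVneq (b j) (a j)) => ej.
- by left; left; left; rewrite (eqb a).
- right; rewrite (eqb (flip j a)) //.
  + by rewrite ffunE (negbTE ij).
  + by rewrite ffunE eqxx; move: ej; case: (b j); case: (a j).
  + by move=> k ki kj; rewrite ffunE (negbTE kj).
- left; left; right; rewrite (eqb (flip i a)) //.
  + by rewrite ffunE eqxx; move: ei; case: (b i); case: (a i).
  + by rewrite ffunE eq_sym (negbTE ij).
  + by move=> k ki kj; rewrite ffunE (negbTE ki).
- left; right; rewrite (eqb (flip j (flip i a))) //.
  + by rewrite !ffunE eqxx (negbTE ij); move: ei; case: (b i); case: (a i).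
  + rewrite !ffunE eqxx eq_sym (negbTE ij).
    by move: ej; case: (b j); case: (a j).
  + by move=> k ki kj; rewrite !ffunE (negbTE ki) (negbTE kj).
Qed.

End Chart.

(** The two squares meet in a cube containing the three vertices x, y and z,
    hence all of the first square. *)
Lemma square_uniq x y z w w' : square x y z w -> square x y z w' -> w = w'.
Proof.
move=> [[xy yz zw wx] [xz yw cC]] [[_ _ zw' wx'] [_ yw' cD]].
set C := [set x; y; z; w] in cC; set D := [set x; y; z; w'] in cD.
have cE : cube (C `&` D).
  by apply: cubeI => //; exists x; split; left; left; left.
have [n [phi [phi_inj phiC face]]] := cube_chart cC.
have C_phi a : C (phi a) by rewrite -phiC; exists a.
have EC : C `&` D `<=` C by move=> ? [].
have /(face _ EC) [d [S eS]] := cE.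
have ex u : C u -> exists a, phi a = u by rewrite -phiC => -[a _ <-]; exists a.
have [X eX] := ex x ltac:(by left; left; left).
have [Y eY] := ex y ltac:(by left; left; right).
have [Z eZ] := ex z ltac:(by left; right).
have chA := chart_adj phi_inj phiC face.
have [i ei] : exists i, X = flip i Y by apply: chA; rewrite eX eY; apply: adj_sym.
have [j ej] : exists j, Z = flip j Y by apply: chA; rewrite eZ eY.
have ij : i != j by apply/eqP => e; apply: xz; rewrite -eX -eZ ei ej e.
have fE a : (C `&` D) (phi a) -> cube_face d S a.
  by rewrite eS => -[b fb /phi_inj <-].
have fX : cube_face d S X.
  by apply: fE; rewrite eX; split; left; left; left.
have fY : cube_face d S Y.
  by apply: fE; rewrite eY; split; left; left; right.
have fZ : cube_face d S Z.
  by apply: fE; rewrite eZ; split; left; right.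
have iS : i \in S by apply: (face_flip fY); rewrite -ei.
have jS : j \in S by apply: (face_flip fY); rewrite -ej.
have fW : cube_face d S (flip j X) by apply: face_flipS.
have EW : (C `&` D) (phi (flip j X)) by rewrite eS; exists (flip j X).
have [_ [h1 h2 _]] := chart_square phi_inj phiC face X ij.
have nX : phi (flip j X) <> x by rewrite -eX => /phi_inj /flip_neq.
have nZ : phi (flip j X) <> z.
  by rewrite -eZ ej ei flipC => /phi_inj /flip_neq.
have nY : phi (flip j X) <> y.
  rewrite -eY ei => /phi_inj/ffunP/(_ i).
  by rewrite !ffunE (negbTE ij) eqxx; case: (Y i).
by have [[[[/nX|/nY]|/nZ]|<-] // [[[/nX|/nY]|/nZ]|->]] := EW.
Qed.

(** A diagonal changes two coordinates of a chart. *)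
Lemma square_Nadj x y z w : square x y z w -> ~ adj x z.
Proof.
move=> [[xy yz zw wx] [xz yw cC]].
have [n [phi [phi_inj phiC face]]] := cube_chart cC.
have ex u : [set x; y; z; w] u -> exists a, phi a = u.
  by rewrite -phiC => -[a _ <-]; exists a.
have [X eX] := ex x ltac:(by left; left; left).
have [Y eY] := ex y ltac:(by left; left; right).
have [Z eZ] := ex z ltac:(by left; right).
have chA := chart_adj phi_inj phiC face.
have [i ei] : exists i, Y = flip i X by apply: chA; rewrite eX eY.
have [j ej] : exists j, Z = flip j Y by apply: chA; rewrite eZ eY.
rewrite -eX -eZ => /chA [k].
rewrite ej ei => /ffunP e.
case: (eqVneq i j) => ij.
  apply: xz; rewrite -eX -eZ ej ei ij; congr phi; apply/ffunP => l.
  by rewrite !ffunE; case: eqP; rewrite ?negbK.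
have := e i; have := e j; rewrite !ffunE !eqxx (negbTE ij).
rewrite (eq_sym j i) (negbTE ij).
case: (eqVneq i k) => [<-|_]; last by case: (X i).
by rewrite eq_sym (negbTE ij); case: (X j).
Qed.

(** The edges from v to a, b and c pairwise span squares, so flagness puts
    them in one cube; t is opposite to v in the 3-face that they span. *)
Lemma cube_condition v a b c d e f : flag_link v ->
  square v a d b -> square v b e c -> square v a f c ->
  exists t, [/\ square a d t f, square b d t e & square c e t f].
Proof.
move=> flag s1 s2 s3.
have [[va ad db bv] [vd ab c1]] := s1.
have [[vb be ec cv] [ve bc c2]] := s2.
have [[_ af fc _] [vf ac c3]] := s3.
have link2 x y z : square v x y z -> link_simplex v [set x; z].
  move=> s; have [[vx xy yz zv] [vy xz cs]] := s.
  exists [set v; x; y; z]; split => //; first by left; left; left.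
  rewrite eqEsubset; split => u.
    by case=> ->; split => //; [left; left; right|right|exact: adj_sym].
  case=> -[[[|]|]|] -> vu.
  - by case: (adj_neq vu).
  - by left.
  - by case: (square_Nadj s).
  - by right.
have link1 x : adj v x -> link_simplex v [set x; x].
  move=> vx; have /adjP[ne cx] := vx.
  exists [set v; x]; split=> //; first by left.
  rewrite setUid eqEsubset; split => u; first by move=> ->; split => //; right.
  by case=> -[->|->] // /adj_neq.
have linkC (x y : V) : [set x; y] = [set y; x] by rewrite setUC.
have [|w|w w'|C [cC Cv eC]] := flag [set a; b; c].
- by rewrite !finite_setU; split; [split|]; exact: finite_set1.
- by move=> [[|]|] ->; [|exact: adj_sym|exact: adj_sym].
- move=> [[|]|] -> [[|]|] ->; try (by apply: link1 => //; exact: adj_sym).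
  + exact: link2 s1.
  + exact: link2 s3.
  + by rewrite linkC; exact: link2 s1.
  + exact: link2 s2.
  + by rewrite linkC; exact: link2 s3.
  + by rewrite linkC; exact: link2 s2.
have [n [phi [phi_inj phiC face]]] := cube_chart cC.
have ex u : C u -> exists a, phi a = u.
  by rewrite -phiC => -[a' _ <-]; exists a'.
have [X eX] := ex v Cv.
have chA := chart_adj phi_inj phiC face.
have nb u : [set a; b; c] u -> exists i, u = phi (flip i X).
  rewrite eC => -[Cu vu]; have [U eU] := ex u Cu.
  by move: vu; rewrite -eX -eU => /chA[i ->]; exists i.
have [i ei] := nb a ltac:(by left; left).
have [j ej] := nb b ltac:(by left; right).
have [k ek] := nb c ltac:(by right).
have ij : i != j by apply/eqP => h; apply: ab; rewrite ei ej h.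
have jk : j != k by apply/eqP => h; apply: bc; rewrite ej ek h.
have ik : i != k by apply/eqP => h; apply: ac; rewrite ei ek h.
have sq := chart_square phi_inj phiC face.
have opp (p1 p2 : 'I_n) (u : V) : p1 != p2 ->
    square v (phi (flip p1 X)) u (phi (flip p2 X)) ->
    u = phi (flip p2 (flip p1 X)).
  move=> pp su; have := sq p1 p2 X pp; rewrite eX => su'.
  move: su su' => /square_rot/square_rot/square_rot h.
  move=> /square_rot/square_rot/square_rot h'.
  exact: square_uniq h h'.
have ed : d = phi (flip j (flip i X)) by apply: opp; rewrite -?ei -?ej.
have ee : e = phi (flip k (flip j X)) by apply: opp; rewrite -?ek -?ej.
have ef : f = phi (flip k (flip i X)) by apply: opp; rewrite -?ek -?ei.
exists (phi (flip k (flip j (flip i X)))); split.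
- by rewrite ei ed ef; exact: sq.
- by rewrite ej ed ee (flipC j i); exact: sq.
- rewrite ek ee ef (flipC k j) (flipC k i) (flipC j i) (flipC k i).
  by rewrite (flipC k j); apply: sq; rewrite eq_sym.
Qed.

End Squares.

(** * Normal forms of edge paths *)

Section NormalForm.
Variable Q : cube_complex.
Notation V := (vertex Q).
Implicit Types (x y z w : V) (p q r s : seq V).
Hypothesis flag : forall v : V, flag_link v.

(** Paths are listed backwards from their last vertex, since edges are appended
    and cancelled there. *)
Inductive swap : seq V -> seq V -> Prop :=
| swap_top x y z w p : square x y z w -> swap [:: z, y, x & p] [:: z, w, x & p]
| swap_cons x p q : swap p q -> swap (x :: p) (x :: q).

Inductive swaps : seq V -> seq V -> Prop :=
| swaps_refl p : swaps p p
| swaps_step p q r : swap p q -> swaps q r -> swaps p r.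

(** The edge from the end of p to y is transported back along p through a
    ladder of squares until it meets its own opposite; q is p with this pair of
    edges removed and the part in between replaced by the other side of the
    ladder, so that it ends at y. *)
Inductive cancels : seq V -> V -> seq V -> Prop :=
| cancels_top x y p : cancels [:: x, y & p] y (y :: p)
| cancels_cons x x' y y' p q : square x' x y y' -> cancels (x' :: p) y' q ->
    cancels [:: x, x' & p] y (y :: q).

Fixpoint reduced p := if p is x :: p' then
  reduced p' /\ forall q, ~ cancels p' x q else True.

Lemma swap_sym p q : swap p q -> swap q p.
Proof.
by elim=> [x y z w r /square_rev sq|x r s _]; [apply: swap_top|apply: swap_cons].
Qed.

Lemma swaps_trans p q r : swaps p q -> swaps q r -> swaps p r.
Proof.
by elim=> // p1 p2 p3 sw _ IH /IH; apply: swaps_step.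
Qed.

Lemma swap_swaps p q : swap p q -> swaps p q.
Proof. by move=> sw; apply: swaps_step sw (swaps_refl _). Qed.

Lemma swaps_sym p q : swaps p q -> swaps q p.
Proof.
elim=> [r|p1 p2 p3 sw _ IH]; first exact: swaps_refl.
by apply: swaps_trans IH _; apply/swap_swaps/swap_sym.
Qed.

Lemma swaps_cons x p q : swaps p q -> swaps (x :: p) (x :: q).
Proof.
elim=> [r|p1 p2 p3 sw _]; first exact: swaps_refl.
by apply: swaps_step; apply: swap_cons.
Qed.

Lemma cancels_head p y q : cancels p y q -> exists q', q = y :: q'.
Proof. by case=> [x z r|x x' z y' r s _ _]; eexists. Qed.

Lemma cancels_size p y q : cancels p y q -> size p = (size q).+1.
Proof. by elim=> //= x x' z y' r s _ _ ->. Qed.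

Lemma cancels_consE x x' p y q : cancels [:: x, x' & p] y q ->
  (y = x' /\ q = x' :: p) \/
  exists y' q', [/\ square x' x y y', cancels (x' :: p) y' q' & q = y :: q'].
Proof.
move=> c; inversion c; subst; first by left.
by right; do 2!eexists; split; eauto.
Qed.

Lemma cancels_uniq p y q q' : cancels p y q -> cancels p y q' -> q = q'.
Proof.
move=> c; elim: c q' => [x z r q'|x x' z y' r s sq _ IH q'].
  move=> /cancels_consE[[]//|[y' [s []]]].
  by move=> [_ [? _]].
move=> /cancels_consE[[zx]|[y'' [s' [sq' c' ->]]]].
  by move: sq => [_ [? _]]; subst.
by move: c'; rewrite -(square_uniq sq sq') => /IH ->.
Qed.

(** The critical case is a swap inside the ladder: the cube condition then
    carries the ladder over the 3-cube spanned by the swapped corner and the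
    rung. *)
Lemma cancels_swap p p' : swap p p' -> forall y q, cancels p y q ->
  exists2 q', cancels p' y q' & swaps q q'.
Proof.
elim=> [x y0 z w p2 sq|x p1 p2 sw IH] y q.
  have zx : z <> x by have [_ [/nesym]] := sq.
  move=> /cancels_consE[[-> ->]|[y' [q1 [sq1 c1 ->]]]].
    exists [:: y0, x & p2]; last exact: swaps_refl.
    apply: (@cancels_cons _ _ _ x); last exact: cancels_top.
    exact: square_rot (square_rev sq).
  move: c1 => /cancels_consE[[e ->]|[y'' [q2 [sq2 c2 ->]]]].
    subst y'; have -> : y = w.
      have h1 := square_rot (square_rot (square_rot sq1)).
      exact: (square_uniq h1 sq).
    by exists [:: w, x & p2]; [exact: cancels_top|exact: swaps_refl].
  (* The swapped corner and two rungs of the ladder meet at y0, along its edges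
     to z, y' and x. *)
  have s1 : square y0 z y y' by [].
  have s2 : square y0 y' y'' x by have := square_rot sq2.
  have s3 : square y0 z w x by have := square_rot sq.
  have [t [t1 t2 t3]] := cube_condition (@flag y0) s1 s2 s3.
  exists [:: y, t & q2].
    apply: (@cancels_cons _ _ _ t); first exact: square_rot (square_rot (square_rot t1)).
    by apply: (@cancels_cons _ _ _ y'') => //; exact: square_rev t3.
  have [q3 ->] := cancels_head c2.
  apply: swap_swaps; apply: swap_top.
  exact: square_rot (square_rot (square_rot t2)).
move=> c.
case: p1 => [|x1 p1] in sw IH c *; first by inversion sw.
have [p3 e] : exists p3, p2 = x1 :: p3 by inversion sw; eexists.
subst p2; move: c => /cancels_consE[[-> ->]|[y' [q1 [sq1 c1 ->]]]].
  by exists (x1 :: p3); [exact: cancels_top|exact: swap_swaps].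
have [q2 c2 sw2] := IH _ _ c1.
by exists (y :: q2); [exact: cancels_cons c2|exact: swaps_cons].
Qed.

Lemma cancels_swaps p p' : swaps p p' -> forall y q, cancels p y q ->
  exists2 q', cancels p' y q' & swaps q q'.
Proof.
elim=> [r|p1 p2 p3 sw _ IH] y q c; first by exists q => //; exact: swaps_refl.
have [q2 c2 sw2] := cancels_swap sw c; have [q3 c3 sw3] := IH _ _ c2.
by exists q3 => //; exact: swaps_trans sw3.
Qed.

(** An edge that cancels after the swap is parallel, across the swapped square,
    to an edge that cancels before it. *)
Lemma reduced_swap p p' : swap p p' -> reduced p -> reduced p'.
Proof.
elim=> [x y z w p2 sq|x p1 p2 sw IH] /=.
  move=> [[rp cy] cz]; split; first split=> // q c.
    by apply: (cz (z :: q)); apply: cancels_cons c.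
  move=> q /cancels_consE[[zx _]|[y' [q1 [sq' c1 _]]]].
    by have [_ [/nesym]] := sq.
  have e : y' = y by apply: (square_uniq sq' (square_rev sq)).
  by rewrite e in c1; apply: cy c1.
move=> [r1 c1]; split; first exact: IH.
move=> q c; have [q' c' _] := cancels_swap (swap_sym sw) c.
exact: c1 c'.
Qed.

Lemma reduced_swaps p p' : swaps p p' -> reduced p -> reduced p'.
Proof. by elim=> // p1 p2 p3 /reduced_swap h _ IH /h. Qed.

(** Appending the cancelled edge again slides it across the ladder. *)
Lemma cancelsK o p y q : cancels p y q -> swaps (head o p :: q) p.
Proof.
elim=> [x z r|x x' z y' r s sq c IH] /=; first exact: swaps_refl.
have [s' e] := cancels_head c; subst s.
apply: (swaps_step (q := [:: x, x', y' & s'])).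
  by apply: swap_top; exact: square_rot (square_rev sq).
by apply: swaps_cons.
Qed.

Lemma cancels_reduced o p y q : reduced p -> cancels p y q ->
  reduced q /\ forall q', ~ cancels q (head o p) q'.
Proof. by move=> rp /(cancelsK o)/swaps_sym/reduced_swaps/(_ rp). Qed.

(** Appending an edge to a normal form. *)
Definition step p y r :=
  cancels p y r \/ (forall q, ~ cancels p y q) /\ r = y :: p.

Lemma step_total p y : exists r, step p y r.
Proof.
case: (pselect (exists q, cancels p y q)) => [[q c]|h]; first by exists q; left.
by exists (y :: p); right; split => // q c; apply: h; exists q.
Qed.

Lemma step_uniq p y r r' : step p y r -> step p y r' -> r = r'.
Proof.
move=> [c|[n ->]] [c'|[n' ->]] //; first exact: cancels_uniq c c'.
  by have := n' _ c.
by have := n _ c'.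
Qed.

Lemma step_reduced p y r : reduced p -> step p y r -> reduced r.
Proof.
by move=> rp [/(cancels_reduced y rp)[]//|[n ->]].
Qed.

Lemma step_head p y r : step p y r -> exists r', r = y :: r'.
Proof. by move=> [/cancels_head//|[_ ->]]; exists p. Qed.

Lemma step_swaps p p' y r r' : swaps p p' -> step p y r -> step p' y r' ->
  swaps r r'.
Proof.
move=> sw [c|[n ->]] [c'|[n' ->]].
- have [q c2 sw'] := cancels_swaps sw c.
  by rewrite -(cancels_uniq c2 c').
- by have [q /n'] := cancels_swaps sw c.
- by have [q /n] := cancels_swaps (swaps_sym sw) c'.
- exact: swaps_cons.
Qed.

(** Homotopy of edge paths is generated by backtracks and squares; the next
    lemmas are the corresponding invariances of normal forms. *)
Lemma step_back x p y r r' : reduced (x :: p) -> step (x :: p) y r -> step r x r' ->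
  swaps r' (x :: p).
Proof.
move=> rp [c|[n ->]] c'.
  have [_ nc] := cancels_reduced x rp c.
  by case: c' => [/nc//|[_ ->]]; exact: (cancelsK x c).
case: c' => [/(cancels_uniq (cancels_top _ _ _)) <-|[/(_ _ (cancels_top _ _ _))//]].
exact: swaps_refl.
Qed.

Lemma step_square_mixed x y z w p r1 r2 s2 : square x y z w -> reduced (x :: p) ->
  cancels (x :: p) y r1 -> (forall q, ~ cancels (x :: p) w q) ->
  step r1 z r2 -> step [:: w, x & p] z s2 -> swaps r2 s2.
Proof.
move=> sq rp cy nw h2 h4.
have [r1' er1] := cancels_head cy; subst r1.
have sw := cancelsK x cy; rewrite /= in sw.
have c : cancels [:: w, x, y & r1'] z [:: z, y & r1'].
  by apply: (cancels_cons (square_rev sq)); exact: cancels_top.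
have [s c2 sw2] := cancels_swaps (swaps_cons w sw) c.
have -> : s2 = s by apply: step_uniq h4 _; left.
case: h2 => [c1|[_ -> //]].
have [q' c' _] : exists2 q', cancels (x :: p) w q' & swaps (w :: r2) q'.
  apply: (cancels_swaps sw); apply: cancels_cons c1.
  exact: square_rot (square_rot (square_rot (square_rev sq))).
by have := nw _ c'.
Qed.

(** The cases are those of y and w cancelling or not. *)
Lemma step_square x y z w p r1 r2 s1 s2 : square x y z w -> reduced (x :: p) ->
  step (x :: p) y r1 -> step r1 z r2 -> step (x :: p) w s1 -> step s1 z s2 ->
  swaps r2 s2.
Proof.
move=> sq rp [cy|[ny ->]] h2 [cw|[nw ->]] h4.
- have [r1' er1] := cancels_head cy; subst r1.
  have [s1' c1 sw1] := cancels_swaps (swaps_sym (cancelsK x cy)) cw.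
  have yw : w <> y by have [_ [_ /nesym]] := sq.
  move: c1 => /cancels_consE[[]//|[y' [q1 [sq1 c1 es]]]].
  have e : y' = z by apply: (square_uniq sq1); exact: square_rev (square_rot sq).
  subst y' s1'; have e2 : r2 = q1 by apply: step_uniq h2 _; left.
  subst r2; have [q1' e1] := cancels_head c1.
  apply: swaps_sym; apply: (step_swaps sw1 h4).
  by left; rewrite e1; apply: cancels_top.
- exact: (step_square_mixed sq rp cy nw h2 h4).
- by apply: swaps_sym; exact: (step_square_mixed (square_rev sq) rp cw ny h4 h2).
- have e2 : r2 = [:: z, y, x & p].
    case: h2 => [c|[_ ->//]]; move: c => /cancels_consE[[zx _]|[y' [q [sq' c _]]]].
      by have [_ [/nesym]] := sq.
    have e : y' = w by apply: (square_uniq sq').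
    by rewrite e in c; have := nw _ c.
  have e4 : s2 = [:: z, w, x & p].
    case: h4 => [c|[_ ->//]]; move: c => /cancels_consE[[zx _]|[y' [q [sq' c _]]]].
      by have [_ [/nesym]] := sq.
    have e : y' = y by apply: (square_uniq sq'); exact: square_rev.
    by rewrite e in c; have := ny _ c.
  by subst r2 s2; apply/swap_swaps; apply: swap_top.
Qed.

Inductive run : seq V -> seq V -> seq V -> Prop :=
| run_nil r : run r [::] r
| run_cons r y l r1 r2 : step r y r1 -> run r1 l r2 -> run r (y :: l) r2.

Lemma run_consE r y l s : run r (y :: l) s -> exists2 r1, step r y r1 & run r1 l s.
Proof. by move=> h; inversion h; subst; exists r1. Qed.

Lemma run_uniq r l s s' : run r l s -> run r l s' -> s = s'.
Proof.
move=> h; elim: h s' => [r0 s' h'|r0 y l0 r1 r2 h1 _ IH s' /run_consE[r3 h3]].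
  by inversion h'.
by rewrite -(step_uniq h1 h3) => /IH.
Qed.

Lemma run_total r l : exists s, run r l s.
Proof.
elim: l r => [|y l IH] r; first by exists r; constructor.
have [r1 h1] := step_total r y; have [s hs] := IH r1.
by exists s; apply: run_cons hs.
Qed.

Lemma run_catE r l l' s : run r (l ++ l') s -> exists2 t, run r l t & run t l' s.
Proof.
elim: l r => [|y l IH] r /=; first by exists r => //; constructor.
move=> /run_consE[r1 H2 /IH[t h1 h2]].
by exists t => //; apply: run_cons h1.
Qed.

Lemma run_reduced r l s : reduced r -> run r l s -> reduced s.
Proof. by move=> + h; elim: h => // a y b c d /step_reduced h _ IH /h. Qed.

Lemma run_swaps r r' l s s' : swaps r r' -> run r l s -> run r' l s' -> swaps s s'.
Proof.
move=> + h; elim: h r' s' => [{}r r' s' sw h|{}r y {}l r1 r2 h1 _ IH r' s' sw h].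
  by inversion h; subst.
case/run_consE: h => r3 h2; apply: IH; exact: step_swaps sw h1 h2.
Qed.

Lemma run1E r y s : run r [:: y] s -> step r y s.
Proof. by move=> /run_consE[r1 h1 h2]; inversion h2; subst. Qed.

(** All vertices of a path, the first included, are fed to [step] starting from
    the empty list, in which nothing cancels. *)
Lemma homotopic_run l l' : edge_homotopic l l' ->
  forall s s', run [::] l s -> run [::] l' s' -> swaps s s'.
Proof.
elim=> [p s s'|p p' _ IH s s' h h'|p1 p2 p3 _ IH1 _ IH2 s1 s3 h1 h3|
        p p' x y _ s s'|p p' x y z w xy yz zw wx c s s'].
- by apply: run_swaps; exact: swaps_refl.
- by apply/swaps_sym/IH.
- have [s2 h2] := run_total [::] p2; exact: swaps_trans (IH1 _ _ h1 h2) (IH2 _ _ h2 h3).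
- move=> /run_catE[t h1 /run_catE[u h2 h3]] /run_catE[t' h1' /run_catE[u' h2' h3']].
  apply: run_swaps h3 h3'.
  case/run_consE: h2 => r1 H2 /run_consE[r2 H5 /run1E h4]; move/run1E: h2' => h2'.
  have sw1 : swaps t t' by apply: run_swaps h1 h1'; exact: swaps_refl.
  have rt := run_reduced (I : reduced [::]) h1.
  have [r1' e] := step_head H2; subst r1.
  apply: (swaps_trans (q := (x :: r1'))); first exact: step_back (step_reduced rt H2) H5 h4.
  exact: step_swaps sw1 H2 h2'.
move=> /run_catE[t h1 /run_catE[u h2 h3]] /run_catE[t' h1' /run_catE[u' h2' h3']].
apply: run_swaps h3 h3'.
case/run_consE: h2 => r1 H2 /run_consE[r2 H5 /run1E h4].
have rt := run_reduced (I : reduced [::]) h1.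
have [r1' e] := step_head H2; subst r1.
have [v hv] : exists v, run t [:: x; w; z] v by exact: run_total.
have sw1 : swaps t t' by apply: run_swaps h1 h1'; exact: swaps_refl.
apply: (swaps_trans (q := v)); last exact: run_swaps sw1 hv h2'.
case/run_consE: (hv) => r3 H6 /run_consE[r4 H9 /run1E h4'].
have e := step_uniq H6 H2; subst r3.
case: (pselect (y = w)) => [yw|yw].
  subst w; have e := step_uniq H9 H5; subst r4.
  by rewrite (step_uniq h4 h4'); exact: swaps_refl.
case: (pselect (x = z)) => [xz|xz].
  subst z.
  apply: (swaps_trans (q := (x :: r1'))); first exact: step_back (step_reduced rt H2) H5 h4.
  by apply: swaps_sym; exact: step_back (step_reduced rt H2) H9 h4'.
have sq : square x y z w by split.
exact: step_square sq (step_reduced rt H2) H5 h4 H9 h4'.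
Qed.

Inductive rpath o : seq V -> Prop :=
| rpath1 : rpath o [:: o]
| rpathS x y s : rpath o (x :: s) -> adj x y -> rpath o [:: y, x & s].

Lemma rpathE o x s : rpath o (x :: s) ->
  exists2 p, edge_path o p x & size p = size s.
Proof.
move e : (x :: s) => l h; elim: h x s e => [x s [-> ->]|y z t _ IH yz x s [-> ->]].
  by exists [::].
have [p [h1 h2] h3] := IH _ _ erefl.
exists (rcons p z); last by rewrite size_rcons h3.
by split; rewrite ?last_rcons // rcons_path h1 h2.
Qed.

Lemma rpath_cancels o s y r : cancels s y r -> rpath o s -> rpath o r.
Proof.
elim=> [x z p h|x x' z y' p q sq c IH h]; first by inversion h.
have [q' e] := cancels_head c; subst q.
apply: rpathS; last by have [[_ _ /adj_sym]] := sq.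
by apply: IH; inversion h.
Qed.

Lemma rpath_step o x s y r : rpath o (x :: s) -> adj x y -> step (x :: s) y r ->
  rpath o r.
Proof. by move=> h xy [/rpath_cancels/(_ h)|[_ ->]] //; exact: rpathS. Qed.

Lemma step_size p y r : step p y r -> (size r <= (size p).+1)%N.
Proof. by move=> [/cancels_size ->|[_ ->]] //=; lia. Qed.

Lemma run_path o x s0 p s : rpath o (x :: s0) -> path (@adj Q) x p ->
  run (x :: s0) p s -> exists s',
  [/\ s = last x p :: s', rpath o s & (size s' <= size p + size s0)%N].
Proof.
elim: p x s0 => [|y p IH] x s0 h /=.
  by move=> _ h'; inversion h'; subst; exists s0.
move=> /andP[xy yp] /run_consE[r1 H2 H4].
have [r1' e] := step_head H2; subst r1.
have [s' [-> h1 h2]] := IH _ _ (rpath_step h xy H2) yp H4.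
exists s'; split => //; have /= := step_size H2; lia.
Qed.

Lemma edge_path_run o x p s : edge_path o p x -> run [::] (o :: p) s ->
  exists s', [/\ s = x :: s', rpath o s & (size s' <= size p)%N].
Proof.
move=> [h <-] /run_consE[r1 H2 H4].
have e : r1 = [:: o] by case: H2 => [c|[_ ->]//]; inversion c.
subst r1; have [s' [-> h1 h2]] := run_path (rpath1 o) h H4.
by exists s'; split => //; move: h2; rewrite addn0.
Qed.

End NormalForm.

(** * CAT(0) cube complexes as median graphs *)

Section Graph.
Variable Q : cube_complex.
Notation V := (vertex Q).
Implicit Types (x y z w u v : V) (p q r s : seq V).

Definition has_path_of_size x y : pred nat :=
  fun n => `[< exists p, edge_path x p y /\ size p = n >].

Definition gdist x y : nat :=
  if pselect (exists n, has_path_of_size x y n) is left h then ex_minn h else 0%N.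

Lemma gdist_le x y p : edge_path x p y -> (gdist x y <= size p)%N.
Proof.
move=> h; rewrite /gdist; case: pselect => [e|//].
by case: ex_minnP => n _; apply; apply/asboolP; exists p.
Qed.

Hypothesis CAT0 : CAT0_cube_complex Q.

Let conn x y : exists p, edge_path x p y.
Proof. by have [[]] := CAT0. Qed.

Lemma gdist_path x y : exists2 p, edge_path x p y & size p = gdist x y.
Proof.
have [p h] := conn x y; rewrite /gdist; case: pselect => [e|[]]; last first.
  by exists (size p); apply/asboolP; exists p.
by case: ex_minnP => n /asboolP[q [hq sq]] _; exists q.
Qed.

Lemma edge_path_cat x y z p q : edge_path x p y -> edge_path y q z ->
  edge_path x (p ++ q) z.
Proof.
by move=> [h1 h2] [h3 h4]; split; rewrite ?last_cat ?cat_path h2 ?h1.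
Qed.

Lemma edge_path_rev x y p : edge_path x p y ->
  exists2 q, edge_path y q x & size q = size p.
Proof.
elim: p x => [|z p IH] x; first by move=> [_ /= ->]; exists [::].
move=> [/= /andP[xz h] e]; have [q hq sq] := IH z (conj h e).
exists (rcons q x); last by rewrite size_rcons sq.
by have [h1 h2] := hq; split; rewrite ?last_rcons // rcons_path h1 h2 adj_sym.
Qed.

Lemma gdist_xx x : gdist x x = 0%N.
Proof. by apply/eqP; rewrite -leqn0; apply: (@gdist_le _ _ [::]). Qed.

Lemma gdist_eq0 x y : gdist x y = 0%N -> x = y.
Proof. by have [p [h e] <-] := gdist_path x y => /size0nil e0; move: e; rewrite e0. Qed.

Lemma gdistC x y : gdist x y = gdist y x.
Proof.
suff h a b : (gdist a b <= gdist b a)%N by apply/eqP; rewrite eqn_leq !h.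
have [p hp <-] := gdist_path b a; have [q hq <-] := edge_path_rev hp.
exact: gdist_le.
Qed.

Lemma gdist_triangle y x z : (gdist x z <= gdist x y + gdist y z)%N.
Proof.
have [p hp <-] := gdist_path x y; have [q hq <-] := gdist_path y z.
by rewrite -size_cat; apply: gdist_le; exact: edge_path_cat hq.
Qed.

Lemma adj_gdist x y : adj x y -> gdist x y = 1%N.
Proof.
move=> xy; apply/eqP; rewrite eqn_leq; apply/andP; split.
  by apply: (@gdist_le _ _ [:: y]); split => //=; rewrite xy.
by rewrite lt0n; apply/eqP => /gdist_eq0; exact: adj_neq.
Qed.

Lemma gdist_adjr x y z : adj y z -> (gdist x z <= (gdist x y).+1)%N.
Proof. by move=> /adj_gdist e; rewrite -addn1 -e gdist_triangle. Qed.

Lemma gdist_pred x y : (0 < gdist x y)%N ->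
  exists2 z, adj z y & gdist x y = (gdist x z).+1.
Proof.
have [p [h1 h2] e] := gdist_path x y; rewrite -e.
case/lastP: p h1 h2 e => // p y'; rewrite last_rcons rcons_path size_rcons.
move=> /andP[hp a] yy e _; subst y'; exists (last x p) => //.
have := gdist_adjr x a; rewrite -e => h.
by have := @gdist_le x (last x p) p (conj hp erefl); move: h; lia.
Qed.

Lemma gdist_succ x y : (0 < gdist x y)%N ->
  exists2 z, adj x z & gdist x y = (gdist z y).+1.
Proof.
rewrite gdistC => /gdist_pred[z a ->]; exists z; first exact: adj_sym.
by rewrite gdistC.
Qed.

Lemma edge_homotopic_ctx a b p q : edge_homotopic p q ->
  edge_homotopic (a ++ p ++ b) (a ++ q ++ b).
Proof.
elim=> [r|p1 p2 _ IH|p1 p2 p3 _ IH1 _ IH2|p1 p2 x y xy|p1 p2 x y z w h1 h2 h3 h4 c].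
- exact: eh_refl.
- exact: eh_sym.
- exact: eh_trans IH2.
- rewrite -!catA !(catA a); exact: eh_backtrack.
- rewrite -!catA !(catA a); exact: eh_square.
Qed.

(** If r leads back from y to x, both r q and p r are loops, so p is homotopic
    to p r q and hence to q. *)
Lemma edge_paths_homotopic x y p q : edge_path x p y -> edge_path x q y ->
  edge_homotopic (x :: p) (x :: q).
Proof.
move=> hp hq; have [r hr] := conn y x; have [[_ _ loop] _] := CAT0.
apply: (@eh_trans _ _ (x :: p ++ r ++ q)).
  have := loop y _ (edge_path_cat hr hq) => /(edge_homotopic_ctx (belast x p) [::]).
  rewrite !cats0 cats1 -[rcons _ _]/(rcons _ _); have [_ <-] := hp.
  rewrite -lastI -cat_rcons -lastI; exact: eh_sym.
have := loop x _ (edge_path_cat hp hr) => /(edge_homotopic_ctx [::] q) /=.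
by rewrite -catA.
Qed.

Lemma homotopic_odd p q : edge_homotopic p q -> odd (size p) = odd (size q).
Proof.
elim=> // [p1 p2 p3 _ -> _ //|p1 p2 x y _|p1 p2 x y z w *]; last by rewrite !size_cat.
by rewrite !size_cat /= !addnS /= negbK.
Qed.

(** Homotopic paths have lengths of the same parity. *)
Lemma gdist_adj x y z : adj y z ->
  gdist x z = (gdist x y).+1 \/ gdist x y = (gdist x z).+1.
Proof.
move=> a; have h1 := gdist_adjr x a; have h2 := gdist_adjr x (adj_sym a).
suff : gdist x y <> gdist x z by lia.
have [p hp <-] := gdist_path x y; have [q hq <-] := gdist_path x z => e.
have hz : edge_path y [:: z] z by split => //=; rewrite a.
have := homotopic_odd (edge_paths_homotopic (edge_path_cat hp hz) hq).
by rewrite /= size_cat e /= addn1 /=; case: odd.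
Qed.

(** Geodesics from o to y and to w, prolonged to z, have normal forms which
    differ by swaps. The edge from z to w cancels in the second, hence in the
    first, where it first crosses the edge from y to z: this is the square. *)
Lemma quadrangle o y z w : y <> w -> adj y z -> adj w z ->
  gdist o z = (gdist o y).+1 -> gdist o z = (gdist o w).+1 ->
  exists2 x, square y z w x & gdist o y = (gdist o x).+1.
Proof.
move=> yw yz wz ey ew; have [_ flag] := CAT0.
have nf x t : adj x t -> gdist o t = (gdist o x).+1 -> exists p s,
    [/\ edge_path o p t, rpath o (x :: s), size s = gdist o x &
        run [::] (o :: p) [:: t, x & s]].
  move=> xt e; have [p hp sp] := gdist_path o x.
  have [s hs] := run_total [::] (o :: p).
  have [s' [es rs ss]] := edge_path_run hp hs; subst s.
  have sx : size s' = gdist o x.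
    apply/eqP; rewrite eqn_leq -{1}sp ss /=.
    by have [q /gdist_le + <-] := rpathE rs.
  exists (rcons p t), s'; split => //.
    have [h1 h2] := hp; split; rewrite ?last_rcons // rcons_path h1 h2.
    exact: xt.
  have [r hr] := run_total [::] (o :: rcons p t).
  have /run_catE[u hu /run1E hr'] : run [::] ((o :: p) ++ [:: t]) r.
    by rewrite cat_cons cats1.
  have eu : u = x :: s' by exact: (run_uniq hu hs).
  subst u; case: hr' => [c|[_ er]]; last by rewrite -er.
  have [r' er] := cancels_head c; subst r.
  have [q /gdist_le le eq] := rpathE (rpath_cancels c rs).
  by move: le eq (cancels_size c) => /=; lia.
have [p [s [hp rs ss rp]]] := nf y z yz ey.
have [q [t [hq rt st rq]]] := nf w z wz ew.
have sw := homotopic_run flag (edge_paths_homotopic hq hp) rq rp.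
have [r c _] := cancels_swaps flag sw (cancels_top _ _ _).
move: c => /cancels_consE[[]//|[x [s' [sq c _]]]]; first by move/esym.
exists x => //; have [r' er] := cancels_head c; subst s'.
have [q' /gdist_le le eq] := rpathE (rpath_cancels c rs).
have [[_ _ _ /(gdist_adjr o) le'] _] := sq.
by move: le le' eq (cancels_size c) => /=; lia.
Qed.

Definition between x y z := gdist x z + gdist z y = gdist x y.

Lemma betweenC x y z : between x y z -> between y x z.
Proof. by rewrite /between !(gdistC _ z) (gdistC z) (gdistC y x) addnC (gdistC x z). Qed.

Lemma between_l x y : between x y x. Proof. by rewrite /between gdist_xx. Qed.
Lemma between_r x y : between x y y. Proof. by rewrite /between gdist_xx addn0. Qed.

Lemma between_shrink x y z t : between x y z -> between x z t -> between x y t.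
Proof.
rewrite /between => h1 h2; apply/eqP; rewrite eqn_leq gdist_triangle andbT.
by have := gdist_triangle z t y; lia.
Qed.

(** If the geodesic from v to w starts by moving away from u, the induction
    hypothesis after its first vertex either concludes or makes it come back
    towards u, and then the quadrangle condition cuts the corner. *)
Lemma descent u v w : v <> w ->
  (exists v1, [/\ adj v v1, between v w v1 & gdist u v = (gdist u v1).+1]) \/
  (exists w1, [/\ adj w w1, between v w w1 & gdist u w = (gdist u w1).+1]).
Proof.
move: {2}(gdist v w) (erefl (gdist v w)) => n.
elim: n v => [|n IH] v e vw; first by have := gdist_eq0 e.
have [|v' a] := @gdist_succ v w; first by rewrite e.
rewrite e => -[e'].
have bv' : between v w v' by rewrite /between (adj_gdist a) -e' e.
have [d|d] := gdist_adj u a; last by left; exists v'.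
case: (pselect (v' = w)) => [vw'|vw'].
  subst v'; right; exists v; split => //; [exact: adj_sym|exact: between_l].
have [[v2 [a2 b2 d2]]|[w1 [a1 b1 d1]]] := IH v' (esym e') vw'; last first.
  right; exists w1; split => //; apply: betweenC.
  by apply: between_shrink (betweenC b1); exact: betweenC.
have dv2 : gdist v' w = (gdist v2 w).+1 by rewrite -b2 (adj_gdist a2).
have vv2 : v <> v2 by move=> h; move: dv2; rewrite -h e; lia.
have [|x sq dx] := @quadrangle u v v' v2 vv2 a (adj_sym a2) d; first by rewrite -d2.
left; exists x; have [[_ _ a3 a4] _] := sq; split; [exact: adj_sym| |by []].
rewrite /between; have := gdist_triangle x v w; have := gdist_triangle v2 x w.
by rewrite (gdistC x v2) (adj_gdist a3) (adj_gdist (adj_sym a4)); lia.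
Qed.

Definition median u v w m := [/\ between u v m, between v w m & between u w m].

(** As long as v and w differ, [descent] moves one of them to a neighbour which
    lies between it and the two other vertices. Medians of the smaller triple
    are medians of the original one. *)
Lemma median_exists u v w : exists m, median u v w m.
Proof.
move: {2}(_ + _)%N (leqnn (gdist u v + gdist v w + gdist u w)) => n.
elim: n v w => [|n IH] v w.
  have [->|vw] := pselect (v = w).
    by exists w; split; [exact: between_r|exact: between_r|exact: between_r].
  by rewrite leqn0 !addn_eq0 => /andP[/andP[_ /eqP/gdist_eq0]].
have [->|vw] := pselect (v = w).
  by exists w; split; [exact: between_r|exact: between_r|exact: between_r].
move=> le; have [[v1 [a b e]]|[w1 [a b e]]] := descent u vw.
  have [|m [h1 h2 h3]] := IH v1 w; first by move: le b; rewrite /between (adj_gdist a); lia.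
  have uv1 : between u v v1 by rewrite /between (gdistC v1) (adj_gdist a) e addn1.
  exists m; split => //; first exact: between_shrink h1.
  by apply: betweenC; apply: between_shrink (betweenC b) (betweenC h2).
have [|m [h1 h2 h3]] := IH v w1.
  by move: le b; rewrite /between (gdistC w1) (adj_gdist a); lia.
have uw1 : between u w w1 by rewrite /between (gdistC w1) (adj_gdist a) e addn1.
exists m; split => //; last exact: between_shrink h3.
exact: between_shrink b h2.
Qed.

Lemma on_geodesicP x y z : between x y z -> on_geodesic x y z.
Proof.
move=> b; have [p hp sp] := gdist_path x z; have [q hq sq] := gdist_path z y.
exists p, q; split => //; split; first exact: edge_path_cat hq.
by move=> r /gdist_le; rewrite size_cat sp sq b.
Qed.

Lemma medianP x y z m : median x y z m -> is_median x y z m.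
Proof. by move=> [h1 h2 h3]; split; exact: on_geodesicP. Qed.

(** Halfspaces are compared as functions, so that parallel edges have equal
    sides. *)
Definition side a b : V -> bool := fun v => (gdist v a < gdist v b)%N.

Lemma sideC a b v : adj a b -> side b a v = ~~ side a b v.
Proof.
by move=> ab; rewrite /side; case: (gdist_adj v ab) => ->; lia.
Qed.

Lemma sideE a b v : adj a b -> reflect (gdist v b = (gdist v a).+1) (side a b v).
Proof.
by move=> ab; apply: (iffP idP); rewrite /side; case: (gdist_adj v ab); lia.
Qed.

(** Otherwise the quadrangle condition gives a second square on the corner
    a, b, b'. *)
Let square_side_sub a b b' a' v : square a b b' a' -> side a b v -> side a' b' v.
Proof.
move=> sq; have [[ab bb' b'a' a'a] [_ ba' _]] := sq; move/(sideE v ab) => e.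
apply/negPn/negP; rewrite -(sideC v (adj_sym b'a')) => /(sideE v b'a') e'.
have e1 := gdist_adj v a'a; have e2 := gdist_adj v bb'.
have eb' : gdist v b = (gdist v b').+1 by lia.
have ab' : a <> b' by have [_ []] := sq.
have [x sx ex] := quadrangle ab' ab (adj_sym bb') e eb'.
by have := square_uniq sx sq => xa; subst x; lia.
Qed.

Lemma square_side a b b' a' : square a b b' a' -> side a b = side a' b'.
Proof.
move=> sq; have [[ab bb' b'a' a'a] _] := sq; apply/funext => v; apply/idP/idP.
  exact: square_side_sub.
apply: contraLR; rewrite -(sideC v ab) -(sideC v (adj_sym b'a')).
apply: square_side_sub; exact: square_rev (square_rot sq).
Qed.

(** The quadrangle condition, applied with base e, builds a ladder of squares
    from the edge a b to the edge c e. *)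
Lemma side_crossing a b c e : adj a b -> adj c e -> side c e a -> ~~ side c e b ->
  side a b = side c e.
Proof.
move=> ab ce; move: {2}(gdist a c) (erefl (gdist a c)) => n.
elim: n a b ab => [|n IH] a b ab ek.
all: move=> /(sideE _ ce) sa; rewrite -sideC // => /(sideE _ (adj_sym ce)) sb.
all: have ea := gdist_adj e ab; have ec := gdist_adj c ab.
all: rewrite !(gdistC c) !(gdistC e) in ea ec.
  have {ek} ac := gdist_eq0 ek; subst c.
  suff /gdist_eq0 -> : gdist b e = 0%N by [].
  by rewrite gdist_xx in sa ec; lia.
have [|c1 a1] := @gdist_succ a c; first by rewrite ek.
rewrite ek => -[e1].
have dc1 := gdist_triangle c c1 e; rewrite (adj_gdist ce) in dc1.
have dc2 := gdist_adjr e (adj_sym a1); rewrite !(gdistC e) in dc2.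
have bc1 : b <> c1 by move=> h; subst c1; lia.
have [||x sq dx] := @quadrangle e b a c1 bc1 (adj_sym ab) (adj_sym a1).
- by rewrite !(gdistC e); lia.
- by rewrite !(gdistC e); lia.
rewrite !(gdistC e) in dx.
have sq' : square a b x c1 by exact: square_rot (square_rot (square_rot (square_rev sq))).
rewrite (square_side sq'); have [[_ bx /adj_sym a2 _] _] := sq'.
apply: IH => //; first by apply/(sideE _ ce); lia.
have := gdist_adjr c (adj_sym bx); rewrite !(gdistC c) /side; lia.
Qed.

Definition halfspace (S : V -> bool) := exists a b, adj a b /\ S = side a b.
Definition separates x y (S : V -> bool) := [/\ halfspace S, S x & ~~ S y].

(** A geodesic crosses each separating halfspace exactly once, and no other. *)
Lemma separating_halfspaces x y : exists s : seq (V -> bool),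
  [/\ uniq s, size s = gdist x y & forall S, S \in s <-> separates x y S].
Proof.
move: {2}(gdist x y) (erefl (gdist x y)) => n.
elim: n y => [|n IH] y e.
  exists [::]; split; rewrite ?e // => S; split => // -[_].
  by rewrite (gdist_eq0 e) => ->.
have [|y' a e'] := @gdist_pred x y; first by rewrite e.
have [|s [us ss hs]] := IH y'; first by lia.
have sx : side y' y x by apply/sideE.
have sy' : side y' y y' by apply/(sideE _ a); rewrite gdist_xx (adj_gdist a).
have sy : ~~ side y' y y by rewrite -sideC // /side gdist_xx gdistC (adj_gdist a).
exists (side y' y :: s); split.
- by rewrite /= us andbT; apply/negP => /hs[_ _]; rewrite sy'.
- by rewrite /= ss e'.
move=> S; rewrite inE; split => [/orP[/eqP ->|/hs[hS Sx Sy']]|[hS Sx Sy]].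
- by split => //; exists y', y.
- split => //; apply/negP => Sy; have [c [d [cd eS]]] := hS.
  have := side_crossing (adj_sym a) cd; rewrite -eS => /(_ Sy Sy') eS'.
  by move: Sx; rewrite -eS' sideC // sx.
- case: (boolP (S y')) => Sy'; last by apply/orP; right; apply/hs.
  apply/orP; left; apply/eqP; have [c [d [cd eS]]] := hS.
  by have := side_crossing a cd; rewrite -eS => /(_ Sy' Sy).
Qed.

Lemma gdist_sep_le x y z w : (forall S, separates x y S -> separates z w S) ->
  (gdist x y <= gdist z w)%N.
Proof.
have [s [us <- hs]] := separating_halfspaces x y.
have [t [_ <- ht]] := separating_halfspaces z w.
by move=> h; apply: uniq_leq_size => // S /hs/h/ht.
Qed.

(** By counting: z is between x and y exactly when the halfspaces separating x
    from y are those separating x from z together with those separating z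
    from y. *)
Lemma between_sep x y z :
  (forall S, halfspace S -> S x = S y -> S z = S x) <-> between x y z.
Proof.
have [s1 [u1 e1 h1]] := separating_halfspaces x z.
have [s2 [u2 e2 h2]] := separating_halfspaces z y.
have [s3 [u3 e3 h3]] := separating_halfspaces x y.
split => [h|b S hS exy].
  apply/eqP; rewrite eqn_leq gdist_triangle andbT -e1 -e2 -e3 -size_cat.
  apply: uniq_leq_size.
    rewrite cat_uniq u1 u2 andbT /=; apply/hasPn => S /h2[_ Sz _].
    by apply/negP => /h1[_ _]; rewrite Sz.
  move=> S; rewrite mem_cat => /orP[/h1[hS Sx Sz]|/h2[hS Sz Sy]]; apply/h3.
    split => //; apply/negP => Sy; have := h S hS; rewrite Sx Sy (negbTE Sz).
    by move/(_ erefl).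
  split => //; apply/negPn/negP => Sx; have := h S hS.
  by rewrite Sz (negbTE Sx) (negbTE Sy) => /(_ erefl).
apply/eqP/negPn/negP => nz.
have sub T : T \in s3 -> T \in s1 ++ s2.
  move=> /h3[hT Tx Ty]; rewrite mem_cat; case: (boolP (T z)) => Tz.
    by apply/orP; right; apply/h2.
  by apply/orP; left; apply/h1.
have S3 : S \notin s3.
  by apply/negP => /h3[_ Sx]; rewrite -exy Sx.
have S12 : S \in s1 ++ s2.
  rewrite mem_cat; case: (boolP (S x)) => Sx.
    apply/orP; left; apply/h1; split => //.
    by move: nz; rewrite Sx; case: (S z).
  apply/orP; right; apply/h2; split => //; last by rewrite -exy.
  by move: nz; rewrite (negbTE Sx); case: (S z).
have : (size (S :: s3) <= size (s1 ++ s2))%N.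
  by apply: uniq_leq_size => [|T]; rewrite ?inE /= ?S3 // => /orP[/eqP ->|/sub].
by rewrite /= size_cat e1 e2 e3 b ltnn.
Qed.

End Graph.

(** * Rectangles in a median graph *)

Section Rectangle.
Variable Q : cube_complex.
Notation V := (vertex Q).
Implicit Types (x y z w u v p q o b : V).
Hypothesis CAT0 : CAT0_cube_complex Q.

Lemma geodesic_chain x y : exists c : nat -> V,
  [/\ c 0%N = x, c (gdist x y) = y &
      forall i j, (i <= j <= gdist x y)%N -> gdist (c i) (c j) = (j - i)%N].
Proof.
move: {2}(gdist x y) (erefl (gdist x y)) => n.
elim: n y => [|n IH] y e.
  exists (fun=> x); split => //; first exact: (gdist_eq0 CAT0 e).
  by move=> i j; rewrite e gdist_xx; lia.
have [|y' a e'] := gdist_pred CAT0 (x := x) (y := y); first by rewrite e.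
rewrite e in e'; case: e' => e'.
have [c [c0 cn cd]] := IH y' (esym e').
rewrite -e' in cn cd.
exists (fun i => if (i <= n)%N then c i else y); split => //; rewrite e ?ltnn //.
move=> i j /andP[ij jn].
have ci k : (k <= n)%N -> gdist (c k) y = (n.+1 - k)%N.
  move=> kn; have h1 := gdist_triangle CAT0 (c k) x y.
  have h2 := gdist_adjr CAT0 (c k) a.
  have h3 : gdist x (c k) = k by rewrite -c0 cd ?subn0 // leq0n.
  have h4 : gdist (c k) y' = (n - k)%N by rewrite -cn cd // kn leqnn.
  by move: h1 h2; rewrite h3 h4 e; lia.
case: (leqP j n) => jn'; first by rewrite (leq_trans ij jn') cd // ij jn'.
have -> : j = n.+1 by lia.
case: (leqP i n) => [/ci //|ni].
by rewrite gdist_xx; lia.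
Qed.

Lemma between_at x y i : (i <= gdist x y)%N ->
  exists2 z, between x y z & gdist x z = i.
Proof.
move=> le; have [c [c0 cn cd]] := geodesic_chain x y.
have h1 : gdist x (c i) = i by rewrite -{1}c0 cd ?subn0 // leq0n.
exists (c i) => //; rewrite /between h1 -{1}cn cd ?leqnn ?le //; lia.
Qed.

(** Geodesics from a to b and from b to c form a geodesic from a to c. *)
Lemma gdist_cat a b c z z' : between a c b -> between a b z -> between b c z' ->
  gdist z z' = (gdist z b + gdist b z')%N.
Proof.
rewrite /between => h1 h2 h3; apply/eqP; rewrite eqn_leq (gdist_triangle CAT0 b).
have := gdist_triangle CAT0 z a c; have := gdist_triangle CAT0 z' z c; lia.
Qed.

Definition majority (a b c : bool) := (a && b) || (b && c) || (a && c).

Lemma median_majority x y z m S : median x y z m -> halfspace S ->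
  S m = majority (S x) (S y) (S z).
Proof.
move=> [/(between_sep CAT0) h1 /(between_sep CAT0) h2 /(between_sep CAT0) h3] hS.
move: (h1 S hS) (h2 S hS) (h3 S hS); rewrite /majority.
case: (S x); case: (S y); case: (S z); case: (S m) => //= h h' h'';
  first [exact: h | exact: h' | exact: h''].
Qed.

(** The vertices p and q are the gates of x and y on the interval between o and
    b. On a halfspace that separates o from b, p agrees with x and q with y; on
    the others both agree with o. So the halfspaces separating p from q cross
    those separating p from u, where u is the top of the rectangle over p.
    The claims are checked on truth tables in the values at x, y, o, b, p1. *)
Lemma rectangle x y o b p q : median x o b p -> median y o b q ->
  exists u, [/\ between x y u, between x p u, (gdist p q <= gdist x y)%N &
  forall T, (T <= gdist u p)%N -> exists p1 q1,
  [/\ gdist p p1 = T, gdist q1 q = T & gdist p1 q1 = gdist p q] /\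
  [/\ between p q1 p1, between p1 q q1, median p1 o b p &
   forall z1 z3, between p p1 z1 -> between q1 q z3 -> (gdist p q <= gdist z1 z3)%N]].
Proof.
move=> mp mq.
have [u mu] := median_exists CAT0 x y p; have [w mw] := median_exists CAT0 x y q.
have ep S := @median_majority _ _ _ _ S mp.
have eq S := @median_majority _ _ _ _ S mq.
have eu S := @median_majority _ _ _ _ S mu.
have ew S := @median_majority _ _ _ _ S mw.
exists u; split; [by have [] := mu|by have [] := mu| |].
  apply: (gdist_sep_le CAT0) => S [hS].
  rewrite ep // eq // => h1 h2; split => //; move: h1 h2; rewrite /majority;
  by case: (S x); case: (S y); case: (S o); case: (S b).
move=> T; rewrite gdistC // => /between_at[p1 b1 e1].
have [q1 mq1] := median_exists CAT0 p1 w q.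
have eq1 S := @median_majority _ _ _ _ S mq1.
have {}b1 S (hS : halfspace S) := (between_sep CAT0 _ _ _).2 b1 S hS.
have bits (F : bool -> bool -> bool -> bool -> bool -> bool -> Prop) (S : V -> bool) :
  halfspace S ->
  (forall x y o b p1 : bool, let p := majority x o b in let q := majority y o b in
    let u := majority x y p in let w := majority x y q in
    let q1 := majority p1 w q in (p = u -> p1 = p) ->
    F p q p1 q1 o b) -> F (S p) (S q) (S p1) (S q1) (S o) (S b).
  move=> hS h; have := h (S x) (S y) (S o) (S b) (S p1).
  rewrite /= -(ep S hS) -(eq S hS) -(eu S hS) -(ew S hS) -(eq1 S hS); apply; exact: b1.
have eT : gdist q1 q = T.
  rewrite -e1 (gdistC CAT0 q1); apply/eqP; rewrite eqn_leq.
  apply/andP; split; apply: (gdist_sep_le CAT0) => S [hS h1 h2]; split => //; move: h1 h2.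
  - refine (bits (fun (p q p1 q1 : bool) _ _ => q -> ~~ q1 -> p) S hS _).
    by move=> [] [] [] [] [] /= h //; have := h erefl.
  - refine (bits (fun (p q p1 q1 : bool) _ _ => q -> ~~ q1 -> ~~ p1) S hS _).
    by move=> [] [] [] [] [] /= h //; have := h erefl.
  - refine (bits (fun (p q p1 q1 : bool) _ _ => p -> ~~ p1 -> q) S hS _).
    by move=> [] [] [] [] [] /= h //; have := h erefl.
  - refine (bits (fun (p q p1 q1 : bool) _ _ => p -> ~~ p1 -> ~~ q1) S hS _).
    by move=> [] [] [] [] [] /= h //; have := h erefl.
exists p1, q1; split; split => //.
- apply/eqP; rewrite eqn_leq.
  apply/andP; split; apply: (gdist_sep_le CAT0) => S [hS h1 h2]; split => //; move: h1 h2.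
  - refine (bits (fun (p q p1 q1 : bool) _ _ => p1 -> ~~ q1 -> p) S hS _).
    by move=> [] [] [] [] [] /= h //; have := h erefl.
  - refine (bits (fun (p q p1 q1 : bool) _ _ => p1 -> ~~ q1 -> ~~ q) S hS _).
    by move=> [] [] [] [] [] /= h //; have := h erefl.
  - refine (bits (fun (p q p1 q1 : bool) _ _ => p -> ~~ q -> p1) S hS _).
    by move=> [] [] [] [] [] /= h //; have := h erefl.
  - refine (bits (fun (p q p1 q1 : bool) _ _ => p -> ~~ q -> ~~ q1) S hS _).
    by move=> [] [] [] [] [] /= h //; have := h erefl.
- apply/(between_sep CAT0) => S hS.
  refine (bits (fun (p q p1 q1 : bool) _ _ => p = q1 -> p1 = p) S hS _).
  by move=> [] [] [] [] [] /= h //; have := h erefl.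
- apply/(between_sep CAT0) => S hS.
  refine (bits (fun (p q p1 q1 : bool) _ _ => p1 = q -> q1 = p1) S hS _).
  by move=> [] [] [] [] [] /= h //; have := h erefl.
- split; apply/(between_sep CAT0) => S hS.
  + refine (bits (fun p q p1 q1 o b : bool => p1 = o -> p = p1) S hS _).
    by move=> [] [] [] [] [] /= h //; have := h erefl.
  + refine (bits (fun p q p1 q1 o b : bool => o = b -> p = o) S hS _).
    by move=> [] [] [] [] [] /= h //; have := h erefl.
  + refine (bits (fun p q p1 q1 o b : bool => p1 = b -> p = p1) S hS _).
    by move=> [] [] [] [] [] /= h //; have := h erefl.
move=> z1 z3 /(between_sep CAT0) h1 /(between_sep CAT0) h3.
apply: (gdist_sep_le CAT0) => S [hS Sp Sq].
have ep1 : S p1.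
  move: Sp Sq; refine (bits (fun p q p1 q1 o b : bool => p -> ~~ q -> p1) S hS _).
  by move=> [] [] [] [] [] /= h //; have := h erefl.
have eq3 : S q1 = false.
  move: Sp Sq; refine (bits (fun p q p1 q1 o b : bool => p -> ~~ q -> q1 = false) S hS _).
  by move=> [] [] [] [] [] /= h //; have := h erefl.
split => //; first by rewrite (h1 S hS) // Sp ep1.
by rewrite (h3 S hS) ?eq3 // (negbTE Sq).
Qed.

(** Two consecutive sides of the rectangle form a geodesic, and points on the
    two vertical sides are at distance at least D while the boundary path
    between them has length at most 2 T + D. *)
Lemma rectangle_chain p p1 q1 q T D : (T <= D)%N ->
  gdist p p1 = T -> gdist q1 q = T -> gdist p1 q1 = D ->
  between p q1 p1 -> between p1 q q1 ->
  (forall z1 z3, between p p1 z1 -> between q1 q z3 -> (D <= gdist z1 z3)%N) ->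
  exists c : nat -> V, [/\ c 0%N = p, c T = p1, c (T + D + T)%N = q &
    forall i j, (i <= j <= T + D + T)%N ->
      (gdist (c i) (c j) <= j - i <= 3 * gdist (c i) (c j))%N].
Proof.
move=> TD e1 e3 e2 b1 b2 far.
have [c1 [a1 z1 d1]] := geodesic_chain p p1.
have [c2 [a2 z2 d2]] := geodesic_chain p1 q1.
have [c3 [a3 z3 d3]] := geodesic_chain q1 q.
rewrite e1 in z1 d1; rewrite e2 in z2 d2; rewrite e3 in z3 d3.
pose c i := if (i <= T)%N then c1 i else
            if (i <= T + D)%N then c2 (i - T)%N else c3 (i - T - D)%N.
have cm1 i : (i <= T)%N -> c i = c1 i by rewrite /c => ->.
have cm2 i : (T <= i <= T + D)%N -> c i = c2 (i - T)%N.
  rewrite /c => /andP[h ->]; case: leqP => // h'.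
  by have -> : i = T by [lia]; rewrite subnn a2 z1.
have cm3 i : (T + D <= i)%N -> c i = c3 (i - T - D)%N.
  move=> h; have [e|e] : i = (T + D)%N \/ (T + D < i)%N by lia.
    by rewrite e cm2 ?addKn ?subnn ?a3 ?z2 //; lia.
  by rewrite /c; case: leqP => h1; [lia|case: leqP => //; lia].
have l1 i : (i <= T)%N -> between p p1 (c1 i) /\ gdist (c1 i) p1 = (T - i)%N.
  move=> h; have h1 : gdist (c1 i) p1 = (T - i)%N by rewrite -z1 d1 // h leqnn.
  by split => //; rewrite /between h1 e1 -{1}a1 d1 ?h //; lia.
have l2 i : (i <= D)%N -> [/\ between p1 q1 (c2 i), gdist p1 (c2 i) = i &
    gdist (c2 i) q1 = (D - i)%N].
  move=> h; have h1 : gdist (c2 i) q1 = (D - i)%N by rewrite -z2 d2 // h leqnn.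
  have h2 : gdist p1 (c2 i) = i by rewrite -{1}a2 d2 ?h //; lia.
  by split => //; rewrite /between h1 e2 h2; lia.
have l3 i : (i <= T)%N -> between q1 q (c3 i) /\ gdist q1 (c3 i) = i.
  move=> h; have h1 : gdist (c3 i) q = (T - i)%N by rewrite -z3 d3 // h leqnn.
  have h2 : gdist q1 (c3 i) = i by rewrite -{1}a3 d3 ?h //; lia.
  by split => //; rewrite /between h1 h2 e3; lia.
exists c; split.
- by rewrite cm1.
- by rewrite cm1.
- by rewrite cm3 ?leq_addr // -z3; congr c3; lia.
move=> i j /andP[ij jN].
case: (leqP j T) => jT.
  by rewrite !cm1 ?(leq_trans ij) // d1 ?ij //; lia.
case: (leqP i T) => iT.
  rewrite (cm1 i) //.
  have [bi di] := l1 i iT.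
  case: (leqP j (T + D)) => jD.
    rewrite cm2; last by lia.
    have [|bj dj _] := l2 (j - T)%N; first lia.
    by rewrite (gdist_cat b1 bi bj) di dj; lia.
  rewrite cm3; last by lia.
  have [|bj dj] := l3 (j - T - D)%N; first lia.
  have h1 := far _ _ bi bj; apply/andP; split; last lia.
  have := gdist_triangle CAT0 p1 (c1 i) (c3 (j - T - D)%N).
  have := gdist_triangle CAT0 q1 p1 (c3 (j - T - D)%N); lia.
case: (leqP j (T + D)) => jD.
  by rewrite !cm2 ?d2; lia.
rewrite (cm3 j); last lia.
have [|bj dj] := l3 (j - T - D)%N; first lia.
case: (leqP i (T + D)) => iD.
  rewrite cm2; last lia.
  have [|bi _ di] := l2 (i - T)%N; first lia.
  by rewrite (gdist_cat b2 bi bj) di dj; lia.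
rewrite cm3; last lia.
by rewrite d3; lia.
Qed.

End Rectangle.

(** * Paths and subdivisions in metric spaces *)

Local Open Scope card_scope.
Local Open Scope ring_scope.

Section MetricTools.
Variables (R : realType) (X : metricType R).
Implicit Types (s t : R).

Lemma within_continuousP (A : set R) (f : R -> X) :
  {within A, continuous f} <->
  forall x, A x -> forall e : R, 0 < e -> exists2 delta : R, 0 < delta &
    forall y, A y -> `|x - y| < delta -> mdist (f x) (f y) < e.
Proof.
split=> [/subspace_continuousP h x Ax e e0|h].
  have /metricType_numDomainType.cvgrPdist_lt/(_ e e0) := h x Ax.
  by move=> /nbhs_ballP[dl dl0 hd]; exists dl => // y Ay xy; exact: hd.
apply/subspace_continuousP => x Ax.
apply/metricType_numDomainType.cvgrPdist_lt => e e0.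
have [dl dl0 hd] := h x Ax e e0.
by apply/nbhs_ballP; exists dl => // y xy Ay; exact: hd.
Qed.

Lemma lipschitz_within_continuous (A : set R) (f : R -> X) J :
  (forall s t, A s -> A t -> mdist (f s) (f t) <= J * `|s - t|) ->
  {within A, continuous f}.
Proof.
move=> h; apply/within_continuousP => x Ax e e0.
have J0 : 0 < `|J| + 1 by rewrite ltr_wpDl.
exists (e / (`|J| + 1)); first by rewrite divr_gt0.
move=> y Ay; rewrite ltr_pdivlMr // => xy.
apply: le_lt_trans (h _ _ Ax Ay) (le_lt_trans _ xy).
by rewrite mulrC ler_wpM2l // (le_trans (ler_norm J)) // lerDl.
Qed.

(** Geodesics between consecutive points are parametrised on unit intervals;
    Lipschitz bounds add up along the concatenation. *)
Lemma chain_interpolation (Xgeo : geodesic_space X) (x : nat -> X) (n : nat) (J : R) :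
  0 <= J -> (forall i, (i < n)%N -> mdist (x i) (x i.+1) <= J) ->
  exists g : R -> X, (forall i, (i <= n)%N -> g i%:R = x i) /\
    forall s t, 0 <= s <= n%:R -> 0 <= t <= n%:R ->
      mdist (g s) (g t) <= J * `|s - t|.
Proof.
move=> J0; elim: n => [|n IH] hx.
  exists (fun=> x 0%N); split => [i|s t _ _]; last by rewrite mdistxx mulr_ge0.
  by rewrite leqn0 => /eqP ->.
have [g [gx glip]] := IH (fun i h => hx i (ltnW h)).
have [e [e0 e1 elip]] := Xgeo (x n) (x n.+1).
set dn := mdist (x n) (x n.+1) in e1 elip.
have dn0 : 0 <= dn by exact: mdist_ge0.
have dnJ : dn <= J by exact: hx.
have hn : n.+1%:R = n%:R + 1 :> R by rewrite -natr1.
pose f t := if t <= n%:R then g t else e ((t - n%:R) * dn).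
have fr t : n%:R <= t -> f t = e ((t - n%:R) * dn).
  rewrite /f le_eqVlt => /orP[/eqP <-|]; last by rewrite ltNge => /negbTE ->.
  by rewrite lexx subrr mul0r e0 gx.
have wlog_lip s t : s <= t -> 0 <= s <= n.+1%:R -> 0 <= t <= n.+1%:R ->
      mdist (f s) (f t) <= J * `|s - t|.
  move=> st /andP[s0 sn] /andP[t0 tn]; rewrite distrC (@ger0_norm _ (t - s)) ?subr_ge0 //.
  have elip' a b : 0 <= a -> a <= b -> b <= 1 ->
      mdist (e (a * dn)) (e (b * dn)) <= J * (b - a).
    move=> a0 ab b1; rewrite elip.
    - rewrite -mulrBl normrM (ger0_norm dn0) distrC ger0_norm ?subr_ge0 //.
      by rewrite mulrC ler_wpM2r // subr_ge0.
    - by rewrite (mulr_ge0 a0 dn0) (ler_piMl dn0 (le_trans ab b1)).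
    - by rewrite (mulr_ge0 (le_trans a0 ab) dn0) (ler_piMl dn0 b1).
  have [tn'|/ltW tn'] := leP t n%:R.
    rewrite /f tn' (le_trans st tn') (le_trans (glip _ _ _ _)) ?s0 ?t0 ?(le_trans st) //.
    by rewrite distrC ger0_norm // subr_ge0.
  have [sn'|/ltW sn'] := leP s n%:R; last first.
    rewrite !fr //; apply: le_trans (elip' _ _ _ _ _) _; [lra|lra|lra|].
    by have -> : t - n%:R - (s - n%:R) = t - s by lra.
  apply: le_trans (metric_triangle _ (x n) _) _.
  have -> : J * (t - s) = J * (n%:R - s) + J * (t - n%:R) by ring.
  rewrite lerD //.
    rewrite /f sn' -(gx n) // (le_trans (glip _ _ _ _)) ?s0 ?sn' ?ler0n ?lexx //.
    by rewrite distrC ger0_norm // subr_ge0.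
  rewrite fr // -e0 -{1}(mul0r dn); apply: le_trans (elip' _ _ _ _ _) _; lra.
exists f; split => [i|s t hs ht].
  rewrite leq_eqVlt ltnS => /orP[/eqP ->|ni]; last by rewrite /f ler_nat ni gx.
  rewrite fr ?ler_nat //.
  by have -> : (n.+1%:R - n%:R) * dn = dn by rewrite hn; ring.
have [st|/ltW ts] := leP s t; first exact: wlog_lip.
by rewrite metric_sym distrC; exact: wlog_lip.
Qed.

Lemma path_length_lipschitz (p : R -> X) L : 0 <= L ->
  (forall s t, 0 <= s <= 1 -> 0 <= t <= 1 -> mdist (p s) (p t) <= L * `|s - t|) ->
  (path_length p <= L%:E)%E.
Proof.
move=> L0 lip; apply: ge_ereal_sup => _ [s [srt /eqP lst] <-]; rewrite lee_fin.
suff H a : 0 <= a -> path <%R a s -> last a s = 1 ->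
    \sum_(i < size s) mdist (p (nth 1 (a :: s) i)) (p (nth 1 s i)) <= L * (1 - a).
  by have := H 0 (lexx _) srt lst; rewrite subr0 mulr1.
elim: s a {srt lst} => [|b s IH] a a0 /=.
  by move=> _ ->; rewrite big_ord0 subrr mulr0.
move=> /andP[ab bs] bl; rewrite big_ord_recl /=.
have b0 := le_trans a0 (ltW ab).
have b1 : b <= 1.
  rewrite -bl; elim: s b bs {IH ab bl b0} => //= c s IH b /andP[bc cs].
  by apply: le_trans (ltW bc) (IH _ cs).
have -> : L * (1 - a) = L * (b - a) + L * (1 - b) by ring.
rewrite lerD //; last exact: IH.
apply: le_trans (lip _ _ _ _) _; rewrite ?a0 ?b0 ?(le_trans (ltW ab)) //.
by rewrite distrC ger0_norm // subr_ge0 ltW.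
Qed.

(** The supremum of the endpoints of fine subdivisions is attained, by
    continuity at that point, and can be passed unless it is 1. *)
Lemma fine_subdivision (p : R -> X) (e : R) : 0 < e ->
  {within `[0, 1]%classic, continuous p} ->
  exists (n : nat) (t : nat -> R), [/\ t 0%N = 0, t n = 1,
    forall i, (i < n)%N -> t i < t i.+1,
    forall i, (i <= n)%N -> 0 <= t i <= 1 &
    forall i, (i < n)%N -> mdist (p (t i)) (p (t i.+1)) <= e].
Proof.
move=> e0 /within_continuousP pc.
pose P (x : R) := 0 <= x <= 1 /\
  exists (n : nat) (t : nat -> R), [/\ t 0%N = 0, t n = x,
    forall i, (i < n)%N -> t i < t i.+1,
    forall i, (i <= n)%N -> 0 <= t i <= 1 &
    forall i, (i < n)%N -> mdist (p (t i)) (p (t i.+1)) <= e].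
have P0 : P 0.
  split; first by rewrite lexx ler01.
  by exists 0%N, (fun=> 0); split => // i _; rewrite lexx ler01.
have ext x y : P x -> x < y -> y <= 1 -> mdist (p x) (p y) <= e -> P y.
  move=> [/andP[x0 x1] [n [t [t0 tn ti tb td]]]] xy y1 pxy.
  have y0 : 0 <= y <= 1 by rewrite y1 (le_trans x0) // ltW.
  split => //; exists n.+1, (fun i => if (i <= n)%N then t i else y); split => //.
  - by rewrite ltnn.
  - move=> i hi; have [->|{}hi] : i = n \/ (i < n)%N by lia.
      by rewrite leqnn ltnn tn.
    by rewrite hi (ltnW hi) ti.
  - by move=> i _; case: leqP => // hi; exact: tb.
  - move=> i hi; have [->|{}hi] : i = n \/ (i < n)%N by lia.
      by rewrite leqnn ltnn tn.
    by rewrite hi (ltnW hi) td.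
have ubP : ubound [set x | P x] 1 by move=> x [/andP[]].
have hub : has_ubound [set x | P x] by exists 1.
have hsP : has_sup [set x | P x] by split; [exists 0 | exists 1].
set c := sup [set x | P x].
have c1 : c <= 1 by apply: ge_sup => //; exists 0.
have c0 : 0 <= c by exact: (ub_le_sup hub).
have c01 : 0 <= c <= 1 by rewrite c0 c1.
have e20 : 0 < e / 2 by rewrite divr_gt0.
have [|dl dl0 hd] := pc c _ (e / 2) e20; first by rewrite /= in_itv.
have Pc : P c.
  have [x Px xc] := sup_adherent dl0 hsP.
  have xc' : x <= c by exact: (ub_le_sup hub).
  move: xc'; rewrite le_eqVlt => /orP[/eqP <- //|xc'].
  apply: (ext x) => //; rewrite metric_sym ltW // (lt_trans (hd _ _ _)) //.
  - by have [h _] := Px; rewrite /= in_itv.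
  - by rewrite ger0_norm ?subr_ge0 ?(ltW xc') //; move: xc; rewrite -/c; lra.
  - lra.
suff c1e : c = 1 by have [_ [n [t h]]] := Pc; exists n, t; rewrite c1e in h.
apply/eqP; rewrite eq_le c1 /= leNgt; apply/negP => c1'.
pose y := Num.min 1 (c + dl / 2).
have cy : c < y by rewrite lt_min c1' /=; lra.
have y1 : y <= 1 by rewrite ge_min lexx.
have Py : P y.
  apply: (ext c) => //; rewrite ltW // (lt_trans (hd _ _ _)) //.
  - by rewrite /= in_itv /= y1 (le_trans c0 (ltW cy)).
  - rewrite distrC ger0_norm ?subr_ge0 ?(ltW cy) //.
    have : y <= c + dl / 2 by rewrite ge_min lexx orbT.
    lra.
  - lra.
have : y <= c by exact: (ub_le_sup hub).
by rewrite leNgt cy.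
Qed.

Lemma path_length_ge (p : R -> X) (n : nat) (t : nat -> R) :
  t 0%N = 0 -> t n = 1 -> (forall i, (i < n)%N -> t i < t i.+1) ->
  ((\sum_(i < n) mdist (p (t i)) (p (t i.+1)))%:E <= path_length p)%E.
Proof.
move=> t0 tn ti; apply: ereal_sup_ubound.
pose s := mkseq (fun i => t i.+1) n.
have ss : size s = n by rewrite size_mkseq.
have ns i : (i < n)%N -> nth 1 s i = t i.+1 by move=> h; rewrite nth_mkseq.
have ns0 i : (i <= n)%N -> nth 1 (0 :: s) i = t i.
  by case: i => [|i] h /=; rewrite ?ns.
exists s.
  split; first by apply/(pathP 1) => i; rewrite ss => h; rewrite ns0 ?ns ?ti // ltnW.
  by rewrite (last_nth 1) ss ns0 // tn.
congr (_%:E); rewrite ss; apply: eq_bigr => i _.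
by rewrite ns0 ?ns // ltnW.
Qed.

Lemma dist_set_le (x : X) (A : set X) a r : A a -> mdist x a <= r -> dist_set x A <= r.
Proof.
move=> Aa h; apply: le_trans h; apply: ge_inf; last by exists a.
by exists 0 => _ [y _ <-]; exact: mdist_ge0.
Qed.

Lemma dist_set_lt (x : X) (A : set X) r : A !=set0 -> dist_set x A < r ->
  exists2 a, A a & mdist x a < r.
Proof.
move=> [a Aa] h; have [|_ [b Ab <-] hb] := inf_lt _ h; first by exists (mdist x a), a.
by exists b.
Qed.

Lemma dist_set_ge0 (x : X) (A : set X) : 0 <= dist_set x A.
Proof.
have [->|/set0P[a Aa]] := eqVneq A set0; first by rewrite /dist_set image_set0 inf0.
by apply: lb_le_inf; [exists (mdist x a), a|move=> _ [b _ <-]; exact: mdist_ge0].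
Qed.

Lemma nat_approx t (n : nat) : 0 <= t <= n%:R ->
  exists2 i, (i <= n)%N & i%:R <= t /\ t - i%:R <= 1.
Proof.
move=> /andP[t0 tn]; have /andP[h1 h2] := truncn_itv t0.
exists (Num.truncn t); first by rewrite -(ler_nat R) (le_trans h1).
by split => //; move: h2; rewrite -natr1; lra.
Qed.

End MetricTools.

(** * Chains and discrete quasi-geodesics *)

Section Chains.
Variables (R : realType) (X : metricType R).
Definition discrete_qg (q : R) (N : nat) (y : nat -> X) :=
  forall i j, (i <= N)%N -> (j <= N)%N ->
    qi_bounds q q `|i%:R - j%:R| (mdist (y i) (y j)).

Lemma discrete_qg_param q N y i j : 1 <= q -> discrete_qg q N y ->
  (i <= N)%N -> (j <= N)%N -> `|i%:R - j%:R| <= q * (mdist (y i) (y j) + q).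
Proof.
move=> q1 h iN jN; have q0 : 0 < q by exact: lt_le_trans q1.
by have /andP[+ _] := h i j iN jN; rewrite lerBlDr ler_pdivrMr // mulrC.
Qed.

Lemma discrete_qg_rev q N y : discrete_qg q N y -> discrete_qg q N (fun i => y (N - i)%N).
Proof.
move=> h i j iN jN; have := h _ _ (leq_subr i N) (leq_subr j N).
suff -> : `|(N - i)%:R - (N - j)%:R| = `|i%:R - j%:R| :> R by [].
by rewrite !natrB // distrC; congr `|_|; ring.
Qed.

Definition chain (z : X) (rho J : R) (n : nat) (x y : X) := exists c : nat -> X,
  [/\ c 0%N = x, c n = y, forall i, (i < n)%N -> mdist (c i) (c i.+1) <= J &
      forall i, (i <= n)%N -> rho <= mdist z (c i)].

Lemma chain_cat z rho J m n x y w : chain z rho J m x y -> chain z rho J n y w ->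
  chain z rho J (m + n) x w.
Proof.
move=> [c [c0 cm cJ cr]] [e [e0 en eJ er]].
exists (fun i => if (i <= m)%N then c i else e (i - m)%N); split => //.
- case: leqP => h; last by rewrite addKn.
  have n0 : n = 0%N by lia.
  by rewrite n0 addn0 cm -e0 -{1}n0.
- move=> i hi; case: (ltngtP i m) => h.
  + exact: cJ.
  + by rewrite subSn 1?ltnW // eJ //; lia.
  + by rewrite h cm -e0 subSn // subnn eJ //; lia.
move=> i hi; case: leqP => h; first exact: cr.
by apply: er; lia.
Qed.

Lemma chain_sym z rho J n x y : chain z rho J n x y -> chain z rho J n y x.
Proof.
move=> [c [c0 cn cJ cr]]; exists (fun i => c (n - i)%N); split => //.
- by rewrite subn0.
- by rewrite subnn.
- move=> i hi; rewrite metric_sym.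
  have -> : (n - i = (n - i.+1).+1)%N by lia.
  by apply: cJ; lia.
by move=> i hi; apply: cr; lia.
Qed.

Lemma chain_geodesic (Xgeo : geodesic_space X) z rho J (n : nat) x y :
  1 <= J -> mdist x y <= n%:R ->
  rho <= mdist z x - n%:R -> chain z rho J n x y.
Proof.
move=> J1 xy hr; have [g [g0 g1 gd]] := Xgeo x y.
set L := mdist x y in xy g1 gd.
have L0 : 0 <= L by exact: mdist_ge0.
pose t (i : nat) : R := Num.min i%:R L.
have t01 i : 0 <= t i <= L by rewrite ge_min lexx orbT andbT le_min ler0n L0.
exists (fun i => g (t i)); split.
- by rewrite /t min_l.
- by rewrite /t min_r.
- move=> i _; rewrite gd //; apply: le_trans J1.
  rewrite /t -natr1; case: (lerP i%:R L) => h; case: (lerP (i%:R + 1) L) => h';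
  rewrite ler_norml; apply/andP; split; lra.
move=> i _; have := metric_triangle z (g (t i)) x.
rewrite -{2}g0 gd ?lexx ?L0 // subr0 ger0_norm; last by case/andP: (t01 i).
by have /andP[_] := t01 i; lra.
Qed.

Lemma chain_qg z rho J q N y i j : 2 * q <= J -> discrete_qg q N y ->
  (forall k, (k <= N)%N -> rho <= mdist z (y k)) -> (i <= N)%N -> (j <= N)%N ->
  exists2 n : nat, n%:R = `|i%:R - j%:R| :> R & chain z rho J n (y i) (y j).
Proof.
move=> qJ h hr; wlog ij : i j / (i <= j)%N.
  move=> WL iN jN; case/orP: (leq_total i j) => ij; first exact: WL.
  by have [n hn /chain_sym ch] := WL j i ij jN iN; exists n; rewrite // distrC.
move=> iN jN; exists (j - i)%N.
  by rewrite natrB // distrC ger0_norm // subr_ge0 ler_nat.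
exists (fun k => y (i + k)%N); split.
- by rewrite addn0.
- by rewrite subnKC.
- move=> k hk; apply: le_trans qJ.
  have /andP[_] := h (i + k)%N (i + k.+1)%N ltac:(lia) ltac:(lia).
  rewrite addnS -natr1 distrC; have -> : (i + k)%:R + 1 - (i + k)%:R = 1 :> R by ring.
  by rewrite normr1; lra.
by move=> k hk; apply: hr; lia.
Qed.

End Chains.

Section QuasiGeodesicRay.
Variables (R : realType) (X : metricType R).
Variables (C : R) (alpha : R -> X).
Hypothesis alpha_qg : quasi_geodesic_ray C C alpha.

Lemma ray_C1 : 1 <= C. Proof. by case: alpha_qg. Qed.
Let C1 := ray_C1.
Let C0 : 0 < C. Proof. exact: lt_le_trans ltr01 C1. Qed.

Lemma ray_upper s t : 0 <= s -> 0 <= t ->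
  mdist (alpha s) (alpha t) <= C * `|s - t| + C.
Proof. by move=> s0 t0; have [_ _ _ /(_ s t s0 t0)/andP[]] := alpha_qg. Qed.

Lemma ray_lower s t : 0 <= s -> 0 <= t ->
  `|s - t| / C - C <= mdist (alpha s) (alpha t).
Proof. by move=> s0 t0; have [_ _ _ /(_ s t s0 t0)/andP[]] := alpha_qg. Qed.

Lemma ray_param s t : 0 <= s -> 0 <= t ->
  `|s - t| <= C * (mdist (alpha s) (alpha t) + C).
Proof.
by move=> s0 t0; rewrite mulrC -ler_pdivrMr // -lerBlDr; exact: ray_lower.
Qed.

Lemma trace_ray s : 0 <= s -> trace alpha (alpha s).
Proof. by move=> s0; exists s. Qed.

Lemma trace_nonempty : trace alpha !=set0.
Proof. by exists (alpha 0), 0 => //=; rewrite /half_line /= lexx. Qed.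

Lemma chain_ray z rho J (u v : R) : 2 * C <= J -> 0 <= u -> 0 <= v ->
  (forall th : R, 0 <= th <= 1 -> rho <= mdist z (alpha (u + (v - u) * th))) ->
  exists2 n : nat, n%:R <= `|v - u| + 1 & chain z rho J n (alpha u) (alpha v).
Proof.
move=> CJ u0 v0 h; have /andP[l1 l2] := truncn_itv (normr_ge0 (v - u)).
set n := (Num.truncn `|v - u|).+1 in l2; exists n; first by rewrite /n -natr1 lerD2r.
have n0 : 0 < n%:R :> R by rewrite ltr0n.
have th01 i : (i <= n)%N -> 0 <= (i%:R / n%:R : R) <= 1.
  by move=> hi; rewrite divr_ge0 //= ler_pdivrMr // mul1r ler_nat.
have pos i : (i <= n)%N -> 0 <= u + (v - u) * (i%:R / n%:R).
  move=> /th01/andP[h0 h1].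
  have -> : u + (v - u) * (i%:R / n%:R) = (1 - i%:R / n%:R) * u + i%:R / n%:R * v by ring.
  by rewrite addr_ge0 // mulr_ge0 // subr_ge0.
exists (fun i => alpha (u + (v - u) * (i%:R / n%:R))); split.
- by rewrite mul0r mulr0 addr0.
- by rewrite divff ?gt_eqF // mulr1; congr alpha; ring.
- move=> i hi; apply: le_trans CJ.
  apply: le_trans (ray_upper (pos _ (ltnW hi)) (pos _ hi)) _.
  rewrite -natr1.
  have -> : u + (v - u) * (i%:R / n%:R) - (u + (v - u) * ((i%:R + 1) / n%:R)) =
         - (v - u) / n%:R by field; rewrite gt_eqF.
  rewrite normrM normrN normfV (ger0_norm (ltW n0)).
  have : `|v - u| / n%:R <= 1 by rewrite ler_pdivrMr // mul1r ltW.
  by move=> h1; have := ler_wpM2l (ltW C0) h1; lra.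
by move=> i hi; apply: h; exact: th01.
Qed.

End QuasiGeodesicRay.

(** * Quadratic divergence implies Morse *)

Section QuadraticDivergence.
Variables (R : realType) (X : metricType R).
Hypothesis Xgeo : geodesic_space X.
Variables (C : R) (alpha : R -> X).
Hypothesis alpha_qg : quasi_geodesic_ray C C alpha.
Let C1 : 1 <= C. Proof. exact: (ray_C1 alpha_qg). Qed.
Let C0 : 0 < C. Proof. exact: lt_le_trans ltr01 C1. Qed.

Variables (delta A c : R).
Hypotheses (delta0 : 0 < delta) (deltaC : delta < 1 / C) (AC : C <= A) (c0 : 0 < c).
Hypothesis hdiv : forall r : R, 0 < r ->
    ((c * r ^+ 2 - 1 / c)%:E <= divergence alpha delta A r)%E.

(** The geodesic interpolation of the chain stays within J of its points, hence
    the margin J in the radius. *)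
Lemma divergence_chain r s J (n : nat) : 0 < r -> r <= s -> 0 <= J ->
  chain (alpha s) (delta * r - A + J) J n (alpha (s - r)) (alpha (s + r)) ->
  c * r ^+ 2 - 1 / c <= n%:R * J.
Proof.
move=> r0 rs J0 [x [x0 xn xJ xr]].
have [g [gx glip]] := chain_interpolation Xgeo J0 xJ.
pose p t := g (t * n%:R).
have tn (t : R) : 0 <= t <= 1 -> 0 <= t * n%:R <= n%:R.
  by move=> /andP[t0 t1]; rewrite mulr_ge0 //= ler_piMl.
have plip (s' t : R) : 0 <= s' <= 1 -> 0 <= t <= 1 ->
    mdist (p s') (p t) <= n%:R * J * `|s' - t|.
  move=> hs ht; rewrite /p; apply: le_trans (glip _ _ (tn _ hs) (tn _ ht)) _.
  by rewrite -mulrBl normrM (ger0_norm (ler0n _ n)) (mulrC `|_|) mulrA (mulrC J).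
rewrite -lee_fin. apply: (le_trans (hdiv r0)).
apply: le_trans (path_length_lipschitz _ plip); last by rewrite mulr_ge0.
apply: (@le_trans _ _ (detour alpha delta A r s)).
  by apply: ereal_inf_lbound; exists s.
apply: ereal_inf_lbound; exists p => //; split.
- apply: lipschitz_within_continuous => s' t; rewrite /= !in_itv /=; exact: plip.
- by rewrite /p mul0r (gx 0%N).
- by rewrite /p mul1r gx.
move=> t ht; rewrite ballEmdist /= => hb.
have [i iN [i1 i2]] := nat_approx (tn t ht).
have := glip i%:R (t * n%:R); rewrite ler0n ler_nat iN gx // => /(_ isT (tn t ht)).
rewrite distrC ger0_norm ?subr_ge0 // => h1.
have h2 : J * (t * n%:R - i%:R) <= J by rewrite ler_piMr.
have h3 := xr i iN; have := metric_triangle (alpha s) (p t) (x i).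
rewrite (metric_sym (p t)); move: h1; rewrite -/(p t); lra.
Qed.

(** One half of a detour around alpha s. The chain follows the ray away from s,
    starting at parameter distance r', up to the endpoint e of y if this is at
    most r away; otherwise it leaves the ray at distance r along a geodesic
    to y. The sign sgn tells on which side of s it runs. *)
Lemma reach s e sgn l r r' rho J E q N y k :
  0 <= s -> sgn = 1 \/ sgn = -1 -> 0 <= e -> e = s + sgn * l ->
  0 <= r' -> r' <= l -> r' <= r -> 2 * C <= J -> 0 <= E -> discrete_qg q N y ->
  (k <= N)%N -> y k = alpha e ->
  (forall tau, 0 <= tau <= l -> exists2 i : nat, (i <= N)%N &
     mdist (alpha (s + sgn * tau)) (y i) <= E + 2) ->
  rho <= r' / C - C -> rho <= r / C - C - (E + 3) ->
  exists tau i (n : nat), [/\ 0 <= tau <= r, 0 <= s + sgn * tau, (i <= N)%N &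
    n%:R <= r + E + 4] /\ mdist (alpha (s + sgn * tau)) (y i) <= E + 2 /\
    chain (alpha s) rho J n (alpha (s + sgn * r')) (y i).
Proof.
move=> s0 sg e0 es r'0 r'l r'r CJ E0 hy kN yk near rho1 rho2.
have hC1 : 1 <= C by exact: C1.
have hC0 : 0 < C by exact: C0.
have J1 : 1 <= J by lra.
have pos (tau : R) : 0 <= tau <= l -> 0 <= s + sgn * tau.
  by move=> /andP[t0 tl]; case: sg => h; move: es; rewrite h; lra.
have ray (tau : R) : r' <= tau -> tau <= l -> exists2 n : nat, (n%:R <= tau - r' + 1) &
    chain (alpha s) rho J n (alpha (s + sgn * r')) (alpha (s + sgn * tau)).
  move=> h1 h2; have p1 : 0 <= s + sgn * r' by apply: pos; rewrite r'0 r'l.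
  have p2 : 0 <= s + sgn * tau by apply: pos; rewrite h2 (le_trans r'0).
  have [|n hn ch] := chain_ray alpha_qg (z := alpha s) (rho := rho) CJ p1 p2; last first.
    exists n => //; apply: le_trans hn _.
    have -> : s + sgn * tau - (s + sgn * r') = sgn * (tau - r') by ring.
    rewrite normrM (ger0_norm (_ : 0 <= tau - r')) ?subr_ge0 //.
    by case: sg => ->; rewrite ?normrN normr1 mul1r.
  move=> th /andP[th0 th1]; apply: le_trans rho1 _.
  set w := r' + (tau - r') * th.
  have -> : s + sgn * r' + (s + sgn * tau - (s + sgn * r')) * th = s + sgn * w.
    by rewrite /w; ring.
  have w1 : r' <= w by rewrite /w lerDl mulr_ge0 // subr_ge0.
  have w2 : w <= l.
    have : (tau - r') * th <= tau - r' by rewrite ler_piMr // subr_ge0.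
    by rewrite /w; lra.
  have w0 : 0 <= w <= l by rewrite w2 (le_trans r'0).
  have := ray_lower alpha_qg s0 (pos _ w0).
  have -> : `|s - (s + sgn * w)| = w.
    have -> : s - (s + sgn * w) = - sgn * w by ring.
    rewrite normrM normrN (ger0_norm (_ : 0 <= w)); last by case/andP: w0.
    by case: sg => ->; rewrite ?normrN normr1 mul1r.
  have : r' / C <= w / C by rewrite ler_pM2r // invr_gt0.
  lra.
have [lr|rl] := leP l r.
  have [n hn ch] := ray l r'l (lexx _).
  have l0 : 0 <= l <= l by rewrite lexx (le_trans r'0).
  exists l, k, n; rewrite -es yk e0 kN mdistxx; split; last by split; [lra|rewrite es].
  by split => //; [rewrite lr (le_trans r'0)|lra].
have [n hn ch] := ray r r'r (ltW rl).
have r0 : 0 <= r <= l by rewrite (le_trans r'0) //= ltW.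
have [i iN hi] := near r r0.
have E2 : 0 <= E + 2 by lra.
exists r, i; have /andP[m1 m2] := truncn_itv E2.
move: m1 m2; set m := Num.truncn (E + 2) => m1 m2.
exists (n + m.+1)%N; split; last split => //.
  split => //; [by rewrite lexx andbT; case/andP: r0|exact: pos|].
  by rewrite natrD -natr1; lra.
apply: chain_cat ch _; apply: (chain_geodesic Xgeo J1); first by apply: le_trans hi (ltW m2).
have := ray_lower alpha_qg s0 (pos _ r0).
have -> : `|s - (s + sgn * r)| = r.
  have -> : s - (s + sgn * r) = - sgn * r by ring.
  rewrite normrM normrN (ger0_norm (_ : 0 <= r)); last by case/andP: r0.
  by case: sg => ->; rewrite ?normrN normr1 mul1r.
by rewrite -natr1; lra.
Qed.

End QuadraticDivergence.

(** Two halves given by [reach], joined along y, avoid a ball of radius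
    proportional to E around alpha s in a number of steps linear in E, whereas
    the divergence is quadratic in E. *)
Lemma gap_bound (R : realType) (X : metricType R) (Xgeo : geodesic_space X)
    (C : R) (alpha : R -> X) (alpha_qg : quasi_geodesic_ray C C alpha)
    (delta A c q : R) : 0 < delta -> delta < 1 / C -> C <= A -> 0 < c ->
  (forall r : R, 0 < r ->
    ((c * r ^+ 2 - 1 / c)%:E <= divergence alpha delta A r)%E) ->
  1 <= q -> exists B, forall N y a b s E,
  0 <= a -> a <= s -> s <= b -> discrete_qg q N y -> y 0%N = alpha a -> y N = alpha b ->
  (forall i, (i <= N)%N -> E <= mdist (alpha s) (y i)) ->
  (forall u, a <= u <= b -> exists2 i, (i <= N)%N & mdist (alpha u) (y i) <= E + 2) ->
  E <= B.
Proof.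
move=> delta0 deltaC hAC c0 hdiv q1; have hC1 := ray_C1 alpha_qg.
have hC0 : 0 < C by exact: lt_le_trans ltr01 hC1.
(* J bounds the steps of both the ray and the quasi-geodesic at integer times;
   k E bounds the number of steps of the detour built below. *)
pose J := 2 * C + 2 * q; pose kappa := 1 / C - delta.
have ka0 : 0 < kappa by rewrite subr_gt0.
have J0 : 0 < J by rewrite /J; lra.
pose k := 2 * (C * (C + 5) + 5) + q * (6 + C * (2 * (C * (C + 5))) + C + q).
have CC0 : 0 <= C * (C + 5) by rewrite mulr_ge0; lra.
have k0 : 0 <= k.
  have h : 0 <= C * (2 * (C * (C + 5))) by rewrite mulr_ge0 ?mulr_ge0 //; lra.
  by rewrite /k addr_ge0 // ?mulr_ge0 //; lra.
pose b1 := 2 * C * ((J + C) / kappa); pose b2 := (k * J + 1 / c) * (4 * C ^+ 2) / c.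
have b10 : 0 <= b1 by rewrite /b1 mulr_ge0 ?divr_ge0 //; lra.
have b20 : 0 <= b2.
  rewrite /b2 divr_ge0 ?(ltW c0) // mulr_ge0 //; last by rewrite mulr_ge0 ?sqr_ge0.
  by rewrite addr_ge0 ?mulr_ge0 ?invr_ge0 // ?ltW //.
exists (1 + 2 * C + 2 * J + b1 + b2) => N y a b s E a0 as_ sb hy y0 yN gap near.
rewrite leNgt; apply/negP => hE.
have E1 : 1 <= E by lra.
have s0 : 0 <= s by lra.
have b0 : 0 <= b by lra.
(* r' is at most the parameter distance from s to a and to b; at parameter
   distance r the ray is so far from alpha s that geodesics of length E + 3
   issued from it stay out of the ball. *)
pose r' := E / (2 * C); pose r := C * (2 * E + C + 3).
have r'e : r' * (2 * C) = E by rewrite /r' divfK // gt_eqF // mulr_gt0.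
have r'0 : 0 < r' by rewrite divr_gt0 ?mulr_gt0 //; lra.
have r'E : r' <= E / 2.
  have : 0 <= r' * (2 * C - 2) by rewrite mulr_ge0 ?(ltW r'0) //; lra.
  lra.
have rC : r / C = 2 * E + C + 3 by rewrite /r mulrC mulKf // gt_eqF.
have rE : E <= r.
  have : 0 <= (C - 1) * (2 * E + C + 3) by rewrite mulr_ge0; move: hC1 E1; clear; lra.
  by rewrite /r; lra.
have rE' : r <= C * (C + 5) * E.
  have : 0 <= C * (C + 3) * (E - 1) by rewrite !mulr_ge0; move: hC1 E1; clear; lra.
  by rewrite /r; clear; lra.
have r'd : r' = E / (2 * C) by [].
have CJ : 2 * C <= J by rewrite /J; lra.
have qJ : 2 * q <= J by rewrite /J; lra.
have kad : kappa = 1 / C - delta by [].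
clearbody r' r kappa.
pose rho := delta * r' - A + J.
have dr'1 : delta * r' <= r'.
  have h : 1 / C <= 1 by rewrite ler_pdivrMr // mul1r.
  by apply: ler_piMl (ltW r'0) _; apply: le_trans h; exact: ltW.
have rhoE : rho <= E by rewrite /rho; lra.
have rho1 : rho <= r' / C - C.
  have e1 : r' / C = kappa * r' + delta * r' by rewrite kad; ring.
  have : J + C <= kappa * r'.
    have CC : 0 < 2 * C by rewrite mulr_gt0.
    have : b1 <= E by move: hE b20 J0 hC0; clear; lra.
    by rewrite /b1 -r'e (mulrC r') ler_pM2l // ler_pdivrMr // (mulrC r').
  by rewrite e1 /rho; lra.
have len (e : R) : 0 <= e -> E <= mdist (alpha s) (alpha e) -> r' <= `|s - e|.
  move=> e0 h; have := ray_upper alpha_qg s0 e0 => h'.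
  have : E / 2 <= C * `|s - e| by move: h h' hE b10 b20 J0; clear; lra.
  by rewrite -r'e -ler_pdivrMl //; have -> : C^-1 * (r' * (2 * C) / 2) = r' by
    field; rewrite gt_eqF.
have la : r' <= s - a.
  have := len a a0; rewrite -y0 gap // ger0_norm ?subr_ge0 //; exact.
have lb : r' <= b - s.
  have := len b b0; rewrite -yN gap // distrC ger0_norm ?subr_ge0 //; exact.
have r'r : r' <= r by move: r'E rE E1; clear; lra.
have rho2 : rho <= r / C - C - (E + 3) by rewrite rC; move: rhoE; clear; lra.
have [|||tau1 [i [n1 [[t1 u10 iN n1le] [d1 ch1]]]]] := @reach R X Xgeo C alpha
  alpha_qg s a (-1) (s - a) r r' rho J E q N y 0 s0 (or_intror erefl) a0 _
  (ltW r'0) la r'r CJ _ hy (leq0n _) y0 _ rho1 rho2.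
- by ring.
- by move: E1; clear; lra.
- by move=> tau ht; apply: near; move: ht as_ sb; clear; lra.
have [|||tau2 [j [n2 [[t2 u20 jN n2le] [d2 ch2]]]]] := @reach R X Xgeo C alpha
  alpha_qg s b 1 (b - s) r r' rho J E q N y N s0 (or_introl erefl) b0 _
  (ltW r'0) lb r'r CJ _ hy (leqnn _) yN _ rho1 rho2.
- by ring.
- by move: E1; clear; lra.
- by move=> tau ht; apply: near; move: ht as_ sb; clear; lra.
have [n3 n3e ch3] := chain_qg (z := alpha s) (rho := rho) qJ hy
   (fun l hl => le_trans rhoE (gap l hl)) iN jN.
have ch := chain_cat (chain_cat ch1 ch3) (chain_sym ch2).
have := @divergence_chain R X Xgeo alpha delta A c hdiv r' s J _ r'0 _ (ltW J0) _.
have -> : s + r' = s + 1 * r' by rewrite mul1r.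
have -> : s - r' = s + -1 * r' by rewrite mulN1r.
move=> /(_ _ _ ch).
have -> : r' <= s by move: la a0; clear; lra.
move=> /(_ isT) hc.
have hn3 : n3%:R <= q * (2 * E + 4 + (C * (2 * r) + C) + q).
  rewrite n3e; apply: le_trans (discrete_qg_param q1 hy iN jN) _.
  rewrite ler_pM2l ?(lt_le_trans ltr01) //.
  have h1 := metric_triangle (y i) (alpha (s + -1 * tau1)) (y j).
  have h2 := metric_triangle (alpha (s + -1 * tau1)) (alpha (s + 1 * tau2)) (y j).
  have h3 := ray_upper alpha_qg u10 u20.
  have h4 : `|s + -1 * tau1 - (s + 1 * tau2)| <= 2 * r.
    by rewrite ler_norml; move: t1 t2; clear; lra.
  have h5 := ler_wpM2l (ltW hC0) h4.
  rewrite (metric_sym (y i) (alpha _)) in h1.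
  by move: h1 h2 h3 h5 d1 d2; clear; lra.
have hn : (n1 + n3 + n2)%:R <= k * E.
  rewrite !natrD.
  have g1 : n3%:R <= q * (6 + C * (2 * (C * (C + 5))) + C + q) * E.
    apply: le_trans hn3 _; rewrite -mulrA ler_pM2l ?(lt_le_trans ltr01) //.
    have g2 : C * (2 * r) <= C * (2 * (C * (C + 5) * E)) by rewrite !ler_pM2l.
    have g3 : 0 <= (4 + C + q) * (E - 1) by rewrite mulr_ge0; move: E1 q1 hC1; clear; lra.
    by move: g2 g3; clear; lra.
  by rewrite /k; move: g1 n1le n2le rE' E1; clear; lra.
have {}hc : c * r' ^+ 2 <= (k * J + 1 / c) * E.
  have g1 : (n1 + n3 + n2)%:R * J <= k * E * J by rewrite ler_pM2r.
  have g2 : 1 / c <= 1 / c * E by rewrite ler_peMr // divr_ge0 // ltW.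
  by move: hc g1 g2; clear; lra.
have : E <= b2; last by move: hE b10 J0 hC0; clear; lra.
have e2 : c * r' ^+ 2 = c * E / (4 * C ^+ 2) * E.
  by rewrite r'd; field; rewrite gt_eqF.
rewrite e2 ler_pM2r in hc; last by move: E1; clear; lra.
rewrite /b2 ler_pdivlMr // mulrC -ler_pdivrMr //.
by rewrite mulr_gt0 // exprn_gt0.
Qed.

(** The discrete form of connectedness used for fellow-traveling. *)
Lemma nat_crossing (P : nat -> Prop) n : P 0%N -> P n \/
  exists i, [/\ (i < n)%N, P i & ~ P i.+1].
Proof.
move=> P0; elim: n => [|n [Pn|[i [h1 h2 h3]]]]; first by left.
  by have [Pn1|nP] := pselect (P n.+1); [left|right; exists n].
by right; exists i; split => //; lia.
Qed.

Lemma ray_near_qg (R : realType) (X : metricType R) (Xgeo : geodesic_space X)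
    (C : R) (alpha : R -> X) (alpha_qg : quasi_geodesic_ray C C alpha) (q B : R) :
  1 <= q ->
  (forall N y (a b s E : R), 0 <= a -> a <= s -> s <= b -> discrete_qg q N y ->
    y 0%N = alpha a -> y N = alpha b ->
    (forall i, (i <= N)%N -> E <= mdist (alpha s) (y i)) ->
    (forall u, a <= u <= b -> exists2 i, (i <= N)%N & mdist (alpha u) (y i) <= E + 2) ->
    E <= B) ->
  exists D, forall N y (a b s : R), 0 <= a -> a <= s -> s <= b -> discrete_qg q N y ->
    y 0%N = alpha a -> y N = alpha b ->
    exists2 i, (i <= N)%N & mdist (alpha s) (y i) <= D.
Proof.
move=> q1 gap; exists (`|B| + 2) => N y a b s a0 as_ sb hy y0 yN.
apply: contrapT => far.
(* The estimate is applied at a point of the ray where the distance to y is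
   within 1 of its supremum. *)
pose S := [set E : R | exists u, a <= u <= b /\
   forall i, (i <= N)%N -> E <= mdist (alpha u) (y i)].
have notS E u : a <= u <= b -> ~ S E -> exists2 i, (i <= N)%N & mdist (alpha u) (y i) <= E.
  move=> hu nS; apply: contrapT => h; apply: nS; exists u; split => // i iN.
  by rewrite leNgt; apply/negP => /ltW h'; apply: h; exists i.
have SB : S (`|B| + 2).
  apply: contrapT => /(notS _ s); rewrite as_ sb => /(_ isT); exact: far.
have ubS : has_ubound S.
  exists (C * (b - a) + C) => E [u [/andP[u1 u2] /(_ 0%N (leq0n _)) h]].
  apply: le_trans h _; rewrite y0.
  apply: le_trans (ray_upper alpha_qg (le_trans a0 u1) a0) _.
  rewrite lerD2r ler_wpM2l ?(le_trans ler01 (ray_C1 alpha_qg)) //.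
  by rewrite ger0_norm ?subr_ge0 // lerD2r.
have hsS : has_sup S by split; [exists (`|B| + 2)|].
have [E [u [/andP[u1 u2] gE]] hE] := sup_adherent ltr01 hsS.
have hB : `|B| + 2 <= sup S by exact: (ub_le_sup ubS).
have EB : E <= B.
  apply: (gap N y a b u) => // v hv.
  apply: notS => // /(ub_le_sup ubS); move: hE; clear; lra.
have := ler_norm B; move: EB hE hB; clear; lra.
Qed.

(** Each point of the ray between alpha a and alpha b is near some y i. Moving
    from a to b by steps of length at most 1, the index i passes from 0 to N,
    so at some step it jumps over k; then the two indices, and k between them,
    are close. *)
Lemma qg_near_ray (R : realType) (X : metricType R)
    (C : R) (alpha : R -> X) (alpha_qg : quasi_geodesic_ray C C alpha) (q D : R)
    (N : nat) (y : nat -> X) (a b : R) (k : nat) :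
  1 <= q -> 0 <= a -> a <= b -> discrete_qg q N y -> y 0%N = alpha a -> y N = alpha b ->
  (forall u : R, a <= u <= b -> exists2 i, (i <= N)%N & mdist (alpha u) (y i) <= D) ->
  (k <= N)%N -> exists2 u, 0 <= u & mdist (y k) (alpha u) <=
     D + (q * (q * (2 * D + 2 * C + q)) + q).
Proof.
move=> q1 a0 ab hy y0 yN near kN; have C1 := ray_C1 alpha_qg.
have C0 : 0 < C by exact: lt_le_trans ltr01 C1.
have q0 : 0 < q by exact: lt_le_trans ltr01 q1.
have D0 : 0 <= D.
  have [|i _ h] := near a; first by rewrite lexx.
  exact: le_trans (mdist_ge0 _ _) h.
have close u i j : (i <= k)%N -> (k <= j)%N -> (j <= N)%N ->
    mdist (alpha u) (y i) <= D -> mdist (y i) (y j) <= 2 * D + 2 * C ->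
    mdist (y k) (alpha u) <= D + (q * (q * (2 * D + 2 * C + q)) + q).
  move=> ik kj jN h1 h2; have iN := leq_trans ik kN.
  have := discrete_qg_param q1 hy iN jN => h3.
  have h4 : `|i%:R - k%:R| <= `|i%:R - j%:R| :> R.
    rewrite !(distrC i%:R) !ger0_norm ?subr_ge0 ?ler_nat ?(leq_trans ik) //.
    by rewrite lerD2r ler_nat.
  have h5 : `|i%:R - k%:R| <= q * (2 * D + 2 * C + q).
    by apply: le_trans h4 (le_trans h3 _); rewrite ler_pM2l // lerD2r.
  have /andP[_ h6] := hy i k iN kN.
  have h7 : q * `|i%:R - k%:R| <= q * (q * (2 * D + 2 * C + q)) by rewrite ler_pM2l.
  have := metric_triangle (alpha u) (y i) (y k); rewrite (metric_sym (y k)).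
  move: h1 h6 h7; clear; lra.
have ba0 : 0 <= b - a by rewrite subr_ge0.
have /andP[m1 m2] := truncn_itv ba0.
set n := (Num.truncn (b - a)).+1 in m2.
have n0 : 0 < n%:R :> R by rewrite ltr0n.
pose u i : R := a + (b - a) * (i%:R / n%:R).
have uab i : (i <= n)%N -> a <= u i <= b.
  move=> hi; have h0 : 0 <= (i%:R / n%:R : R) by rewrite divr_ge0.
  have h1 : (i%:R / n%:R : R) <= 1 by rewrite ler_pdivrMr // mul1r ler_nat.
  have := mulr_ge0 ba0 h0; have := ler_piMr ba0 h1; rewrite /u; clear; lra.
have u_pos i : (i <= n)%N -> 0 <= u i by move=> /uab/andP[h _]; exact: le_trans a0 h.
pose P i := exists2 j, (j <= k)%N & mdist (alpha (u i)) (y j) <= D.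
have P0 : P 0%N.
  by exists 0%N => //; rewrite /u mul0r mulr0 addr0 -y0 mdistxx.
have [[j jk hj]|[i [hi [j jk hj] nP]]] := nat_crossing n P0.
  exists (u n); first exact: u_pos.
  have un : u n = b by rewrite /u divff ?gt_eqF //; ring.
  apply: (close _ j N) => //; rewrite yN -un metric_sym; move: hj D0 C0; clear; lra.
exists (u i); first exact: u_pos (ltnW hi).
have [l lN hl] := near _ (uab _ hi).
have kl : (k <= l)%N.
  by rewrite leqNgt; apply/negP => /ltnW lk; apply: nP; exists l.
apply: (close _ j l) => //.
have h1 := ray_upper alpha_qg (u_pos _ (ltnW hi)) (u_pos _ hi).
have h2 : `|u i - u i.+1| <= 1.
  have -> : u i - u i.+1 = - ((b - a) / n%:R).
    by rewrite /u -natr1; field; rewrite gt_eqF.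
  rewrite normrN ger0_norm; last by rewrite divr_ge0 // subr_ge0.
  by rewrite ler_pdivrMr // mul1r ltW.
have h3 := ler_wpM2l (ltW C0) h2.
have h4 := metric_triangle (y j) (alpha (u i)) (y l).
have h5 := metric_triangle (alpha (u i)) (alpha (u i.+1)) (y l).
rewrite (metric_sym (y j) (alpha _)) in h4.
move: h1 h3 h4 h5 hj hl; clear; lra.
Qed.

(** The last step may have length less than 1, whence the additive 1. *)
Lemma discretize_qg (R : realType) (X : metricType R) (q Q : R) (g : R -> X) (t0 t1 : R) :
  t0 <= t1 -> quasi_geodesic q Q `[t0, t1]%classic g ->
  exists N y, [/\ discrete_qg (q + Q + 1) N y, y 0%N = g t0, y N = g t1 &
    forall t, t0 <= t <= t1 -> exists2 i, (i <= N)%N & mdist (g t) (y i) <= q + Q].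
Proof.
move=> t01 [q1 Q0 _ hg].
have t10 : 0 <= t1 - t0 by rewrite subr_ge0.
have /andP[m1 m2] := truncn_itv t10.
set n := Num.truncn (t1 - t0) in m1 m2.
pose tau i : R := if (i <= n)%N then t0 + i%:R else t1.
have tau01 i : t0 <= tau i <= t1.
  rewrite /tau; case: leqP => h; last by rewrite t01 lexx.
  have : i%:R <= n%:R :> R by rewrite ler_nat.
  have : 0 <= i%:R :> R by [].
  move: m1; clear; lra.
have mem i : `[t0, t1]%classic (tau i) by rewrite /= in_itv /= tau01.
have gap i j : (i <= j)%N -> (j <= n.+1)%N ->
    `|i%:R - j%:R| - 1 <= `|tau i - tau j| <= `|i%:R - j%:R|.
  move=> ij jn; have hij : i%:R <= j%:R :> R by rewrite ler_nat.
  rewrite (distrC i%:R) (distrC (tau i)) (ger0_norm (_ : 0 <= j%:R - i%:R)) ?subr_ge0 //.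
  rewrite /tau; case: (leqP j n) => hj.
    rewrite (leq_trans ij hj).
    have -> : t0 + j%:R - (t0 + i%:R) = j%:R - i%:R by ring.
    by rewrite ger0_norm ?subr_ge0 // lexx gerBl ler01.
  have -> : j = n.+1 by lia.
  case: (leqP i n) => hi.
    have hin : i%:R <= n%:R :> R by rewrite ler_nat.
    rewrite ger0_norm; last by move: hin m1; clear; lra.
    by move: m1 m2; rewrite -natr1; clear; lra.
  have -> : i = n.+1 by lia.
  by rewrite !subrr normr0 lexx; lra.
have q0 : 0 < q by exact: lt_le_trans ltr01 q1.
have q'0 : 0 < q + Q + 1 by move: q0 Q0; clear; lra.
exists n.+1, (g \o tau); split.
- suff H i j : (i <= j)%N -> (j <= n.+1)%N ->
     qi_bounds (q + Q + 1) (q + Q + 1) `|i%:R - j%:R| (mdist (g (tau i)) (g (tau j))).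
    move=> i j iN jN; case/orP: (leq_total i j) => ij; first exact: H.
    by rewrite /qi_bounds distrC /= metric_sym; exact: H.
  move=> ij jn; have /andP[g1 g2] := gap i j ij jn.
  have /andP[h1 h2] := hg _ _ (mem i) (mem j).
  have d0 : 0 <= `|i%:R - j%:R| :> R by [].
  set d := `|i%:R - j%:R| in g1 g2 d0 *; set e := `|tau i - tau j| in g1 g2 h1 h2.
  set m := mdist _ _ in h1 h2 *.
  apply/andP; split; last first.
    have k1 : q * e <= q * d by rewrite ler_pM2l.
    have k2 : 0 <= (Q + 1) * d by rewrite mulr_ge0 // addr_ge0.
    by move: h2 k1 k2 q1; clear; lra.
  have k1 : (d - 1) / q <= e / q by rewrite ler_pM2r // invr_gt0.
  have k2 : d / (q + Q + 1) <= d / q.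
    by rewrite ler_wpM2l // lef_pV2 ?posrE //; move: Q0; clear; lra.
  have k3 : 1 / q <= 1 by rewrite ler_pdivrMr // mul1r.
  have k4 : (d - 1) / q = d / q - 1 / q by ring.
  by move: h1 k1 k2 k3 k4 q1; clear; lra.
- by rewrite /= /tau /= addr0.
- by rewrite /= /tau ltnn.
move=> t ht; have [|i iN [i1 i2]] := @nat_approx R (t - t0) n.+1.
  by case/andP: ht => h1 h2; rewrite subr_ge0 h1 /= ltW // (le_lt_trans _ m2) // lerD2r.
have [i' i'n h] : exists2 i', (i' <= n)%N & `|t - tau i'| <= 1.
  case: (leqP i n) => hi.
    exists i => //; rewrite /tau hi opprD addrA ger0_norm ?subr_ge0 //.
  have ei : i = n.+1 by lia.
  by move: i1 m2 ht; rewrite ei => h1 h2 /andP[_ h3]; exfalso; move: h1 h2 h3; clear; lra.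
exists i'; first exact: leq_trans i'n _.
have ht' : `[t0, t1]%classic t by rewrite /= in_itv.
have /andP[_ h1] := hg _ _ ht' (mem i').
have h2 : q * `|t - tau i'| <= q by rewrite ler_piMr // ltW.
by apply: le_trans h1 _; rewrite lerD2r.
Qed.

Theorem quadratic_divergence_Morse (R : realType) (X : metricType R)
    (Xgeo : geodesic_space X)
    (C : R) (alpha : R -> X) (alpha_qg : quasi_geodesic_ray C C alpha) :
  at_least_quadratic_divergence C alpha -> Morse alpha.
Proof.
move=> [delta [A [d0 dC CA [c c0 hdiv]]]] q Q q1 Q0.
set q' := q + Q + 1; have q'1 : 1 <= q' by rewrite /q'; move: q1 Q0; clear; lra.
have [B gap] := gap_bound Xgeo alpha_qg d0 dC CA c0 hdiv q'1.
have [D near] := ray_near_qg Xgeo alpha_qg q'1 gap.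
exists (D + (q' * (q' * (2 * D + 2 * C + q')) + q') + (q + Q)).
move=> g t0 t1 t01 hg [a a0 ea] [b b0 eb] t ht.
have [N [y [hy y0 yN hc]]] := discretize_qg t01 hg.
have [i iN hi] := hc t ht.
have [u u0 hu] : exists2 u, 0 <= u & mdist (y i) (alpha u) <=
    D + (q' * (q' * (2 * D + 2 * C + q')) + q').
  have [ab|/ltW ba] := leP a b.
    apply: (qg_near_ray alpha_qg q'1 a0 ab hy) => //; rewrite ?y0 ?yN //.
    by move=> u /andP[u1 u2]; apply: (near N y a b) => //; rewrite ?y0 ?yN.
  have -> : y i = y (N - (N - i))%N by rewrite subKn.
  apply: (qg_near_ray alpha_qg q'1 b0 ba (discrete_qg_rev hy)); rewrite ?subn0 ?subnn ?y0 ?yN //.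
    move=> u /andP[u1 u2]; apply: (near N (fun i => y (N - i)%N) b a) => //.
    - exact: discrete_qg_rev.
    - by rewrite subn0 yN.
    - by rewrite subnn y0.
  exact: leq_subr.
apply: (@dist_set_le _ _ _ _ (alpha u)); first exact: trace_ray.
have := metric_triangle (g t) (y i) (alpha u); move: hi hu; clear; lra.
Qed.

(** * Contracting implies quadratic divergence *)

(** The scale is w: within r1 = w / a of the ray, the points of the chain
    project at parameter distance at least 4 C w from s, since the chain avoids
    the ball of radius 8 C ^ 2 w - C, and two consecutive such projections are
    closer than 8 C w. So the projection crosses s during an excursion at
    distance at least r1 from the ray, and it moves by at least 8 w - C. *)
Lemma crossing_length (R : realType) (X : metricType R)
    (C : R) (alpha : R -> X) (alpha_qg : quasi_geodesic_ray C C alpha)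
    (tau : X -> R) (a b K kappa w s : R) (n : nat) (z : nat -> X) :
  1 <= a -> 0 <= b -> 0 < K -> 0 < kappa ->
  (forall x, 0 <= tau x) ->
  (forall x, mdist x (alpha (tau x)) <= a * dist_set x (trace alpha) + b) ->
  (forall x y, mdist x y < kappa * dist_set x (trace alpha) ->
     mdist (alpha (tau x)) (alpha (tau y)) <= K) ->
  b + 2 * C + 1 + 3 * K + 2 * a / kappa <= w -> 16 * C ^+ 3 * w <= s ->
  z 0%N = alpha (s - 16 * C ^+ 3 * w) -> z n = alpha (s + 16 * C ^+ 3 * w) ->
  (forall i, (i < n)%N -> mdist (z i) (z i.+1) <= 1) ->
  (forall i, (i <= n)%N -> 8 * C ^+ 2 * w - C <= mdist (alpha s) (z i)) ->
  2 * kappa * w ^+ 2 / (a * K) <= \sum_(i < n) mdist (z i) (z i.+1).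
Proof.
move=> a1 b0 K0 k0 tau0 h1 h2 hw rs z0 zn zstep zfar.
have C1 := ray_C1 alpha_qg; have C0 : 0 < C by exact: lt_le_trans ltr01 C1.
have a0 : 0 < a by exact: lt_le_trans ltr01 a1.
have ak0 : 0 <= 2 * a / kappa by rewrite divr_ge0 ?mulr_ge0 // ltW.
have w1 : 1 <= w by move: hw b0 C0 K0 ak0; clear; lra.
have w0 : 0 < w by exact: lt_le_trans ltr01 w1.
have C2 : 1 <= C ^+ 2 by rewrite exprn_ege1.
have C3 : C <= C ^+ 3 by rewrite exprS ler_peMr // ltW.
set r := 16 * C ^+ 3 * w in rs z0 zn.
have rw : 16 * w * C <= r.
  have : 0 <= 16 * w * (C ^+ 3 - C) by rewrite mulr_ge0 ?mulr_ge0 ?subr_ge0 // ltW.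
  rewrite /r; clear; lra.
have r0 : 0 <= r by apply: le_trans rw; rewrite !mulr_ge0 // ltW.
have s0 : 0 <= s by exact: le_trans rs.
pose r1 := w / a; have ar1 : a * r1 = w by rewrite /r1 mulrC divfK // gt_eqF.
have r10 : 0 < r1 by rewrite divr_gt0.
have kr1 : 2 <= kappa * r1.
  have : 2 * a / kappa <= w by move: hw b0 C0 K0; clear; lra.
  by rewrite ler_pdivrMr // /r1 mulrA ler_pdivlMr // (mulrC w).
pose dist i := dist_set (z i) (trace alpha).
pose t i := tau (z i).
have near_far i : (i <= n)%N -> dist i < r1 -> 4 * C * w <= `|t i - s|.
  move=> iN di; have e1 := h1 (z i).
  have e2 : a * dist i <= w by rewrite -ar1 ler_pM2l // ltW.
  have e3 := zfar i iN; have e4 := metric_triangle (alpha s) (alpha (t i)) (z i).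
  rewrite (metric_sym (alpha (t i)) (z i)) in e4.
  have e5 := ray_upper alpha_qg s0 (tau0 (z i)); rewrite distrC in e5.
  rewrite -(ler_pM2l C0).
  have e6 : 0 <= (C ^+ 2 - 1) * w by rewrite mulr_ge0 ?subr_ge0 // ltW.
  have -> : C * (4 * C * w) = 4 * C ^+ 2 * w by ring.
  move: e1 e2 e3 e4 e5 e6 hw b0 C0 K0 ak0; rewrite -/(t i) -/(dist i); clear; lra.
have side i : (i <= n)%N -> dist i < r1 -> t i <= s \/ s + 4 * C * w <= t i.
  move=> iN di; have H := near_far i iN di.
  have [|ts] := leP (t i) s; [by left|right].
  by move: H; rewrite ger0_norm ?subr_ge0 ?(ltW ts) //; clear; lra.
have side_l i : (i <= n)%N -> dist i < r1 -> t i <= s -> t i <= s - 4 * C * w.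
  move=> iN di ts; have := near_far i iN di.
  rewrite distrC ger0_norm ?subr_ge0 //; clear; lra.
pose L m := \sum_(i < m) mdist (z i) (z i.+1).
have LS m : L m.+1 = L m + mdist (z m) (z m.+1) by rewrite /L big_ord_recr.
have L0 m : 0 <= L m by apply: sumr_ge0 => i _; exact: mdist_ge0.
(* After m steps, the chain has travelled far from the ray and has already
   carried its projection across s. *)
pose big m := exists N : nat, N%:R * (kappa * r1 / 2) <= L m /\ 8 * w - C <= K * (N%:R + 3).
pose left_near m := dist m < r1 /\ t m <= s.
(* The chain left the ray at the parameter be, to the left of s; z j is the
   last anchor, and N anchors were passed, each after a travel of at least
   kappa r1 / 2 and at the cost of one K in the projection. *)
pose far m := r1 <= dist m /\ exists (N : nat) be j, [/\ 0 <= be, be <= s - 4 * C * w,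
   r1 <= dist j & mdist (alpha be) (alpha (t j)) <= K * (N%:R + 1)] /\
   mdist (z j) (z m) < kappa * r1 /\ N%:R * (kappa * r1 / 2) + mdist (z j) (z m) <= L m.
have move_far i j : r1 <= dist i -> mdist (z i) (z j) < kappa * r1 ->
    mdist (alpha (t i)) (alpha (t j)) <= K.
  by move=> di dij; apply: h2; apply: lt_le_trans dij _; rewrite ler_pM2l.
have d1 i : (i < n)%N -> mdist (z i) (z i.+1) < kappa * r1.
  by move=> hi; have := zstep i hi; move: kr1; clear; lra.
have inv m : (m <= n)%N -> big m \/ left_near m \/ far m.
  elim: m => [_|m IH mn].
    right; left; split.
      apply: le_lt_trans r10; apply: (@dist_set_le _ _ _ _ (z 0%N)); last by rewrite mdistxx.
      by rewrite z0; apply: trace_ray; rewrite subr_ge0.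
    have sr : 0 <= s - r by rewrite subr_ge0.
    have e0 : dist 0%N <= 0.
      by apply: (@dist_set_le _ _ _ _ (z 0%N)); rewrite ?mdistxx // z0; exact: trace_ray.
    have e1 := h1 (z 0%N); have e2 : a * dist 0%N <= 0 by rewrite pmulr_rle0.
    have e3 := ray_param alpha_qg sr (tau0 (z 0%N)); rewrite -z0 in e3.
    have e4 : C * (mdist (z 0%N) (alpha (tau (z 0%N))) + C) <= C * (16 * w).
      rewrite ler_pM2l //; move: e1 e2 hw b0 C0 K0 ak0; rewrite -/(dist 0%N); clear; lra.
    have := ler_norm (tau (z 0%N) - (s - r)); rewrite distrC -/(t 0%N).
    by move: e3 e4 rw; rewrite -/(t 0%N); clear; lra.
  have mn' := ltnW mn.
  have stepL : L m <= L m.+1 by rewrite LS lerDl mdist_ge0.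
  case: (IH mn') => [[N [b1 b2]]|[[dm tm]|[dm [N [be [j [[be0 bes dj e1] [e2 e3]]]]]]]].
  - by left; exists N; split => //; exact: le_trans stepL.
  - right; have [dm1|dm1] := ltP (dist m.+1) r1; last first.
      right; split => //; exists 0%N, (t m), m.+1; split; last first.
        by rewrite mdistxx mul0r addr0; split => //; move: kr1; clear; lra.
      split => //; first exact: tau0; first exact: side_l.
      rewrite add0r mulr1 metric_sym; apply: move_far => //.
      by rewrite metric_sym; exact: d1.
    left; split => //; have [//|h] := side _ mn dm1; exfalso.
    have h' := side_l _ mn' dm tm.
    have g1 := h1 (z m); have g2 := h1 (z m.+1).
    have g3 : a * dist m <= w by rewrite -ar1 ler_pM2l // ltW.
    have g4 : a * dist m.+1 <= w by rewrite -ar1 ler_pM2l // ltW.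
    have g5 := metric_triangle (alpha (t m)) (z m) (alpha (t m.+1)).
    have g6 := metric_triangle (z m) (z m.+1) (alpha (t m.+1)).
    rewrite (metric_sym (alpha (t m)) (z m)) in g5.
    have g7 := zstep m mn.
    have g8 := ray_param alpha_qg (tau0 (z m.+1)) (tau0 (z m)).
    have g9 := ler_norm (t m.+1 - t m).
    rewrite (metric_sym (alpha (tau (z m.+1)))) in g8.
    have g10 : C * (mdist (alpha (tau (z m))) (alpha (tau (z m.+1))) + C) < C * (8 * w).
      rewrite ltr_pM2l //; move: g1 g2 g3 g4 g5 g6 g7 hw b0 C0 K0 ak0.
      rewrite -/(t m) -/(t m.+1) -/(dist m) -/(dist m.+1); clear; lra.
    by move: h h' g8 g9 g10; rewrite -/(t m) -/(t m.+1); clear; lra.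
  have mj := move_far _ _ dj e2.
  have [dm1|dm1] := ltP (dist m.+1) r1; last first.
    right; right; split => //.
    have tri := metric_triangle (z j) (z m) (z m.+1).
    have [hj|hj] := ltP (mdist (z j) (z m.+1)) (kappa * r1).
      exists N, be, j; split => //; split => //.
      by rewrite LS; move: tri e3; clear; lra.
    exists N.+1, be, m; split.
      split => //; have := metric_triangle (alpha be) (alpha (t j)) (alpha (t m)).
      by rewrite -natr1; move: e1 mj; clear; lra.
    split; first exact: d1.
    have st := zstep m mn; rewrite LS -natr1.
    by move: tri hj e3 st kr1; clear; lra.
  have mm : mdist (alpha (t m)) (alpha (t m.+1)) <= K by apply: move_far => //; exact: d1.
  have [tm1|tm1] := side _ mn dm1; first by right; left.
  left; exists N; split.
    by move: e3 stepL (mdist_ge0 (z j) (z m)); clear; lra.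
  have g1 := metric_triangle (alpha be) (alpha (t j)) (alpha (t m.+1)).
  have g2 := metric_triangle (alpha (t j)) (alpha (t m)) (alpha (t m.+1)).
  have g3 := ray_lower alpha_qg be0 (tau0 (z m.+1)).
  have g4 : 8 * w <= `|be - t m.+1| / C.
    rewrite ler_pdivlMr // distrC; have := ler_norm (t m.+1 - be).
    by move: bes tm1; clear; lra.
  by move: e1 mj mm g1 g2 g3 g4; rewrite -/(t m.+1); clear; lra.
have dn : dist n <= 0.
  apply: (@dist_set_le _ _ _ _ (z n)); rewrite ?mdistxx // zn; apply: trace_ray.
  by rewrite addr_ge0.
have [[N [b1 b2]]|[[_ tn]|[/le_trans/(_ dn)]]] := inv n (leqnn n); last first.
- by rewrite leNgt r10.
- exfalso; have sr : 0 <= s + r by rewrite addr_ge0.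
  have e1 := h1 (z n); have e2 : a * dist n <= 0 by rewrite pmulr_rle0.
  have e3 := ray_param alpha_qg sr (tau0 (z n)); rewrite -zn in e3.
  have e4 : C * (mdist (z n) (alpha (tau (z n))) + C) < C * (16 * w).
    rewrite ltr_pM2l //; move: e1 e2 hw b0 C0 K0 ak0; rewrite -/(dist n); clear; lra.
  have := ler_norm (s + r - tau (z n)); rewrite -/(t n).
  by move: e3 e4 rw tn; rewrite -/(t n); clear; lra.
apply: le_trans b1.
have N0 : 4 * w / K <= N%:R.
  by rewrite ler_pdivrMr // (mulrC N%:R); move: b2 hw b0 C0 ak0 w0; clear; lra.
have := ler_wpM2r (_ : 0 <= kappa * r1 / 2) N0.
have -> : 4 * w / K * (kappa * r1 / 2) = 2 * kappa * w ^+ 2 / (a * K).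
  by rewrite /r1; field; rewrite !gt_eqF.
by apply; rewrite divr_ge0 // mulr_ge0 // ltW.
Qed.

Theorem contracting_quadratic_divergence (R : realType) (X : metricType R)
    (C : R) (alpha : R -> X) (alpha_qg : quasi_geodesic_ray C C alpha) :
  contracting alpha -> at_least_quadratic_divergence C alpha.
Proof.
move=> [pi [D1 [D2 [kappa [C2 [k0 hpi hD hC]]]]]].
have C1 := ray_C1 alpha_qg; have C0 : 0 < C by exact: lt_le_trans ltr01 C1.
have /choice[tau htau] : forall x, exists t, 0 <= t /\ pi x (alpha t).
  by move=> x; have [[y py] /(_ y py) [t t0 e]] := hpi x; exists t; rewrite e.
pose a := `|D1| + 1; pose b := `|D2|; pose K := `|C2| + 1.
have a1 : 1 <= a by rewrite lerDr.
have b0 : 0 <= b by exact: normr_ge0.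
have K0 : 0 < K by rewrite ltr_wpDl.
have tau0 x : 0 <= tau x by have [] := htau x.
have h1 x : mdist x (alpha (tau x)) <= a * dist_set x (trace alpha) + b.
  have : mdist x (alpha (tau x)) <= (D1 + 1) * dist_set x (trace alpha) + D2.
    rewrite -lee_fin; apply: le_trans (hD x); apply: ereal_sup_ubound.
    exists (x, alpha (tau x)) => //; split; [by left|by right; have [] := htau x].
  move/le_trans; apply; apply: lerD; last exact: ler_norm.
  by apply: ler_wpM2r; [exact: dist_set_ge0|rewrite lerD2r ler_norm].
have h2 x y : mdist x y < kappa * dist_set x (trace alpha) ->
    mdist (alpha (tau x)) (alpha (tau y)) <= K.
  move=> /hC hle; have : mdist (alpha (tau x)) (alpha (tau y)) <= C2.
    rewrite -lee_fin; apply: le_trans hle; apply: ereal_sup_ubound.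
    exists (alpha (tau x), alpha (tau y)) => //.
    by split; [left; have [] := htau x|right; have [] := htau y].
  by have := ler_norm C2; rewrite /K; clear; lra.
pose w0 := b + 2 * C + 1 + 3 * K + 2 * a / kappa.
have w00 : 0 < w0.
  have : 0 <= 2 * a / kappa by rewrite divr_ge0 ?mulr_ge0 ?(ltW k0) // (le_trans ler01).
  by rewrite /w0; move: b0 C0 K0; clear; lra.
pose M := 16 * C ^+ 3; have M0 : 0 < M by rewrite mulr_gt0 // exprn_gt0.
pose c1 := 2 * kappa / (a * K) / M ^+ 2.
have c10 : 0 < c1.
  by rewrite !divr_gt0 ?mulr_gt0 ?exprn_gt0 // (lt_le_trans ltr01).
pose r0 := M * w0; have r00 : 0 < r0 by rewrite mulr_gt0.
pose c := Num.min c1 (1 / r0).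
have c0 : 0 < c by rewrite lt_min c10 divr_gt0.
have cc1 : c <= c1 by rewrite ge_min lexx.
have cr0 : c <= 1 / r0 by rewrite ge_min lexx orbT.
exists (1 / (2 * C)), C; split => //.
- by rewrite divr_gt0 ?mulr_gt0.
- rewrite !div1r ltf_pV2 ?posrE ?mulr_gt0 //; move: C0; clear; lra.
exists c => // r rpos; apply: le_ereal_inf_tmp => _ [s rs <-].
apply: le_ereal_inf_tmp => _ [p [pc p0 p1 pavoid] <-].
have [n [t [t0 tn ti tb td]]] := fine_subdivision ltr01 pc.
apply: le_trans (path_length_ge p t0 tn ti); rewrite lee_fin.
have [rr0|rr0] := ltP r r0.
  apply: (@le_trans _ _ 0); last by apply: sumr_ge0 => i _; exact: mdist_ge0.
  rewrite subr_le0 ler_pdivlMr //.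
  have e1 : c * r <= 1.
    apply: (@le_trans _ _ (1 / r0 * r0)); last by rewrite divfK ?gt_eqF.
    by apply: ler_pM => //; exact: ltW.
  have -> : c * r ^+ 2 * c = (c * r) ^+ 2 by ring.
  by rewrite exprn_ile1 // mulr_ge0 // ltW.
pose w := r / M; have wM : M * w = r by rewrite mulrC divfK // gt_eqF.
have ww : w0 <= w by rewrite ler_pdivlMr // mulrC.
apply: (@le_trans _ _ (c1 * r ^+ 2)).
  have e1 : c * r ^+ 2 <= c1 * r ^+ 2 by rewrite ler_wpM2r ?sqr_ge0.
  have e2 : 0 <= 1 / c by rewrite divr_ge0 // ltW.
  by move: e1 e2; clear; lra.
have -> : c1 * r ^+ 2 = 2 * kappa * w ^+ 2 / (a * K).
  rewrite /c1 -wM; field; rewrite !gt_eqF // (lt_le_trans ltr01) //.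
apply: (@crossing_length _ _ _ _ alpha_qg tau a b K kappa w s n (fun i => p (t i))) => //.
- by rewrite -/M wM.
- by rewrite -/M wM t0.
- by rewrite -/M wM tn.
move=> i iN; have := pavoid (t i) (tb i iN); rewrite ballEmdist /= => /negP.
rewrite -leNgt; apply: le_trans; rewrite lerD2r -wM /M.
by have -> : 1 / (2 * C) * (16 * C ^+ 3 * w) = 8 * C ^+ 2 * w by field; rewrite gt_eqF.
Qed.

(** * Cubical models of finite subsets *)

Lemma edge_distE (R : realType) (Q : cube_complex) (x y : vertex Q) :
  CAT0_cube_complex Q -> edge_dist R x y = (gdist x y)%:R.
Proof.
move=> CAT0; have [p hp sp] := gdist_path CAT0 x y.
apply/eqP; rewrite eq_le; apply/andP; split.
  apply: ge_inf; last by exists p => //; rewrite sp.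
  by exists 0 => _ [q _ <-].
apply: lb_le_inf; first by exists (size p)%:R, p.
by move=> _ [q hq <-]; rewrite ler_nat; exact: gdist_le.
Qed.

Lemma on_geodesic_refl (Q : cube_complex) (a : vertex Q) : on_geodesic a a a.
Proof. by exists [::], [::]; split => //; split. Qed.

Section Transfer.
Variables (R : realType) (X : metricType R) (m : X -> X -> X -> X).

Definition cubical_model (K : R) (s : seq X) :=
  exists (Q : cube_complex) (f : vertex Q -> X),
  [/\ CAT0_cube_complex Q, median_up_to m K f,
      forall a b, qi_bounds K K (gdist a b)%:R (mdist (f a) (f b)) &
      forall x, x \in s -> exists a, mdist x (f a) <= K].

End Transfer.

Lemma coarse_median_lipschitz (R : realType) (X : metricType R) (m : X -> X -> X -> X)
    (h : nat -> nat) (cm : coarse_median m h) x y z x' y' z' : mdist (m x y z) (m x' y' z') <=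
     (h 1%N)%:R * (mdist x x' + mdist y y' + mdist z z').
Proof. by have [+ _] := cm; apply. Qed.

(** The cubical approximation of one point suffices, since a vertex is the
    median of itself. *)
Lemma median_diag (R : realType) (X : metricType R) (m : X -> X -> X -> X)
    (h : nat -> nat) (cm : coarse_median m h) :
  exists2 e : R, 0 <= e & forall x, mdist x (m x x x) <= e.
Proof.
pose H : R := (h 1%N)%:R; have H0 : 0 <= H by rewrite /H.
exists (H + H + H * (H + H + H)); first by rewrite !addr_ge0 // mulr_ge0 // !addr_ge0.
move=> x; have [_ /(_ 1%N [set x])] := cm; rewrite (card_le_eql card_set1).
move=> /(_ (card_lexx _)) [Q [_ _ [f [g [fm fg]]]]].
have h1 := fg x erefl.
have mm : is_median (g x) (g x) (g x) (g x) by split; exact: on_geodesic_refl.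
have h2 := fm _ _ _ _ mm.
have h3 := coarse_median_lipschitz cm (f (g x)) (f (g x)) (f (g x)) x x x.
have h4 := metric_triangle x (f (g x)) (m x x x).
have h5 := metric_triangle (f (g x)) (m (f (g x)) (f (g x)) (f (g x))) (m x x x).
have h6 : H * (mdist (f (g x)) x + mdist (f (g x)) x + mdist (f (g x)) x) <= H * (H + H + H).
  by rewrite ler_wpM2l // !lerD // metric_sym.
rewrite -/H in h1 h2 h3; move: h1 h2 h3 h4 h5 h6; clear; lra.
Qed.

(** The set F is only coarsely contained in its hull: each join replaces y by
    m y y y. *)
Lemma hull_near (R : realType) (X : metricType R) (m : X -> X -> X -> X)
    (h : nat -> nat) (v : nat) (cm : coarse_median m h) :
  exists2 e : R, 0 <= e & forall (F : set X) x, F x ->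
  exists2 y, hull m v F y & mdist x y <= e.
Proof.
have [e e0 he] := median_diag cm; exists (v%:R * e); first by rewrite mulr_ge0.
move=> F x Fx; elim: (v) => [|k [y hy xy]].
  by exists x => //; rewrite mdistxx mul0r.
exists (m y y y).
  by rewrite /hull iterS; exists y => //; exists y => //; exists y.
apply: le_trans (metric_triangle _ y _) _; rewrite -natr1 mulrDl mul1r.
by apply: lerD => //; exact: he.
Qed.

Lemma card_seq_le (T : choiceType) (s : seq T) n : [set` s] #= `I_n -> (n <= size s)%N.
Proof.
move=> hn; rewrite -card_le_II -(card_le_eql hn).
case: s {hn} => [|x0 s]; first by rewrite set_nil card_ge0.
suff <- : nth x0 (x0 :: s) @` `I_(size (x0 :: s)) = [set` x0 :: s].
  exact: card_image_le.
rewrite eqEsubset; split => [_ [i hi <-]|y ys]; first exact: mem_nth.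
by exists (index y (x0 :: s)); [rewrite /mkset index_mem|exact: nth_index].
Qed.

(** The constants for the cardinalities up to N are added up, together with the
    distance from F to its hull. *)
Lemma LQC_cubical_model (R : realType) (X : metricType R) (m : X -> X -> X -> X)
    (h : nat -> nat) (v : nat) (cm : coarse_median m h) :
  locally_cubical m v -> forall N, exists2 K : R, 1 <= K &
  forall s, s != [::] -> (size s <= N)%N -> cubical_model m K s.
Proof.
move=> [K lc] N; have [e e0 he] := hull_near v cm.
pose B := 1 + \sum_(n < N.+1) `|K n| + e.
have KB n : (n <= N)%N -> K n <= 1 + \sum_(n < N.+1) `|K n|.
  move=> nN; rewrite (bigD1 (Ordinal (nN : (n < N.+1)%N))) //=.
  have : 0 <= \sum_(i < N.+1 | i != Ordinal (nN : (n < N.+1)%N)) `|K i|.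
    by apply: sumr_ge0.
  by have := ler_norm (K n); clear; lra.
have S0 : 0 <= \sum_(n < N.+1) `|K n| by exact: sumr_ge0.
exists B; first by move: S0 e0; rewrite /B; clear; lra.
move=> s s0 sN.
have [n hn] : exists n, [set` s] #= `I_n by apply/finite_setP; exact: finite_seq.
have nN : (n <= N)%N by apply: leq_trans sN; exact: card_seq_le.
have Fne : [set` s] !=set0.
  by case: s s0 {sN hn} => // x s _; exists x; rewrite /= mem_head.
have [Q [CAT0 _ [f fm [K1 fH fqi fsurj]]]] := lc n _ Fne hn.
have KnB := KB n nN; have KnB' : K n <= B by move: KnB e0; rewrite /B; clear; lra.
exists Q, f; split => //.
- by move=> a b c mu /fm/le_trans; apply.
- move=> a b; have /andP[] := fqi a b; rewrite (edge_distE _ _ _ CAT0).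
  set d := (gdist a b)%:R; have d0 : 0 <= d :> R by [].
  have Kn0 : 0 < K n by exact: lt_le_trans ltr01 K1.
  have k1 : d / B <= d / K n.
    by rewrite ler_wpM2l // lef_pV2 // posrE ?(lt_le_trans Kn0).
  have k2 : K n * d <= B * d by rewrite ler_wpM2r.
  by move=> h1 h2; apply/andP; split; move: h1 h2 k1 k2 KnB'; clear; lra.
move=> x xs; have [y hy xy] := he [set` s] x xs; have [a ya] := fsurj y hy.
exists a; have := metric_triangle x y (f a); move: xy ya KnB; rewrite /B; clear; lra.
Qed.

(** Adding the endpoints on the ray to the chain costs a factor 5 in the
    constants; the interpolation of the new chain is a continuous
    quasi-geodesic. *)
Lemma discrete_Morse (R : realType) (X : metricType R) (Xgeo : geodesic_space X)
    (alpha : R -> X) : Morse alpha -> forall q : R, 1 <= q -> exists2 M : R, 0 <= M &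
  forall N y s t, discrete_qg q N y -> 0 <= s -> 0 <= t ->
    mdist (alpha s) (y 0%N) <= q -> mdist (alpha t) (y N) <= q ->
    forall i, (i <= N)%N -> exists2 u, 0 <= u & mdist (y i) (alpha u) <= M.
Proof.
move=> hM q q1; have q0 : 0 < q by exact: lt_le_trans ltr01 q1.
pose q' := 5 * q; pose J := 2 * q'; pose Q' := q' + 2 * J + 1.
have q'1 : 1 <= q' by rewrite /q'; move: q1; clear; lra.
have q'0 : 0 < q' by exact: lt_le_trans ltr01 q'1.
have J1 : 1 <= J by rewrite /J; move: q'1; clear; lra.
have J0 : 0 < J by exact: lt_le_trans ltr01 J1.
have Q'0 : 0 <= Q' by rewrite /Q'; move: J1 q'1; clear; lra.
have [M0 hM0] := hM J Q' J1 Q'0.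
exists (`|M0| + 1); first by rewrite addr_ge0.
move=> N y s t hy s0 t0 hs ht i iN.
(* y' is alpha s, y 0, ..., y N, alpha t, within q of the chain y reindexed by
   phi. *)
pose phi k := minn k.-1 N.
have phi_mono k l : (k <= l)%N -> (phi k <= phi l)%N.
  by clear; rewrite /phi; lia.
have phi_gap k l : (k <= l)%N -> (l <= N.+2)%N ->
    (phi l - phi k <= l - k)%N /\ (l - k <= phi l - phi k + 2)%N.
  by clear; rewrite /phi; lia.
have phi_i : (i.+1 == N.+2) = false /\ phi i.+1 = i.
  by move: iN; clear; rewrite /phi; lia.
pose y' k := if k == 0%N then alpha s else if k == N.+2 then alpha t else y (phi k).
have y'd k : (k <= N.+2)%N -> mdist (y' k) (y (phi k)) <= q.
  rewrite /y'; case: eqP => [->|_] hk; first by rewrite /phi min0n.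
  case: eqP => [->|_]; last by rewrite mdistxx ltW.
  by rewrite /phi /= (minn_idPr (leqnSn N)).
have phiN k : (phi k <= N)%N by rewrite /phi geq_minr.
have hy' : discrete_qg q' N.+2 y'.
  suff H k l : (k <= l)%N -> (l <= N.+2)%N ->
      qi_bounds q' q' `|k%:R - l%:R| (mdist (y' k) (y' l)).
    move=> k l hk hl; case/orP: (leq_total k l) => kl; first exact: H.
    by rewrite /qi_bounds distrC metric_sym; exact: H.
  move=> kl hl; have hk := leq_trans kl hl.
  have e1 := y'd k hk; have e2 := y'd l hl.
  have /andP[e3 e4] := hy _ _ (phiN k) (phiN l).
  have e5 := metric_triangle (y' k) (y (phi k)) (y' l).
  have e6 := metric_triangle (y (phi k)) (y (phi l)) (y' l).
  have e7 := metric_triangle (y (phi k)) (y' k) (y (phi l)).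
  have e8 := metric_triangle (y' k) (y' l) (y (phi l)).
  rewrite (metric_sym (y (phi k)) (y' k)) in e7.
  rewrite (metric_sym (y (phi l)) (y' l)) in e6.
  have pkl := phi_mono k l kl; have [g1 g2] := phi_gap k l kl hl.
  move: e3 e4; rewrite (distrC k%:R) (distrC (phi k)%:R) -!natrB // !normr_nat.
  set D := (phi l - phi k)%N; set E := (l - k)%N => e3 e4.
  have DE : D%:R <= E%:R :> R by rewrite ler_nat.
  have ED : E%:R <= D%:R + 2 :> R by rewrite -natrD ler_nat.
  have k1 : E%:R / q' <= E%:R / q.
    by rewrite ler_wpM2l // lef_pV2 ?posrE // /q'; move: q0; clear; lra.
  have k2 : E%:R / q <= (D%:R + 2) / q by rewrite ler_pM2r // invr_gt0.
  have k3 : (D%:R + 2) / q = D%:R / q + 2 * (1 / q) by ring.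
  have k4 : 1 / q <= 1 by rewrite ler_pdivrMr // mul1r.
  have k5 : q * D%:R <= q * E%:R by rewrite ler_pM2l.
  have k6 : 0 <= q * E%:R by rewrite mulr_ge0 // ltW.
  apply/andP; split; rewrite /q'.
    rewrite -/q'; move: e1 e2 e3 e7 e8 k1 k2 k3 k4 q1; rewrite /q'; clear; lra.
  by move: e1 e2 e4 e5 e6 k5 k6 q1; clear; lra.
have step k : (k < N.+2)%N -> mdist (y' k) (y' k.+1) <= J.
  move=> hk; have /andP[_] := hy' k k.+1 (ltnW hk) hk.
  rewrite -natr1 distrC; have -> : k%:R + 1 - k%:R = 1 :> R by ring.
  by rewrite normr1 /J; clear; lra.
have [g [gy glip]] := chain_interpolation Xgeo (ltW J0) step.
have hg : quasi_geodesic J Q' `[0, N.+2%:R]%classic g.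
  split => //.
    by apply: lipschitz_within_continuous => a b; rewrite /= !in_itv /=; exact: glip.
  move=> a b; rewrite /= !in_itv /= => ha hb; apply/andP; split; last first.
    by apply: le_trans (glip _ _ ha hb) _; rewrite lerDl.
  have [k hk [k1 k2]] := nat_approx ha; have [l hl [l1 l2]] := nat_approx hb.
  have /andP[e1 _] := hy' k l hk hl.
  have hk' : 0 <= (k%:R : R) <= N.+2%:R by rewrite ler0n ler_nat.
  have hl' : 0 <= (l%:R : R) <= N.+2%:R by rewrite ler0n ler_nat.
  have e2 := glip _ _ ha hk'; have e3 := glip _ _ hb hl'.
  rewrite !gy // in e2 e3.
  have e4 : J * `|a - k%:R| <= J by rewrite ler_piMr ?(ltW J0) // ger0_norm // subr_ge0.
  have e5 : J * `|b - l%:R| <= J by rewrite ler_piMr ?(ltW J0) // ger0_norm // subr_ge0.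
  have e6 := metric_triangle (y' k) (g a) (y' l).
  have e7 := metric_triangle (g a) (g b) (y' l).
  rewrite (metric_sym (y' k) (g a)) in e6.
  have e8 : `|a - b| - 1 <= `|k%:R - l%:R|.
    have h1 : `|a - b| <= `|k%:R - l%:R| + `|(a - k%:R) - (b - l%:R)|.
      apply: le_trans (ler_normD _ _).
      by have -> : k%:R - l%:R + (a - k%:R - (b - l%:R)) = a - b by ring.
    have h2 : `|(a - k%:R) - (b - l%:R)| <= 1.
      by rewrite ler_norml; move: k1 k2 l1 l2; clear; lra.
    by move: h1 h2; clear; lra.
  have e9 : (`|a - b| - 1) / q' <= `|k%:R - l%:R| / q' by rewrite ler_pM2r // invr_gt0.
  have e10 : (`|a - b| - 1) / q' = `|a - b| / q' - 1 / q' by ring.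
  have e11 : 1 / q' <= 1 by rewrite ler_pdivrMr // mul1r.
  have e12 : `|a - b| / J <= `|a - b| / q'.
    by rewrite ler_wpM2l // lef_pV2 ?posrE // /J; move: q'0; clear; lra.
  by rewrite /Q'; move: e1 e2 e3 e4 e5 e6 e7 e9 e10 e11 e12; clear; lra.
have i1 : 0 <= (i.+1%:R : R) <= N.+2%:R by rewrite ler0n ler_nat ltnS (leq_trans iN).
have := hM0 g 0 N.+2%:R (ler0n _ _) hg _ _ _ i1.
rewrite (gy 0%N) // !gy ?ltnS ?(leq_trans iN) // /y' /= eqxx.
rewrite phi_i.1 phi_i.2.
move=> /(_ (ex_intro2 _ _ s s0 erefl) (ex_intro2 _ _ t t0 erefl)) hd.
have [|_ [u u0 <-] hu] := @dist_set_lt _ _ (y i) (trace alpha) (`|M0| + 1) (trace_nonempty _).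
  by apply: le_lt_trans hd _; have := ler_norm M0; clear; lra.
by exists u => //; exact: ltW.
Qed.

Lemma geodesic_chain_through (Q : cube_complex) (CAT0 : CAT0_cube_complex Q)
    (x y z : vertex Q) : between x y z -> exists c : nat -> vertex Q,
  [/\ c 0%N = x, c (gdist x z) = z, c (gdist x y) = y &
      forall i j, (i <= j <= gdist x y)%N -> gdist (c i) (c j) = (j - i)%N].
Proof.
move=> b; have [c1 [a1 z1 d1]] := geodesic_chain CAT0 x z.
have [c2 [a2 z2 d2]] := geodesic_chain CAT0 z y.
pose c i := if (i <= gdist x z)%N then c1 i else c2 (i - gdist x z)%N.
have cm2 i : (gdist x z <= i)%N -> c i = c2 (i - gdist x z)%N.
  rewrite /c => h; case: leqP => // h'.
  by have -> : i = gdist x z by [lia]; rewrite subnn a2 z1.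
exists c; split.
- by rewrite /c.
- by rewrite /c leqnn.
- by rewrite cm2 -b ?leq_addr // addKn.
move=> i j /andP[ij jn].
case: (leqP j (gdist x z)) => jT.
  by rewrite /c jT (leq_trans ij jT) d1 // ij.
rewrite (cm2 j) ?(ltnW jT) //.
case: (leqP (gdist x z) i) => iT.
  by rewrite cm2 // d2; rewrite -b in jn; lia.
rewrite {1}/c (ltnW iT).
have e0 : gdist x (c1 i) = i.
  by have := d1 0%N i; rewrite a1 subn0; apply; rewrite leq0n ltnW.
have e1 : gdist (c1 i) z = (gdist x z - i)%N.
  by have := d1 i (gdist x z); rewrite z1; apply; rewrite leqnn ltnW.
have jz : (j - gdist x z <= gdist z y)%N by move: b jn; rewrite /between; lia.
have e2 : gdist z (c2 (j - gdist x z)%N) = (j - gdist x z)%N.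
  by have := d2 0%N (j - gdist x z)%N; rewrite a2 subn0; apply.
have e3 : gdist (c2 (j - gdist x z)%N) y = (gdist z y - (j - gdist x z))%N.
  by have := d2 (j - gdist x z)%N (gdist z y); rewrite z2; apply; rewrite jz leqnn.
rewrite (gdist_cat CAT0 b) /between ?e0 ?e1 ?e2 ?e3; lia.
Qed.

(** * Morse implies contracting *)

Definition qi_embedding (R : realType) (X : metricType R) (Q : cube_complex)
    (K : R) (f : vertex Q -> X) :=
  forall a b, qi_bounds K K (gdist a b)%:R (mdist (f a) (f b)).

(** The factor 3 is that of the boundary path of a rectangle. *)
Lemma qi_embedding_chain (R : realType) (X : metricType R) (Q : cube_complex)
    (K q : R) (f : vertex Q -> X) (c : nat -> vertex Q) n :
  1 <= K -> 3 * K <= q -> qi_embedding K f ->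
  (forall i j, (i <= j <= n)%N -> (gdist (c i) (c j) <= j - i <= 3 * gdist (c i) (c j))%N) ->
  discrete_qg q n (f \o c).
Proof.
move=> K1 Kq hf hc; have K0 : 0 < K by exact: lt_le_trans ltr01 K1.
have q0 : 0 < q by move: K0 Kq; clear; lra.
suff H i j : (i <= j)%N -> (j <= n)%N ->
    qi_bounds q q `|i%:R - j%:R| (mdist (f (c i)) (f (c j))).
  move=> i j hi hj; case/orP: (leq_total i j) => ij; first exact: H.
  by rewrite /qi_bounds distrC metric_sym; exact: H.
move=> ij jn; have /andP[h1 h2] := hc i j ltac:(by rewrite ij jn).
have /andP[h3 h4] := hf (c i) (c j).
rewrite distrC -natrB // normr_nat; set E := (j - i)%N in h1 h2 *.
set G := gdist _ _ in h1 h2 h3 h4.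
have e1 : G%:R <= E%:R :> R by rewrite ler_nat.
have e2 : E%:R <= 3 * G%:R :> R by rewrite -natrM ler_nat.
have e3 : E%:R / q <= E%:R / (3 * K).
  by rewrite ler_wpM2l // lef_pV2 // posrE // mulr_gt0.
have e4 : E%:R / (3 * K) <= G%:R / K.
  rewrite ler_pdivrMr ?mulr_gt0 //.
  by have -> : G%:R / K * (3 * K) = 3 * G%:R by field; rewrite gt_eqF.
have e5 : K * G%:R <= K * E%:R by rewrite ler_pM2l.
have e6 : K * E%:R <= q * E%:R.
  by rewrite ler_wpM2r //; move: K0 Kq; clear; lra.
by apply/andP; split; move: e3 e4 e5 e6 h3 h4 K0 Kq; clear; lra.
Qed.

Lemma qi_embedding_gdist (R : realType) (X : metricType R) (Q : cube_complex)
    (K : R) (f : vertex Q -> X) a b : 1 <= K -> qi_embedding K f ->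
  (gdist a b)%:R <= K * (mdist (f a) (f b) + K).
Proof.
move=> K1 hf; have K0 : 0 < K by exact: lt_le_trans ltr01 K1.
by have /andP[+ _] := hf a b; rewrite lerBlDr ler_pdivrMr // mulrC.
Qed.

Lemma geodesic_chain_bounds (Q : cube_complex) (c : nat -> vertex Q) n :
  (forall i j, (i <= j <= n)%N -> gdist (c i) (c j) = (j - i)%N) ->
  forall i j, (i <= j <= n)%N -> (gdist (c i) (c j) <= j - i <= 3 * gdist (c i) (c j))%N.
Proof. by move=> h i j ij; rewrite h //; lia. Qed.

Section MorseRay.
Variables (R : realType) (X : metricType R).
Hypothesis Xgeo : geodesic_space X.
Variables (C : R) (alpha : R -> X).
Hypothesis alpha_qg : quasi_geodesic_ray C C alpha.
Hypothesis alpha_Morse : Morse alpha.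

(** A geodesic of Q from a to b through u is mapped to a quasi-geodesic with
    both ends near the ray. *)
Lemma interval_near_ray (K : R) : 1 <= K -> exists2 M : R, 0 <= M &
  forall (Q : cube_complex) (f : vertex Q -> X) (s t : R) a b u,
    CAT0_cube_complex Q -> qi_embedding K f -> 0 <= s -> 0 <= t ->
    mdist (alpha s) (f a) <= K -> mdist (alpha t) (f b) <= K -> between a b u ->
    exists2 w, 0 <= w & mdist (f u) (alpha w) <= M.
Proof.
move=> K1; have K3 : 1 <= 3 * K by lra.
have [M M0 hM] := discrete_Morse Xgeo alpha_Morse K3.
exists M => // Q f s t a b u CAT0 hf s0 t0 ha hb hu.
have [c [c0 cu cn hc]] := geodesic_chain_through CAT0 hu.
have hq := qi_embedding_chain K1 (lexx _) hf (geodesic_chain_bounds hc).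
have K3' : K <= 3 * K by lra.
have := hM _ _ s t hq s0 t0; rewrite /= c0 cn.
move=> /(_ (le_trans ha K3') (le_trans hb K3') (gdist a u)); rewrite cu; apply.
by rewrite -hu leq_addr.
Qed.

End MorseRay.

(** Conversely, the image of a geodesic of Q from a to b follows the ray from
    alpha s to alpha u in bounded steps, so it passes near alpha t. *)
Lemma ray_near_interval (R : realType) (X : metricType R) (Xgeo : geodesic_space X)
    (C : R) (alpha : R -> X) (alpha_qg : quasi_geodesic_ray C C alpha)
    (alpha_Morse : Morse alpha) (K : R) : 1 <= K -> exists2 M : R, 0 <= M &
  forall (Q : cube_complex) (f : vertex Q -> X) (s t u : R) a b,
    CAT0_cube_complex Q -> qi_embedding K f -> 0 <= s -> s <= t -> t <= u ->
    mdist (alpha s) (f a) <= K -> mdist (alpha u) (f b) <= K ->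
    exists2 v, between a b v & mdist (alpha t) (f v) <= M.
Proof.
move=> K1; have K0 : 0 < K by exact: lt_le_trans ltr01 K1.
have C1 := ray_C1 alpha_qg; have C0 : 0 < C by exact: lt_le_trans ltr01 C1.
have [M M0 hM] := interval_near_ray Xgeo alpha_Morse K1.
pose M' := M + K; pose E := C * (C * (2 * M' + 2 * K + C)) + C + M'.
have M'0 : 0 <= M' by rewrite addr_ge0 // ltW.
have E0 : 0 <= E.
  have h : 0 <= C * (C * (2 * M' + 2 * K + C)).
    by rewrite !mulr_ge0 ?(ltW C0) //; move: M'0 K0 C0; clear; lra.
  by rewrite /E; move: h M'0 C0; clear; lra.
exists E => // Q f s t u a b CAT0 hf s0 st tu ha hb.
have t0 : 0 <= t by exact: le_trans st.
have u0 : 0 <= u by exact: le_trans tu.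
have [c [c0 cn hc]] := geodesic_chain CAT0 a b.
pose n := gdist a b.
have cb i : (i <= n)%N -> between a b (c i).
  move=> hi; have := hc 0%N i; have := hc i n; rewrite /between c0 cn leq0n hi leqnn.
  by move=> /(_ isT) -> /(_ isT) ->; move: hi; rewrite /n; clear; lia.
have conclude i w : 0 <= w -> `|t - w| <= C * (2 * M' + 2 * K + C) ->
    mdist (f (c i)) (alpha w) <= M' -> mdist (alpha t) (f (c i)) <= E.
  move=> w0 tw hw; have h1 := ray_upper alpha_qg t0 w0.
  have h2 : C * `|t - w| <= C * (C * (2 * M' + 2 * K + C)) by rewrite ler_pM2l.
  have h3 := metric_triangle (alpha t) (alpha w) (f (c i)).
  rewrite (metric_sym (alpha w)) in h3.
  by rewrite /E; move: h1 h2 h3 hw; clear; lra.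
pose P i := exists2 w, 0 <= w <= t & mdist (f (c i)) (alpha w) <= M'.
have P0 : P 0%N.
  exists s; first by rewrite s0.
  by rewrite c0 metric_sym (le_trans ha) // lerDr.
have [[w /andP[w0 wt] hw]|[i [hi [w /andP[w0 wt] hw] nP]]] := nat_crossing n P0.
  exists (c n); first exact: cb.
  apply: (conclude n w) => //.
  have h1 := ray_param alpha_qg u0 w0.
  have h2 : `|t - w| <= `|u - w|.
    rewrite !ger0_norm ?subr_ge0 // ?(le_trans wt) //.
    by rewrite lerD2r.
  apply: le_trans h2 (le_trans h1 _); rewrite ler_pM2l // lerD2r.
  have h3 := metric_triangle (alpha u) (f (c n)) (alpha w).
  by move: h3 hb hw M'0 K0; rewrite /n cn; clear; lra.
have [w' w'0 hw'] := hM Q f s u a b (c i.+1) CAT0 hf s0 u0 ha hb (cb _ hi).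
have hw'' : mdist (f (c i.+1)) (alpha w') <= M' by apply: le_trans hw' _; rewrite lerDl ltW.
have tw' : t <= w'.
  rewrite leNgt; apply/negP => /ltW h; apply: nP; exists w' => //.
  by rewrite w'0.
exists (c i); first exact: cb (ltnW hi).
apply: (conclude i w) => //.
have h1 := ray_param alpha_qg w'0 w0.
have h2 : `|t - w| <= `|w' - w|.
  rewrite !ger0_norm ?subr_ge0 // ?(le_trans wt) //.
  by rewrite lerD2r.
apply: le_trans h2 (le_trans h1 _); rewrite ler_pM2l // lerD2r.
have h3 := metric_triangle (alpha w') (f (c i.+1)) (alpha w).
have h4 := metric_triangle (f (c i.+1)) (f (c i)) (alpha w).
have /andP[_ h5] := hf (c i.+1) (c i).
have h6 : gdist (c i.+1) (c i) = 1%N.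
  by rewrite gdistC // hc ?subSnn //; move: hi; rewrite /n; clear; lia.
rewrite h6 mulr1 in h5; rewrite (metric_sym (alpha w') (f _)) in h3.
by move: h3 h4 h5 hw hw''; clear; lra.
Qed.

Definition lipschitz_median (R : realType) (X : metricType R) (m : X -> X -> X -> X)
    (L : R) :=
  0 <= L /\ forall x y z x' y' z',
    mdist (m x y z) (m x' y' z') <= L * (mdist x x' + mdist y y' + mdist z z').

Definition locally_modelled (R : realType) (X : metricType R) (m : X -> X -> X -> X) :=
  forall N, exists2 K : R, 1 <= K &
    forall s, s != [::] -> (size s <= N)%N -> cubical_model m K s.

Lemma median_model (R : realType) (X : metricType R) (m : X -> X -> X -> X) (L K : R)
    (Q : cube_complex) (f : vertex Q -> X) (x y z : X) a b c mu e :
  CAT0_cube_complex Q -> lipschitz_median m L -> median_up_to m K f ->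
  median a b c mu -> mdist x (f a) + mdist y (f b) + mdist z (f c) <= e ->
  mdist (m x y z) (f mu) <= L * e + K.
Proof.
move=> CAT0 [L0 lip] fm hmu he.
have h1 := fm _ _ _ _ (medianP CAT0 hmu).
have h2 := lip x y z (f a) (f b) (f c).
have h3 := ler_wpM2l L0 he.
have h4 := metric_triangle (m x y z) (m (f a) (f b) (f c)) (f mu).
rewrite (metric_sym (m (f a) (f b) (f c)) (f mu)) in h4.
by move: h1 h2 h3 h4; clear; lra.
Qed.

Section SegmentGates.
Variables (Q : cube_complex).
Hypothesis CAT0 : CAT0_cube_complex Q.

Lemma median_between (o b v : vertex Q) : between o b v -> median v o b v.
Proof.
by move=> h; split => //; [apply: betweenC => //; exact: between_r|exact: between_l].
Qed.

(** For v between o and b, the gate on the interval from o to v factors through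
    the gate on the interval from o to b. *)
Lemma median_initial (x o b v p q : vertex Q) : between o b v ->
  median x o b p -> median x o v q -> median p o v q.
Proof.
move=> /(between_sep CAT0) hv hp hq.
have ep S := @median_majority Q CAT0 _ _ _ _ S hp.
have eq S := @median_majority Q CAT0 _ _ _ _ S hq.
have bits S : halfspace S ->
   [/\ S p = S o -> S q = S p, S o = S v -> S q = S o & S p = S v -> S q = S p].
  move=> hS; move: (hv S hS); rewrite ep // eq // /majority.
  by case: (S x); case: (S o); case: (S b); case: (S v) => //= h; split => //; have := h erefl.
by split; apply/(between_sep CAT0) => S hS; have [] := bits S hS.
Qed.

End SegmentGates.

(** The median of x, alpha 0 and alpha t is the coarse gate of x on the initial
    segment of the ray up to alpha t. *)
Lemma gate_near_ray (R : realType) (X : metricType R) (Xgeo : geodesic_space X)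
    (alpha : R -> X) (alpha_Morse : Morse alpha)
    (m : X -> X -> X -> X) (L : R) (hL : lipschitz_median m L) (hm : locally_modelled m) :
  exists2 M : R, 0 <= M & forall x t, 0 <= t ->
    exists2 u, 0 <= u & mdist (m x (alpha 0) (alpha t)) (alpha u) <= M.
Proof.
have [K K1 hK] := hm 3%N; have K0 : 0 < K by exact: lt_le_trans ltr01 K1.
have [M M0 hM] := interval_near_ray Xgeo alpha_Morse K1; have [L0 _] := hL.
exists (L * (3 * K) + K + M); first by rewrite !addr_ge0 ?mulr_ge0 // ltW.
move=> x t t0.
have [| |Q [f [CAT0 fm fq fs]]] := hK [:: x; alpha 0; alpha t]; [by []|by []|].
have [x' hx] := fs x ltac:(by rewrite !inE eqxx).
have [ o ho] := fs (alpha 0) ltac:(by rewrite !inE eqxx ?orbT).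
have [b hb] := fs (alpha t) ltac:(by rewrite !inE eqxx ?orbT).
have [mu hmu] := median_exists CAT0 x' o b.
have h1 : mdist (m x (alpha 0) (alpha t)) (f mu) <= L * (3 * K) + K.
  by apply: (median_model CAT0 hL fm hmu); move: hx ho hb; clear; lra.
have [u u0 hu] := hM Q f 0 t o b mu CAT0 fq (lexx _) t0 ho hb ltac:(by case: hmu).
exists u => //; have := metric_triangle (m x (alpha 0) (alpha t)) (f mu) (alpha u).
by move: h1 hu; clear; lra.
Qed.

Lemma gate_ray (R : realType) (X : metricType R) (Xgeo : geodesic_space X)
    (C : R) (alpha : R -> X) (alpha_qg : quasi_geodesic_ray C C alpha)
    (alpha_Morse : Morse alpha)
    (m : X -> X -> X -> X) (L : R) (hL : lipschitz_median m L) (hm : locally_modelled m) :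
  exists2 M : R, 0 <= M & forall t u, 0 <= t -> t <= u ->
    mdist (m (alpha t) (alpha 0) (alpha u)) (alpha t) <= M.
Proof.
have [K K1 hK] := hm 2%N; have K0 : 0 < K by exact: lt_le_trans ltr01 K1.
have [M M0 hM] := ray_near_interval Xgeo alpha_qg alpha_Morse K1; have [L0 _] := hL.
exists (L * (M + 2 * K) + K + M).
  by rewrite !addr_ge0 ?mulr_ge0 ?addr_ge0 // ?ltW // mulr_gt0.
move=> t u t0 tu.
have [| |Q [f [CAT0 fm fq fs]]] := hK [:: alpha 0; alpha u]; [by []|by []|].
have [ o ho] := fs (alpha 0) ltac:(by rewrite !inE eqxx ?orbT).
have [b hb] := fs (alpha u) ltac:(by rewrite !inE eqxx ?orbT).
have [v bv hv] := hM Q f 0 t u o b CAT0 fq (lexx _) t0 tu ho hb.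
have h1 : mdist (m (alpha t) (alpha 0) (alpha u)) (f v) <= L * (M + 2 * K) + K.
  apply: (median_model CAT0 hL fm (median_between CAT0 bv)).
  by move: ho hb hv; clear; lra.
have := metric_triangle (m (alpha t) (alpha 0) (alpha u)) (f v) (alpha t).
by rewrite (metric_sym (f v)); move: h1 hv; clear; lra.
Qed.

(** The gate of x on the longer segment is near alpha w with w bounded in terms
    of x. For t larger than w, it is coarsely fixed by the gate map of the
    shorter segment, and by [median_initial] that map sends it near the gate
    of x. *)
Lemma gate_stable (R : realType) (X : metricType R) (Xgeo : geodesic_space X)
    (C : R) (alpha : R -> X) (alpha_qg : quasi_geodesic_ray C C alpha)
    (alpha_Morse : Morse alpha)
    (m : X -> X -> X -> X) (L : R) (hL : lipschitz_median m L) (hm : locally_modelled m) :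
  exists2 M : R, 0 <= M & forall x, exists2 T, 0 <= T & forall t u, T <= t -> t <= u ->
    mdist (m x (alpha 0) (alpha t)) (m x (alpha 0) (alpha u)) <= M.
Proof.
have [K K1 hK] := hm 3%N; have K0 : 0 < K by exact: lt_le_trans ltr01 K1.
have [M1 M10 h1] := gate_near_ray Xgeo alpha_Morse hL hm.
have [M3 M30 h3] := gate_ray Xgeo alpha_qg alpha_Morse hL hm.
have [M M0 hM] := ray_near_interval Xgeo alpha_qg alpha_Morse K1.
have C1 := ray_C1 alpha_qg; have C0 : 0 < C by exact: lt_le_trans ltr01 C1.
have [L0 lip] := hL.
pose e := L * (M + 2 * K) + K; pose e' := L * (3 * K) + K.
have K20 : 0 <= 2 * K by rewrite mulr_ge0 // ltW.
have K30 : 0 <= 3 * K by rewrite mulr_ge0 // ltW.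
have e0 : 0 <= e by rewrite /e !(addr_ge0, mulr_ge0) // ltW.
have e'0 : 0 <= e' by rewrite /e' !(addr_ge0, mulr_ge0) // ltW.
pose e2 := L * (e' + M1 + K + M) + K.
have e20 : 0 <= e2 by rewrite /e2 !(addr_ge0, mulr_ge0) // ltW.
exists (e + e2 + M3 + M1); first by rewrite !(addr_ge0, mulr_ge0) // ltW.
move=> x; pose T := C * (M1 + (L * mdist x (alpha 0) + M3) + C).
have T0 : 0 <= T.
  by rewrite /T !(addr_ge0, mulr_ge0) ?mdist_ge0 // ltW.
exists T => // t u Tt tu; have t0 : 0 <= t by exact: le_trans Tt.
have u0 : 0 <= u by exact: le_trans tu.
have [w w0 hw] := h1 x u u0.
have wt : w <= t.
  apply: le_trans Tt; have := ray_param alpha_qg w0 (lexx 0); rewrite subr0 ger0_norm //.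
  move/le_trans; apply; rewrite /T ler_pM2l // lerD2r.
  have g1 := lip x (alpha 0) (alpha u) (alpha 0) (alpha 0) (alpha u).
  rewrite !mdistxx !addr0 in g1.
  have g2 := h3 0 u (lexx _) u0.
  have g3 := metric_triangle (alpha w) (m x (alpha 0) (alpha u)) (alpha 0).
  have g4 := metric_triangle (m x (alpha 0) (alpha u)) (m (alpha 0) (alpha 0) (alpha u)) (alpha 0).
  rewrite (metric_sym (alpha w) (m _ _ _)) in g3.
  by move: g1 g2 g3 g4 hw; clear; lra.
have [| |Q [f [CAT0 fm fq fs]]] := hK [:: x; alpha 0; alpha u]; [by []|by []|].
have [x' hx] := fs x ltac:(by rewrite !inE eqxx ?orbT).
have [ o ho] := fs (alpha 0) ltac:(by rewrite !inE eqxx ?orbT).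
have [b hb] := fs (alpha u) ltac:(by rewrite !inE eqxx ?orbT).
have [v bv hv] := hM Q f 0 t u o b CAT0 fq (lexx _) t0 tu ho hb.
have [p hp] := median_exists CAT0 x' o b.
have [q hq] := median_exists CAT0 x' o v.
have g1 : mdist (m x (alpha 0) (alpha t)) (f q) <= e.
  by apply: (median_model CAT0 hL fm hq); move: hx ho hv; clear; lra.
have g2 : mdist (m x (alpha 0) (alpha u)) (f p) <= e'.
  by apply: (median_model CAT0 hL fm hp); move: hx ho hb; clear; lra.
have g3 : mdist (m (alpha w) (alpha 0) (alpha t)) (f q) <= e2.
  apply: (median_model CAT0 hL fm (median_initial CAT0 bv hp hq)).
  have := metric_triangle (alpha w) (m x (alpha 0) (alpha u)) (f p).
  rewrite (metric_sym (alpha w) (m _ _ _)).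
  by move: g2 hw ho hv; clear; lra.
have g4 := h3 w t w0 wt.
have k1 := metric_triangle (m x (alpha 0) (alpha t)) (f q) (m x (alpha 0) (alpha u)).
have k2 := metric_triangle (f q) (m (alpha w) (alpha 0) (alpha t)) (m x (alpha 0) (alpha u)).
have k3 := metric_triangle (m (alpha w) (alpha 0) (alpha t)) (alpha w) (m x (alpha 0) (alpha u)).
rewrite (metric_sym (f q) (m (alpha w) _ _)) in k2.
rewrite (metric_sym (alpha w) (m x _ _)) in k3.
by move: k1 k2 k3 g1 g3 g4 hw; clear; lra.
Qed.

(** The top p1 of the left side of the truncated rectangle is near some alpha w
    by the Morse property. Its gate is p, while alpha w is its own gate up to
    bounded error; so p1 is near p, which bounds the truncated height T. *)
Lemma gate_contracting (R : realType) (X : metricType R) (Xgeo : geodesic_space X)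
    (C : R) (alpha : R -> X) (alpha_qg : quasi_geodesic_ray C C alpha)
    (alpha_Morse : Morse alpha)
    (m : X -> X -> X -> X) (L : R) (hL : lipschitz_median m L) (hm : locally_modelled m) :
  exists kappa B : R, [/\ 0 < kappa, 0 <= B &
    forall x y, mdist x y < kappa * dist_set x (trace alpha) ->
      exists2 T, 0 <= T & forall t, T <= t ->
        mdist (m x (alpha 0) (alpha t)) (m y (alpha 0) (alpha t)) <= B].
Proof.
have [K K1 hK] := hm 4%N; have K0 : 0 < K by exact: lt_le_trans ltr01 K1.
have [M3 M30 h3] := gate_ray Xgeo alpha_qg alpha_Morse hL hm.
have [M M0 hM] := interval_near_ray Xgeo alpha_Morse K1.
pose q0 := 3 * K + M.
have q01 : 1 <= q0 by move: K1 M0; rewrite /q0; clear; lra.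
have [M6 M60 h6] := discrete_Morse Xgeo alpha_Morse q01.
have C1 := ray_C1 alpha_qg; have C0 : 0 < C by exact: lt_le_trans ltr01 C1.
have [L0 lip] := hL.
pose e' := L * (3 * K) + K.
have K20 : 0 <= 2 * K by rewrite mulr_ge0 // ltW.
have K30 : 0 <= 3 * K by rewrite mulr_ge0 // ltW.
have e'0 : 0 <= e' by rewrite /e' !(addr_ge0, mulr_ge0) // ltW.
pose e := L * (M6 + 2 * K) + K + M3 + M6.
have e0 : 0 <= e.
  by rewrite /e !(addr_ge0, mulr_ge0) // ltW.
pose T0 := K * (e + K).
have T00 : 0 <= T0 by rewrite /T0 !(addr_ge0, mulr_ge0) // ltW.
pose c0 := K * (K * (3 * K) + T0) + 2 * K + M.
have c00 : 0 <= c0.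
  have h : 0 <= K * (K * (3 * K) + T0).
    by rewrite !(addr_ge0, mulr_ge0) // ltW.
  by rewrite /c0; move: h K0 M0; clear; lra.
pose kappa := 1 / (2 * K ^+ 2).
have k0 : 0 < kappa by rewrite divr_gt0 // mulr_gt0 // exprn_gt0.
have k1 : kappa <= 1.
  rewrite ler_pdivrMr ?mul1r ?mulr_gt0 ?exprn_gt0 //.
  by have := exprn_ege1 2 K1; clear; lra.
exists kappa, (K * T0 + K + 2 * e' + L * (2 * c0)); split => //.
  by rewrite !(addr_ge0, mulr_ge0) // ltW.
move=> x y hxy; pose d0 := mdist x (alpha 0).
have d00 : 0 <= d0 by exact: mdist_ge0.
(* f p1 lies within b1 - M6 of alpha 0, so the point of the ray near f p1 has
   parameter at most Tx, hence at most t. *)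
pose b0 := e' + (L * d0 + M3).
pose b1 := M6 + (K * (K * (K + d0 + b0 + K)) + K) + b0.
pose Tx := C * (b1 + C).
have b00 : 0 <= b0 by rewrite /b0 !(addr_ge0, mulr_ge0) // ltW.
have b10 : 0 <= b1.
  by rewrite /b1 !(addr_ge0, mulr_ge0) // ltW.
have Tx0 : 0 <= Tx by rewrite /Tx !(addr_ge0, mulr_ge0) // ltW.
exists Tx => // t Txt; have t0 : 0 <= t by exact: le_trans Txt.
have [| |Q [f [CAT0 fm fq fs]]] := hK [:: x; y; alpha 0; alpha t]; [by []|by []|].
have [x' hx] := fs x ltac:(by rewrite !inE eqxx ?orbT).
have [y' hy] := fs y ltac:(by rewrite !inE eqxx ?orbT).
have [ o ho] := fs (alpha 0) ltac:(by rewrite !inE eqxx ?orbT).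
have [b hb] := fs (alpha t) ltac:(by rewrite !inE eqxx ?orbT).
have [p hp] := median_exists CAT0 x' o b.
have [q hq] := median_exists CAT0 y' o b.
have gx : mdist (m x (alpha 0) (alpha t)) (f p) <= e'.
  by apply: (median_model CAT0 hL fm hp); move: hx ho hb; clear; lra.
have gy : mdist (m y (alpha 0) (alpha t)) (f q) <= e'.
  by apply: (median_model CAT0 hL fm hq); move: hy ho hb; clear; lra.
have [sp sp0 hsp] := hM Q f 0 t o b p CAT0 fq (lexx _) t0 ho hb ltac:(by case: hp).
have [sq sq0 hsq] := hM Q f 0 t o b q CAT0 fq (lexx _) t0 ho hb ltac:(by case: hq).
have [u [bxyu bxpu pqxy rect]] := rectangle CAT0 hp hq.
pose D := gdist p q; pose H := gdist u p; pose T := minn D H.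
have [|p1 [q1 [[eT1 eT2 eD] [bt1 bt2 mp1 far]]]] := rect T; first exact: geq_minr.
have [c [cc0 cT cN cd]] := rectangle_chain CAT0 (geq_minl D H) eT1 eT2 eD bt1 bt2 far.
have K3 : 3 * K <= q0 by rewrite /q0 lerDl.
have Mq0 : M <= q0 by rewrite /q0 lerDr mulr_ge0 // ltW.
have hq0 := qi_embedding_chain K1 K3 fq cd.
have [w w0 hw] : exists2 w, 0 <= w & mdist (f p1) (alpha w) <= M6.
  have := h6 _ _ sp sq hq0 sp0 sq0; rewrite /= cc0 cN.
  rewrite (metric_sym (alpha sp)) (metric_sym (alpha sq)).
  move=> /(_ (le_trans hsp Mq0) (le_trans hsq Mq0) T); rewrite /= cT; apply.
  by rewrite -addnA leq_addr.
have fp0 : mdist (f p) (alpha 0) <= b0.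
  have g1 := lip x (alpha 0) (alpha t) (alpha 0) (alpha 0) (alpha t).
  rewrite !mdistxx !addr0 -/d0 in g1; have g2 := h3 0 t (lexx _) t0.
  have g3 := metric_triangle (f p) (m x (alpha 0) (alpha t)) (alpha 0).
  have g4 := metric_triangle (m x (alpha 0) (alpha t)) (m (alpha 0) (alpha 0) (alpha t)) (alpha 0).
  rewrite (metric_sym (f p) (m _ _ _)) in g3.
  by move: g1 g2 g3 g4 gx; rewrite /b0; clear; lra.
have xp : (gdist u p <= gdist x' p)%N by rewrite -bxpu leq_addl.
have wt : w <= t.
  apply: le_trans Txt; have := ray_param alpha_qg w0 (lexx 0); rewrite subr0 ger0_norm //.
  move/le_trans; apply; rewrite /Tx ler_pM2l // lerD2r.
  have g1 := qi_embedding_gdist x' p K1 fq.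
  have g2 := metric_triangle (f x') x (f p); rewrite (metric_sym (f x') x) in g2.
  have g3 := metric_triangle x (alpha 0) (f p); rewrite (metric_sym (alpha 0) (f p)) in g3.
  have g4 : (gdist p1 p)%:R <= K * (K + d0 + b0 + K).
    apply: (@le_trans _ _ (gdist x' p)%:R).
      by rewrite ler_nat (leq_trans _ xp) // gdistC // eT1 geq_minr.
    apply: le_trans g1 _; rewrite ler_pM2l //.
    by move: g2 g3 hx fp0; rewrite -/d0; clear; lra.
  have /andP[_ g5] := fq p1 p.
  have g6 : K * (gdist p1 p)%:R <= K * (K * (K + d0 + b0 + K)) by rewrite ler_pM2l.
  have g7 := metric_triangle (alpha w) (f p1) (alpha 0).
  have g8 := metric_triangle (f p1) (f p) (alpha 0).
  rewrite (metric_sym (alpha w) (f p1)) in g7.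
  by move: g5 g6 g7 g8 hw fp0; rewrite /b1; clear; lra.
have TT0 : T%:R <= T0.
  have g1 : mdist (m (alpha w) (alpha 0) (alpha t)) (f p) <= L * (M6 + 2 * K) + K.
    apply: (median_model CAT0 hL fm mp1); rewrite (metric_sym (alpha w)).
    by move: hw ho hb; clear; lra.
  have g2 := h3 w t w0 wt.
  have g3 := metric_triangle (f p) (m (alpha w) (alpha 0) (alpha t)) (f p1).
  have g4 := metric_triangle (m (alpha w) (alpha 0) (alpha t)) (alpha w) (f p1).
  rewrite (metric_sym (f p) (m _ _ _)) in g3.
  rewrite (metric_sym (alpha w) (f p1)) in g4.
  have g5 := qi_embedding_gdist p p1 K1 fq; rewrite eT1 in g5.
  apply: le_trans g5 _; rewrite ler_pM2l // lerD2r.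
  by move: g1 g2 g3 g4 hw; rewrite /e; clear; lra.
have Lc0 : 0 <= L * (2 * c0) by rewrite !mulr_ge0.
have KT0 : 0 <= K * T0 by rewrite mulr_ge0 // ltW.
have [TD|TH] : T = D \/ T = H by rewrite /T /minn; case: ifP; [left|right].
  have /andP[_ g1] := fq p q; rewrite -/D -TD in g1.
  have g2 : K * T%:R <= K * T0 by rewrite ler_pM2l.
  have g3 := metric_triangle (m x (alpha 0) (alpha t)) (f p) (m y (alpha 0) (alpha t)).
  have g4 := metric_triangle (f p) (f q) (m y (alpha 0) (alpha t)).
  rewrite (metric_sym (f q)) in g4.
  by move: g1 g2 g3 g4 gx gy Lc0; clear; lra.
(* The rectangle is low: x is within a multiple of d(x, y) of p up to a
   constant, and kappa makes that multiple less than half of dx. *)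
pose dx := dist_set x (trace alpha).
have dx0 : 0 <= dx by exact: dist_set_ge0.
have hdx : dx <= mdist x (alpha sp) by apply: dist_set_le (lexx _); exact: trace_ray.
have g1 : (gdist x' y')%:R <= K * (mdist x y + 3 * K).
  apply: le_trans (qi_embedding_gdist x' y' K1 fq) _; rewrite ler_pM2l //.
  have := metric_triangle (f x') x (f y'); have := metric_triangle x y (f y').
  by rewrite (metric_sym (f x') x); move: hx hy; clear; lra.
have g2 : (gdist x' p)%:R <= (gdist x' y')%:R + T0.
  have : (gdist x' p <= gdist x' y' + T)%N.
    by rewrite -bxpu TH leq_add2r -bxyu leq_addr.
  by rewrite -(ler_nat R) natrD; move: TT0; clear; lra.
have /andP[_ g3] := fq x' p.
have g4 : K * (gdist x' p)%:R <= K * (K * (mdist x y + 3 * K) + T0).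
  by rewrite ler_pM2l //; move: g1 g2; clear; lra.
have g5 := metric_triangle x (f x') (alpha sp).
have g6 := metric_triangle (f x') (f p) (alpha sp).
have g7 : K * (K * (mdist x y + 3 * K) + T0) =
   K ^+ 2 * mdist x y + K * (K * (3 * K) + T0) by ring.
have g8 : K ^+ 2 * mdist x y <= dx / 2.
  have -> : dx / 2 = K ^+ 2 * (kappa * dx) by rewrite /kappa; field; rewrite gt_eqF.
  by rewrite ler_pM2l ?exprn_gt0 // ltW.
have g9 : dx <= 2 * c0.
  by rewrite /c0; move: hdx g3 g4 g5 g6 g7 g8 hx hsp; clear; lra.
have g10 : kappa * dx <= dx by rewrite ler_piMl.
have g11 := lip x (alpha 0) (alpha t) y (alpha 0) (alpha t).
rewrite !mdistxx !addr0 in g11.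
have g12 : L * mdist x y <= L * (2 * c0).
  by rewrite ler_wpM2l //; move: hxy g9 g10; rewrite -/dx; clear; lra.
by move: g11 g12 KT0 K0 e'0; clear; lra.
Qed.

Theorem Morse_contracting (R : realType) (X : metricType R) (Xgeo : geodesic_space X)
    (XLQC : LQC X) (C : R) (alpha : R -> X) (alpha_qg : quasi_geodesic_ray C C alpha) :
  Morse alpha -> contracting alpha.
Proof.
move=> alpha_Morse; have [m [h [v [cm _ _ lc]]]] := XLQC.
have hL : lipschitz_median m ((h 1%N)%:R : R).
  by split => // *; exact: coarse_median_lipschitz.
set L : R := (h 1%N)%:R in hL; have [L0 lip] := hL.
have hm : locally_modelled m := LQC_cubical_model cm lc.
have [M1 M10 h1] := gate_near_ray Xgeo alpha_Morse hL hm.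
have [M3 M30 h3] := gate_ray Xgeo alpha_qg alpha_Morse hL hm.
have [M5 M50 h5] := gate_stable Xgeo alpha_qg alpha_Morse hL hm.
have [kappa [B [k0 B0 h4]]] := gate_contracting Xgeo alpha_qg alpha_Morse hL hm.
pose r := M1 + M5; have r0 : 0 <= r by rewrite addr_ge0.
pose G (x : X) (t : R) : X := m x (alpha 0) (alpha t).
pose pi (x : X) : set X := [set p | trace alpha p /\
   exists2 T, 0 <= T & forall t, T <= t -> mdist p (G x t) <= r].
have common x y p q : pi x p -> pi y q -> forall T, exists t,
    [/\ 0 <= t, T <= t, mdist p (G x t) <= r & mdist q (G y t) <= r].
  move=> [_ [T1 T10 hp]] [_ [T2 T20 hq]] T; exists (Num.max T (Num.max T1 T2)).
  split; [|by rewrite le_max lexx|apply: hp|apply: hq]; rewrite !le_max ?T10 ?lexx ?orbT //.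
have diam_pi x p q : pi x p -> pi x q -> mdist p q <= 2 * r.
  move=> hp hq; have [t [_ _ g1 g2]] := common _ _ _ _ hp hq 0.
  by have := metric_triangle p (G x t) q; rewrite (metric_sym (G x t) q); move: g1 g2; clear; lra.
exists pi, L, (1 + L + M3 + 2 * r), kappa, (B + 2 * r); split => //.
- move=> x; split; last by move=> p [].
  have [T T0 hT] := h5 x; have [u u0 hu] := h1 x T T0.
  exists (alpha u); split; first exact: trace_ray.
  exists T => // t Tt; have := metric_triangle (alpha u) (G x T) (G x t).
  rewrite (metric_sym (alpha u) (G x T)); have := hT T t (lexx _) Tt.
  by move: hu; rewrite -/(G x T) -/(G x t) /r; clear; lra.
- move=> x; pose d := dist_set x (trace alpha); rewrite -/d.
  have d0 : 0 <= d by exact: dist_set_ge0.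
  have [_ [s s0 <-] hs] : exists2 a, trace alpha a & mdist x a < d + 1.
    by apply: dist_set_lt; [exact: trace_nonempty|rewrite ltrDl].
  have Ld : 0 <= L * d by rewrite mulr_ge0.
  have near p : pi x p -> mdist x p <= (L + 1) * d + (1 + L + M3 + 2 * r).
    move=> hp; have [t [t0 st g1 _]] := common _ _ _ _ hp hp s.
    have g2 := h3 s t s0 st; rewrite -/(G _ _) in g2.
    have g3 := lip x (alpha 0) (alpha t) (alpha s) (alpha 0) (alpha t).
    rewrite !mdistxx !addr0 -!/(G _ _) in g3.
    have g4 : L * mdist x (alpha s) <= L * (d + 1) by rewrite ler_wpM2l // ltW.
    have g5 := metric_triangle x (alpha s) p.
    have g6 := metric_triangle (alpha s) (G (alpha s) t) p.
    have g7 := metric_triangle (G (alpha s) t) (G x t) p.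
    rewrite (metric_sym (alpha s) (G _ _)) in g6.
    rewrite (metric_sym (G x t) p) (metric_sym (G (alpha s) t) (G x t)) in g7.
    by move: g1 g2 g3 g4 g5 g6 g7 hs r0; clear; lra.
  apply: ge_ereal_sup => _ [[p q] /= [hp hq] <-]; rewrite lee_fin.
  case: hp hq => [->|hp] [->|hq].
  + by rewrite mdistxx; move: Ld d0 r0 L0 M30; clear; lra.
  + exact: near.
  + by rewrite metric_sym; exact: near.
  + by have := diam_pi _ _ _ hp hq; move: Ld d0 r0 L0 M30; clear; lra.
move=> x y hxy; have [T T0 hT] := h4 x y hxy.
have cross p q : pi x p -> pi y q -> mdist p q <= B + 2 * r.
  move=> hp hq; have [t [t0 Tt g1 g2]] := common _ _ _ _ hp hq T.
  have g3 := hT t Tt; rewrite -!/(G _ _) in g3.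
  have g4 := metric_triangle p (G x t) q; have g5 := metric_triangle (G x t) (G y t) q.
  by rewrite (metric_sym (G y t) q) in g5; move: g1 g2 g3 g4 g5; clear; lra.
apply: ge_ereal_sup => _ [[p q] /= [hp hq] <-]; rewrite lee_fin.
case: hp hq => hp [] hq.
- by have := diam_pi _ _ _ hp hq; move: B0; clear; lra.
- exact: cross.
- by rewrite metric_sym; exact: cross.
- by have := diam_pi _ _ _ hp hq; move: B0; clear; lra.
Qed.

Theorem corollary5 (R : realType) (X : metricType R)
  (Xproper : proper_space X) (Xgeodesic : geodesic_space X) (XLQC : LQC X)
  (C : R) (alpha : R -> X) (alpha_qg : quasi_geodesic_ray C C alpha) :
  (Morse alpha <-> contracting alpha) /\
  (contracting alpha <-> at_least_quadratic_divergence C alpha).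
Proof.
have Morse_contr := Morse_contracting Xgeodesic XLQC alpha_qg.
have contr_div := contracting_quadratic_divergence alpha_qg.
have div_Morse := quadratic_divergence_Morse Xgeodesic alpha_qg.
by split; split; auto.
Qed.
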